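(* Let $G=G_1\times\cdots\times G_k$ be a product of at least two locally compact second countable groups and $\mu=\mu_1\times\cdots\times\mu_k$ an admissible probability measure on $G$. Let $(X,\nu)$ be an ergodic $(G,\mu)$-space and let $(B,\beta)$ be the Poisson boundary of $(G,\mu)$. Let $(A,\alpha)$ be an intermediate factor $$(B,\beta)\curlyvee(X,\nu)\to(A,\alpha)\to(X,\nu),$$ where the maps are $G$-maps that compose to the natural projection map. Then $A$ is isomorphic to the relative independent joining of $A_1\times\cdots\times A_k$ and $X$ over their common factor $X_1\times\cdots\times X_k$.
   Context: Admissible: nonsingular with respect to Haar measure and with support generating the group. A $(G,\mu)$-space is a probability space $(X,\nu)$ with a quasi-invariant $G$-action such that $\mu*\nu=\nu$. A $G$-map is a $G$-equivariant measurable map carrying the measure on the domain to the measure on the target. Stationary joining: for $(G,\mu)$-spaces $(X,\nu)$ and $(Y,\eta)$, let $\nu_\omega=\lim_n\omega_1\cdots\omega_n\nu$ and $\eta_\omega=\lim_n\omega_1\cdots\omega_n\eta$ (weak* limits in compact models) be the conditional measures, defined for $\mu^{\mathbb{N}}$-almost every $\omega\in G^{\mathbb{N}}$. The $\mu$-stationary joining $(X,\nu)\curlyvee(Y,\eta)$ is $X\times Y$ with the diagonal action and the $\mu$-stationary measure $\int_{G^{\mathbb{N}}}\nu_\omega\times\eta_\omega\,d\mu^{\mathbb{N}}(\omega)$. Invariant products functor: for a $G$-space $(Y,\eta)$ and each $j$, let $\check G_j=\prod_{i\neq j}G_i$ and let $(Y_j,\eta_j)$ be the space of $\check G_j$-ergodic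 components of $(Y,\eta)$, which is a $G_j$-space. The associated $G$-map is $(Y,\eta)\to(Y_1,\eta_1)\times\cdots\times(Y_k,\eta_k)$. The spaces $A_j$ and $X_j$ in the claim are obtained in this way from $A$ and $X$. *)

(* Defs.v *)
From HB Require Import structures.
From mathcomp Require Import all_boot all_order all_algebra.
From mathcomp Require Import all_classical all_reals all_analysis.
From mathcomp Require Import measurable_realfun.

Set Implicit Arguments.
Unset Strict Implicit.
Unset Printing Implicit Defensive.

Import Order.TTheory GRing.Theory Num.Theory.
Import numFieldTopology.Exports.

Local Open Scope classical_set_scope.
Local Open Scope ring_scope.
Local Open Scope group_scope.

HB.mixin Record Topological_isTopologicalGroup G of Topological G & Group G := {
  mulg_continuous : continuous (fun xy : G * G => xy.1 * xy.2 : G) ;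
  invg_continuous : continuous (fun x : G => x^-1 : G)
}.

#[short(type="topGroupType")]
HB.structure Definition TopologicalGroup :=
  {G of Topological G & Group G & Topological_isTopologicalGroup G}.

Definition lcsc (G : topGroupType) : Prop :=
  [/\ hausdorff_space G, locally_compact [set: G] & @second_countable G].

(* Measurable types are pointed; a group is pointed by its unit. *)
Definition pointed_group (G : topGroupType) : Type := G.
HB.instance Definition _ (G : topGroupType) :=
  Choice.copy (pointed_group G) G.
HB.instance Definition _ (G : topGroupType) :=
  isPointed.Build (pointed_group G) (1 : G).

Notation borel G :=
  (g_sigma_algebraType (T := pointed_group G) (@open G)).

Section product_group.
Context (I : eqType) (G : I -> topGroupType).

Definition prod_group : Type := prod_topology G.

HB.instance Definition _ := Topological.on prod_group.

Definition prod_one : prod_group := fun i => 1.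
Definition prod_mul (x y : prod_group) : prod_group := fun i => x i * y i.
Definition prod_inv (x : prod_group) : prod_group := fun i => (x i)^-1.

Let prod_mulA : associative prod_mul.
Proof.
by move=> x y z; apply: functional_extensionality_dep => i; exact: mulgA.
Qed.

Let prod_mul1 : left_id prod_one prod_mul.
Proof.
by move=> x; apply: functional_extensionality_dep => i; exact: mul1g.
Qed.

Let prod_mulr1 : right_id prod_one prod_mul.
Proof.
by move=> x; apply: functional_extensionality_dep => i; exact: mulg1.
Qed.

Let prod_mulV : left_inverse prod_one prod_inv prod_mul.
Proof.
by move=> x; apply: functional_extensionality_dep => i; exact: mulVg.
Qed.

Let prod_mulrV : right_inverse prod_one prod_inv prod_mul.
Proof.
by move=> x; apply: functional_extensionality_dep => i; exact: mulgV.
Qed.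

HB.instance Definition _ := isGroup.Build prod_group
  prod_mulA prod_mul1 prod_mulr1 prod_mulV prod_mulrV.

Lemma prod_group_proj_continuous i : continuous (fun x : prod_group => x i).
Proof. exact: (@proj_continuous I G i). Qed.

Lemma prod_group_continuous (T : topologicalType) (f : T -> prod_group) :
  (forall i, continuous (fun t => f t i)) -> continuous f.
Proof.
move=> cf t; apply/cvg_sup => i U [V] [[W oW <-] WfN] WU.
apply: (filterS WU).
by apply: (cf i t); apply: open_nbhs_nbhs.
Qed.

Let prod_mul_continuous :
  continuous (fun xy : prod_group * prod_group => xy.1 * xy.2 : prod_group).
Proof.
apply: prod_group_continuous => i xy.
have h : (fun z : prod_group * prod_group => (z.1 i, z.2 i)) @ xy -->
    (xy.1 i, xy.2 i).
  apply: cvg_pair => /=.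
    apply: (@cvg_comp _ _ _ fst (fun z : prod_group => z i));
      [exact: cvg_fst|exact: prod_group_proj_continuous].
  apply: (@cvg_comp _ _ _ snd (fun z : prod_group => z i));
    [exact: cvg_snd|exact: prod_group_proj_continuous].
exact: cvg_comp h (@mulg_continuous (G i) (xy.1 i, xy.2 i)).
Qed.

Let prod_inv_continuous : continuous (fun x : prod_group => x^-1 : prod_group).
Proof.
apply: prod_group_continuous => i x.
exact: cvg_comp (@prod_group_proj_continuous i x)
  (@invg_continuous (G i) (x i)).
Qed.

HB.instance Definition _ := Topological_isTopologicalGroup.Build prod_group
  prod_mul_continuous prod_inv_continuous.

End product_group.

Definition cylinders (I : Type) (d : I -> measure_display)
    (T : forall i, measurableType (d i)) : set (set (forall i, T i)) :=
  [set A | exists i (B : set (T i)), measurable B /\ A = [set f | B (f i)]].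

Arguments cylinders {I d} T.

Notation prodm T := (g_sigma_algebraType (cylinders T)).

(* Under P the maps pr i are independent with laws m i; when the pr i are the
   coordinates of a product space, P is the product of the measures m i. *)
Definition is_product_law (R : realType) (I : eqType) (d : I -> measure_display)
    (T : forall i, measurableType (d i)) d' (S : measurableType d')
    (pr : forall i, S -> T i) (m : forall i, probability (T i) R)
    (P : probability S R) : Prop :=
  forall (s : seq I) (E : forall i, set (T i)), uniq s ->
    (forall i, measurable (E i)) ->
    P (\bigcap_(i in [set` s]) (pr i @^-1` E i)) =
    (\prod_(i <- s) fine (m i (E i)))%R%:E.

Definition standard_borel (R : realType) d (X : measurableType d) : Prop :=
  exists (P : completePseudoMetricType R) (f : X -> P),
    [/\ hausdorff_space P,
        exists2 D : set P, countable D & dense D,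
        bijective f &
        forall A : set X, measurable A <-> <<s @open P >> (f @` A)].

Record gspace (G : topGroupType) := GSpace {
  gs_display : measure_display ;
  gs_carrier :> measurableType gs_display ;
  act : G -> gs_carrier -> gs_carrier ;
  act1 : forall x, act 1 x = x ;
  actM : forall g h x, act (g * h) x = act g (act h x) ;
  measurable_act : measurable_fun [set: borel G * gs_carrier]
    (fun gx : borel G * gs_carrier => act gx.1 gx.2)
}.

Section gspace_prod.
Context (G : topGroupType) (X Y : gspace G).

Let prod_act (g : G) (z : X * Y) : X * Y := (act g z.1, act g z.2).

Let prod_act1 z : prod_act 1 z = z.
Proof. by case: z => x y; rewrite /prod_act/= !act1. Qed.

Let prod_actM g h z : prod_act (g * h) z = prod_act g (prod_act h z).
Proof. by rewrite /prod_act !actM. Qed.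

Let measurable_prod_act : measurable_fun [set: borel G * (X * Y)]
  (fun gz : borel G * (X * Y) => prod_act gz.1 gz.2).
Proof.
apply: measurable_fun_pair.
- apply: (measurableT_comp (@measurable_act _ X)
    (g := fun gz : borel G * (X * Y) => (gz.1, gz.2.1))).
  apply: measurable_fun_pair => //.
  exact: measurableT_comp measurable_fst measurable_snd.
- apply: (measurableT_comp (@measurable_act _ Y)
    (g := fun gz : borel G * (X * Y) => (gz.1, gz.2.2))).
  apply: measurable_fun_pair => //.
  exact: measurableT_comp measurable_snd measurable_snd.
Qed.

Definition gspace_prod : gspace G :=
  GSpace prod_act1 prod_actM measurable_prod_act.

End gspace_prod.

Section gspace_pi.
Context (I : eqType) (G : I -> topGroupType) (Y : forall i, gspace (G i)).

Let pi_act (g : prod_group G) (y : prodm Y) : prodm Y :=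
  fun i => act (g i) (y i).

Let pi_act1 y : pi_act 1 y = y.
Proof. by apply: functional_extensionality_dep => i; exact: act1. Qed.

Let pi_actM g h y : pi_act (g * h) y = pi_act g (pi_act h y).
Proof. by apply: functional_extensionality_dep => i; exact: actM. Qed.

Let measurable_pi_act : measurable_fun [set: borel (prod_group G) * prodm Y]
  (fun gy : borel (prod_group G) * prodm Y => pi_act gy.1 gy.2).
Proof.
apply: (@measurability _ _ _ (prodm Y) _ _ (cylinders Y)) => //.
move=> _ [_ [i [B [mB ->]]] <-].
suff H : measurable_fun [set: borel (prod_group G) * prodm Y]
  (fun gy : borel (prod_group G) * prodm Y => (gy.1 i : borel (G i), gy.2 i)).
  exact: (measurableT_comp (@measurable_act _ (Y i)) H).
apply: measurable_fun_pair.
- have mp : measurable_fun [set: borel (prod_group G)]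
      (fun g : borel (prod_group G) => g i : borel (G i)).
    apply: (@measurability _ _ _ (borel (G i)) _ _ (@open (G i))) => //.
    move=> _ [U oU <-]; rewrite setTI; apply: sub_sigma_algebra.
    by move/continuousP: (@prod_group_proj_continuous I G i); exact.
  exact: measurableT_comp mp measurable_fst.
- have mp : measurable_fun [set: prodm Y] (fun y : prodm Y => y i).
    move=> _ C mC.
    by rewrite setTI; apply: sub_sigma_algebra; exists i, C.
  exact: measurableT_comp mp measurable_snd.
Qed.

Definition gspace_pi : gspace (prod_group G) :=
  GSpace pi_act1 pi_actM measurable_pi_act.

End gspace_pi.

Section measures_on_group.
Context (R : realType) (G : topGroupType).

Definition left_haar (m : {measure set (borel G) -> \bar R}) : Prop :=
  [/\ forall (g : G) (E : set (borel G)), measurable E ->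
        m [set x | E ((g : G) * x)] = m E,
      forall K : set G, compact K -> (m K < +oo)%E &
      forall U : set G, open U -> U !=set0 -> (0 < m U)%E].

Definition mutually_singular d (T : measurableType d)
    (m1 m2 : {measure set T -> \bar R}) : Prop :=
  exists N : set T, [/\ measurable N, m1 N = 0%E & m2 (~` N) = 0%E].

Definition measure_support (mu : probability (borel G) R) : set G :=
  [set g | forall U : set G, open U -> U g -> (0 < mu U)%E].

Definition is_subgroup (H : set G) : Prop :=
  [/\ H 1, forall x y, H x -> H y -> H (x * y) & forall x, H x -> H x^-1].

(* Nonsingular: not mutually singular with Haar measure (an absolutely
   continuous part is allowed to coexist with a singular one). *)
Definition admissible (mu : probability (borel G) R) : Prop :=
  (exists2 m : {measure set (borel G) -> \bar R},
     left_haar m & ~ mutually_singular mu m) /\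
  (forall H : set G, is_subgroup H -> measure_support mu `<=` H -> H = setT).

End measures_on_group.

Section gspaces.
Context (R : realType) (G : topGroupType).

Definition quasi_invariant (X : gspace G) (nu : probability X R) : Prop :=
  forall (g : G) (E : set X), measurable E ->
    nu (act g @^-1` E) = 0%E <-> nu E = 0%E.

(* mu * nu = nu *)
Definition stationary (mu : probability (borel G) R) (X : gspace G)
    (nu : probability X R) : Prop :=
  forall E : set X, measurable E ->
    (\int[mu]_g nu (act (g : G) @^-1` E))%E = nu E.

Definition gmu_space (mu : probability (borel G) R) (X : gspace G)
    (nu : probability X R) : Prop :=
  [/\ standard_borel R X, quasi_invariant nu & stationary mu nu].

(* As for maps of measure spaces in general, equivariance is modulo null sets:
   the null set may depend on the group element. *)
Definition gmap (X : gspace G) (nu : probability X R)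
    (Y : gspace G) (eta : probability Y R) (f : X -> Y) : Prop :=
  [/\ measurable_fun setT f,
      forall g : G, {ae nu, forall x, f (act g x) = act g (f x)} &
      forall E : set Y, measurable E -> nu (f @^-1` E) = eta E].

Definition gspace_isomorphic (X : gspace G) (nu : probability X R)
    (Y : gspace G) (eta : probability Y R) : Prop :=
  exists (f : X -> Y) (h : Y -> X),
    [/\ gmap nu eta f, gmap eta nu h,
        {ae nu, forall x, h (f x) = x} & {ae eta, forall y, f (h y) = y}].

Definition invariant_set (H : set G) (X : gspace G) (nu : probability X R)
    (E : set X) : Prop :=
  measurable E /\ forall g, H g -> nu ((act g @^-1` E) `+` E) = 0%E.

Definition ergodic (X : gspace G) (nu : probability X R) : Prop :=
  forall E : set X, invariant_set setT nu E -> nu E = 0%E \/ nu E = 1%E.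

(* p realizes the sigma-algebra of H-invariant sets of (Y, eta), modulo null
   sets, as a standard probability space (Z, zeta). *)
Definition ergodic_components (H : set G) (Y : gspace G) (eta : probability Y R)
    d (Z : measurableType d) (zeta : probability Z R) (p : Y -> Z) : Prop :=
  [/\ standard_borel R Z,
      measurable_fun setT p,
      forall E : set Z, measurable E -> eta (p @^-1` E) = zeta E,
      forall h, H h -> {ae eta, forall y, p (act h y) = p y} &
      forall E : set Y, invariant_set H eta E ->
        exists2 F : set Z, measurable F & eta (E `+` (p @^-1` F)) = 0%E].

End gspaces.

(* The copy of \prod_(i != j) G i inside the product group. *)
Definition cofactor_subgroup (I : eqType) (G : I -> topGroupType) (j : I) :
    set (prod_group G) := [set g | g j = 1].

Definition invariant_component (R : realType) (I : eqType)
    (G : I -> topGroupType) (j : I)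
    (Y : gspace (prod_group G)) (eta : probability Y R)
    (Yj : gspace (G j)) (etaj : probability Yj R) (p : Y -> Yj) : Prop :=
  [/\ ergodic_components (cofactor_subgroup j) eta etaj p,
      quasi_invariant etaj &
      forall g : prod_group G, {ae eta, forall y, p (act g y) = act (g j) (p y)}].

Section random_walk.
Context (R : realType) (G : topGroupType).

Notation paths := (prodm (fun _ : nat => borel G)).

(* The law of a sequence of independent mu-distributed increments. *)
Definition is_iid_law (mu : probability (borel G) R)
    (muN : probability paths R) : Prop :=
  is_product_law (fun (n : nat) (w : paths) => w n) (fun=> mu) muN.

(* w_0 * w_1 * ... * w_(n-1) *)
Fixpoint walk (w : nat -> G) (n : nat) : G :=
  if n is m.+1 then walk w m * w m else 1.

(* The Poisson boundary is the space of ergodic components of the time shift on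
   the path space of the random walk: bnd realizes the shift-invariant
   sigma-algebra, G acting on paths by left translation. *)
Definition poisson_boundary (mu : probability (borel G) R)
    (muN : probability paths R) (B : gspace G) (beta : probability B R) : Prop :=
  gmu_space mu beta /\
  exists bnd : paths -> B,
    [/\ measurable_fun setT bnd,
        forall E : set B, measurable E ->
          muN [set w : paths | E (bnd (walk w))] = beta E,
        forall g : G, {ae muN, forall w : paths,
          bnd (fun n => g * walk w n) = act g (bnd (walk w))},
        {ae muN, forall w : paths,
          bnd (fun n => walk w n.+1) = bnd (walk w)} &
        forall A : set paths, measurable A ->
          (forall x : paths, A (fun n => x n.+1) <-> A x) ->
          exists2 E : set B, measurable E &
            muN [set w : paths | ([set x | E (bnd x)] `+` A) (walk w)] = 0%E].

(* nu_w is the weak-* limit of w_0 ... w_(n-1) nu, taken in a compact model K of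
   X: a compact metrizable space with a continuous action into which X embeds
   equivariantly. *)
Definition conditional_measures (muN : probability paths R)
    (X : gspace G) (nu : probability X R) (nuw : paths -> probability X R) : Prop :=
  (forall E : set X, measurable E -> measurable_fun [set: paths] (nuw ^~ E)) /\
  exists (K : metricType R) (aK : G -> K -> K) (iota : X -> K),
    [/\ compact [set: K],
        continuous (fun gx : G * K => aK gx.1 gx.2) &
        (forall x, aK 1 x = x) /\
        (forall g h x, aK (g * h) x = aK g (aK h x))] /\
    [/\ injective iota,
        forall U : set K, open U -> measurable (iota @^-1` U),
        forall g x, iota (act g x) = aK g (iota x) &
        {ae muN, forall w : paths, forall f : K -> R, continuous f ->
          (fun n => \int[nu]_x f (iota (act (walk w n) x)))%R @ \oo -->
          (\int[nuw w]_x f (iota x))%R}].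

Definition stationary_joining (muN : probability paths R)
    (X : gspace G) (nu : probability X R) (Y : gspace G) (eta : probability Y R)
    (lambda : probability (gspace_prod X Y) R) : Prop :=
  exists (nuw : paths -> probability X R) (etaw : paths -> probability Y R),
    [/\ conditional_measures muN nu nuw,
        conditional_measures muN eta etaw &
        forall C : set (X * Y), measurable C ->
          lambda C = (\int[muN]_w (nuw w \x etaw w) C)%E].

End random_walk.

Section relative_joining.
Context (R : realType).

(* kappa is the family of fibre measures of u over p : (U, u) -> (Z, zeta). *)
Definition disintegration d (U : measurableType d) (u : probability U R)
    d' (Z : measurableType d') (zeta : probability Z R) (p : U -> Z)
    (kappa : Z -> probability U R) : Prop :=
  (forall E : set U, measurable E -> measurable_fun [set: Z] (kappa ^~ E)) /\
  (forall (E : set U) (F : set Z), measurable E -> measurable F ->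
     (\int[zeta]_(z in F) kappa z E)%E = u (E `&` p @^-1` F)).

Definition relative_independent_joining (G : topGroupType)
    (U : gspace G) (u : probability U R) (V : gspace G) (v : probability V R)
    (Z : gspace G) (zeta : probability Z R) (p : U -> Z) (q : V -> Z)
    (J : probability (gspace_prod U V) R) : Prop :=
  [/\ gmap u zeta p, gmap v zeta q &
      exists (kappa : Z -> probability U R) (kappa' : Z -> probability V R),
        [/\ disintegration u zeta p kappa, disintegration v zeta q kappa' &
            forall C : set (U * V), measurable C ->
              J C = (\int[zeta]_z (kappa z \x kappa' z) C)%E]].

End relative_joining.

(* Main.v *)
From HB Require Import structures.
Require Import Defs.
From mathcomp Require Import all_boot all_order all_algebra.
From mathcomp Require Import all_classical all_reals all_analysis.
From mathcomp Require Import measurable_realfun.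
From mathcomp Require finmap.
From mathcomp Require Import lra ring zify.

Set Implicit Arguments.
Unset Strict Implicit.
Unset Printing Implicit Defensive.

Import Order.TTheory GRing.Theory Num.Theory.
Import numFieldTopology.Exports.
Import HBNNSimple.

Local Open Scope classical_set_scope.
Local Open Scope ring_scope.


(** Write $z_Y$ for the map from a space $Y$ to the product $Y_1\times\cdots\times Y_k$ of its
    components.

    Densities come from components. Let $(Y,\eta)$ be ergodic and stationary. Averaging $\eta$ over
    the factor $G_j$, or over its cofactor, gives a stationary measure absolutely continuous with
    respect to $\eta$, and [stationary_unique] forces it to be $\eta$: so $\eta$ is stationary under
    $G_j$ and under the cofactor separately ([factor_stationary]). A measure absolutely continuous
    with respect to $\eta$ and stationary under the cofactor of $j$ has a density whose superlevel
    sets are cofactor-invariant, hence a function on $Y_j$ ([cofactor_stationary_density]).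
    Translates of $\eta$ by $G_j$ are of this kind because $G_j$ commutes with its cofactor. So for
    every $g\in G$ the density of $g\eta$ with respect to $\eta$ is a function of $z_Y$
    ([action_density]). In the same way the conditional probability given $X$ of a
    cofactor-invariant subset of $A$ is a function on $X_j$ ([invariant_set_density]).

    The boundary enters through path space. Let $\Lambda$ be the law of $(\omega,x)$, where $\omega$
    is a sequence of increments and $x$ has law $\nu_\omega$. Sending $\omega$ to its boundary point
    and then mapping the joining to $A$ gives $\Phi$ from paths times $X$ to $A$, with
    $\rho(\Phi(\omega,x))=x$ almost surely. Given the first $n$ increments, $\Phi$ has law $g\alpha$
    with $g=\omega_0\cdots\omega_{n-1}$ ([joining_walk], [path_factor_of_joining]). Products of a
    cylinder and a subset of $X$ generate, so functions on paths times $X$ can be compared through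
    integrals over such products, and for functions of $\Phi$ these are integrals over $A$ against
    the measures $g\alpha$ ([path_factor_integral], [path_rects_ae_eq]).

    Generation. Let $e$ be the conditional probability of $E\subseteq A$ given $(z_A,\rho)$. The
    density of $g\alpha$ depends only on $z_A$, so $1_E$ and $e$ have the same integrals against
    functions of $\rho$ under every $g\alpha$; hence $1_E\circ\Phi=e\circ\Phi$ almost surely and $E$
    is, up to a null set, determined by $(z_A,\rho)$ ([factor_generated]). So $(z_A,\rho)$ is an
    isomorphism onto its image law.

    Independence. Under $\Lambda$, the path $\omega$ and the point $x$ are conditionally independent
    given $z_X(x)$ ([path_swap]), and an event of $A_j$ lifted by $\Phi$ is a function of $\omega$
    and $z_X(x)$ ([component_path_measurable]). Hence events of $A_1,\ldots,A_k$ taken together are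
    conditionally independent of $X$ given $z_X$ ([factor_cond_indep]), while the components
    themselves are independent ([components_independent]). This identifies the law of $(z_A,\rho)$
    as the relative independent joining. *)

(** * Densities, push-forwards and conditional probabilities *)

Section integral_toolbox.
Local Open Scope ereal_scope.
Context {R : realType}.

(** Induction principle behind all passages from sets to functions: a nonnegative measurable
    function is an increasing limit of simple functions, and these are finite combinations of
    indicators. *)
Lemma ge0_measurable_ind d (T : measurableType d)
    (P : (T -> \bar R) -> Prop) :
  (forall E : set T, measurable E -> P (fun x => (\1_E x)%:E)) ->
  (forall f g : T -> \bar R, measurable_fun setT f -> measurable_fun setT g ->
    (forall x, 0 <= f x) -> (forall x, 0 <= g x) ->
    P f -> P g -> P (fun x => f x + g x)) ->
  (forall (r : R) (f : T -> \bar R), (0 <= r)%R -> measurable_fun setT f ->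
    (forall x, 0 <= f x) -> P f -> P (fun x => r%:E * f x)) ->
  (forall (h : nat -> T -> \bar R) (f : T -> \bar R),
    (forall n, measurable_fun setT (h n)) -> (forall n x, 0 <= h n x) ->
    (forall x, nondecreasing_seq (h ^~ x)) ->
    (forall x, h ^~ x @ \oo --> f x) ->
    (forall n, P (h n)) -> P f) ->
  forall f : T -> \bar R, measurable_fun setT f -> (forall x, 0 <= f x) -> P f.
Proof.
move=> P1 PD PZ Plim f mf f0.
apply: (Plim (fun n x => (nnsfun_approx measurableT mf n x)%:E)).
- by move=> n; exact/measurable_EFinP.
- by move=> n x; rewrite lee_fin.
- by move=> x m n mn; rewrite lee_fin; exact/lefP/nd_nnsfun_approx.
- by move=> x; exact: cvg_nnsfun_approx.
move=> n; set g := nnsfun_approx _ _ n.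
have -> : (fun x => (g x)%:E) =
    (fun x => \sum_(r <- finmap.enum_fset (fset_set (range g))) (r%:E * (\1_(g @^-1` [set r]) x)%:E)).
  apply/funext => x; rewrite fimfunE fsbig_finite//= -sumEFin.
  by apply: eq_bigr => r _; rewrite EFinM.
have : forall r, r \in finmap.enum_fset (fset_set (range g)) -> (0 <= r)%R.
  by move=> r; rewrite in_fset_set// => /set_mem[x _ <-].
elim: (finmap.enum_fset (fset_set (range g))) => [_|r s IH rs].
  have -> : (fun x => \sum_(r <- [::]) (r%:E * (\1_(g @^-1` [set r]) x)%:E)) =
      (fun x => (\1_(@set0 T) x)%:E).
    by apply/funext => x; rewrite big_nil indic0.
  exact: P1.
under eq_fun do rewrite big_cons.
have mr q : measurable_fun setT (fun x => (\1_(g @^-1` [set q]) x)%:E : \bar R).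
  by apply/measurable_EFinP; exact: measurable_indic.
have r0 : (0 <= r)%R by apply: rs; rewrite inE eqxx.
have rs' q : q \in s -> (0 <= q)%R.
  by move=> qs; apply: rs; rewrite inE qs orbT.
apply: PD.
- exact: measurable_funeM.
- by apply: emeasurable_sum => q; exact: measurable_funeM.
- by move=> x; rewrite mule_ge0// lee_fin.
- move=> x; rewrite big_seq_cond sume_ge0// => q.
  by rewrite andbT => /rs' q0; rewrite mule_ge0// lee_fin.
- by apply: PZ => //; exact: P1.
- by apply: IH.
Qed.

Lemma measurable_EFin_indic d (T : measurableType d) (E : set T) :
  measurable E -> measurable_fun setT (fun x => (\1_E x)%:E : \bar R).
Proof. by move=> mE; apply/measurable_EFinP; exact: measurable_indic. Qed.

Lemma integral_setT_indic d (T : measurableType d)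
    (m : {measure set T -> \bar R}) (E : set T) : measurable E ->
  \int[m]_x (\1_E x)%:E = m E.
Proof. by move=> mE; rewrite integral_indic// setIT. Qed.

Lemma integral_mul_indic d (T : measurableType d)
    (m : {measure set T -> \bar R}) (E : set T) (f : T -> \bar R) :
  measurable E -> \int[m]_x (f x * (\1_E x)%:E) = \int[m]_(x in E) f x.
Proof.
by move=> mE; rewrite [RHS]integral_mkcond epatch_indic.
Qed.

(** The hypothesis says that the push-forwards of [u] times [m] by [q] and of [v] times [m'] by [q']
    coincide as measures on [W]; they then integrate every [k] alike. Most identities between
    measures below are used in this form, which avoids constructing the two measures. *)
Lemma density_integral d (T : measurableType d) d' (T' : measurableType d')
    d'' (W : measurableType d'')
    (m : {measure set T -> \bar R}) (m' : {measure set T' -> \bar R})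
    (q : T -> W) (q' : T' -> W) (u : T -> \bar R) (v : T' -> \bar R) :
  measurable_fun setT q -> measurable_fun setT q' ->
  measurable_fun setT u -> measurable_fun setT v ->
  (forall x, 0 <= u x) -> (forall x, 0 <= v x) ->
  (forall D, measurable D -> \int[m]_x (u x * (\1_D (q x))%:E) =
                             \int[m']_x (v x * (\1_D (q' x))%:E)) ->
  forall k : W -> \bar R, measurable_fun setT k -> (forall w, 0 <= k w) ->
  \int[m]_x (u x * k (q x)) = \int[m']_x (v x * k (q' x)).
Proof.
move=> mq mq' mu mv u0 v0 H.
apply: ge0_measurable_ind => //.
- move=> f g mf mg f0 g0 Hf Hg.
  under eq_integral do rewrite ge0_muleDr//.
  under [RHS]eq_integral do rewrite ge0_muleDr//.
  rewrite !ge0_integralD//; first by rewrite Hf Hg.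
  + by move=> x _; rewrite mule_ge0.
  + by apply: emeasurable_funM => //; exact: measurableT_comp mf mq'.
  + by move=> x _; rewrite mule_ge0.
  + by apply: emeasurable_funM => //; exact: measurableT_comp mg mq'.
  + by move=> x _; rewrite mule_ge0.
  + by apply: emeasurable_funM => //; exact: measurableT_comp mf mq.
  + by move=> x _; rewrite mule_ge0.
  + by apply: emeasurable_funM => //; exact: measurableT_comp mg mq.
- move=> r f r0 mf f0 Hf.
  under eq_integral do rewrite muleCA.
  under [RHS]eq_integral do rewrite muleCA.
  rewrite !ge0_integralZl//; first by rewrite Hf.
  + by apply: emeasurable_funM => //; exact: measurableT_comp mf mq'.
  + by move=> x _; rewrite mule_ge0.
  + by apply: emeasurable_funM => //; exact: measurableT_comp mf mq.
  + by move=> x _; rewrite mule_ge0.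
- move=> h f mh h0 hnd hf IH.
  have hsup w : f w = ereal_sup (range (h ^~ w)).
    apply/esym/(cvg_unique (@ereal_hausdorff R) _ (hf w)).
    exact: ereal_nondecreasing_cvgn.
  have f0 w : 0 <= f w.
    by rewrite hsup; apply: le_trans (h0 0%N w) (ereal_sup_ubound _); exists 0%N.
  have key d1 (S : measurableType d1) (m1 : {measure set S -> \bar R})
      (p : S -> W) (w : S -> \bar R) : measurable_fun setT p ->
      measurable_fun setT w -> (forall x, 0 <= w x) ->
      \int[m1]_x (w x * f (p x)) = limn (fun n => \int[m1]_x (w x * h n (p x))).
    move=> mp mw w0; rewrite -monotone_convergence//.
    (* Multiplication by an infinite weight is not continuous at 0. In that case either the limit of
       the [h n] is 0 and every term vanishes, or some [h n] is positive and the products are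
       eventually [+oo]. *)
    + apply: eq_integral => x _; apply/esym/(cvg_lim (@ereal_hausdorff R)).
      have [wy|] := eqVneq (w x) +oo; last first.
        move=> wy; apply: cvgeZl; last exact: hf.
        by rewrite ge0_fin_numE// ltey.
      rewrite wy; have [fx0|fneq] := eqVneq (f (p x)) 0.
        have hz n : h n (p x) = 0.
          apply/eqP; rewrite eq_le h0 andbT -fx0.
          by rewrite hsup; apply: ereal_sup_ubound; exists n.
        rewrite fx0 mule0 (_ : (fun n => _) = cst 0); first exact: cvg_cst.
        by apply/funext => n; rewrite hz mule0.
      have fpos : 0 < f (p x) by rewrite lt_neqAle eq_sym fneq f0.
      rewrite gt0_mulye//; apply: cvg_near_cst.
      have [n hn] : exists n, 0 < h n (p x).
        apply: contrapT => /forallNP hn.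
        have hz n : h n (p x) = 0.
          by apply/eqP; rewrite eq_le h0 andbT leNgt; apply/negP/hn.
        move: fpos; rewrite hsup ltNge; apply/negP/negPn/ub_ereal_sup.
        by move=> _ [n _ <-]; rewrite hz.
      exists n => // k /= nk; rewrite gt0_mulye//.
      exact: lt_le_trans hn (hnd _ _ _ nk).
    + by move=> n; apply: emeasurable_funM => //; exact: measurableT_comp (mh n) mp.
    + by move=> n x _; rewrite mule_ge0.
    + by move=> x _ a b ab; rewrite lee_wpmul2l//; exact: hnd.
  rewrite (key _ _ m q u)// (key _ _ m' q' v)//.
  by under eq_fun do rewrite IH.
Qed.

Lemma mixture_integral d (T : measurableType d) d' (S : measurableType d')
    (P : {measure set T -> \bar R}) (K : T -> {measure set S -> \bar R})
    (M : {measure set S -> \bar R}) :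
  (forall E, measurable E -> measurable_fun setT (K ^~ E)) ->
  (forall E, measurable E -> M E = \int[P]_t K t E) ->
  forall f : S -> \bar R, measurable_fun setT f -> (forall x, 0 <= f x) ->
  \int[M]_x f x = \int[P]_t \int[K t]_x f x.
Proof.
move=> mK MK.
have mKf f : measurable_fun setT f -> (forall x, 0 <= f x) ->
    measurable_fun setT (fun t => \int[K t]_x f x).
  by move=> mf f0; apply: measurable_fun_integral_kernel.
apply: ge0_measurable_ind => //.
- move=> E mE; rewrite integral_setT_indic// MK//.
  by apply: eq_integral => t _; rewrite integral_setT_indic.
- move=> f g mf mg f0 g0 Hf Hg.
  rewrite ge0_integralD// Hf Hg.
  under [RHS]eq_integral do rewrite ge0_integralD//.
  rewrite [RHS]ge0_integralD//.
  + by move=> t _; exact: integral_ge0.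
  + exact: mKf.
  + by move=> t _; exact: integral_ge0.
  + exact: mKf.
- move=> r f r0 mf f0 Hf.
  rewrite ge0_integralZl// Hf.
  under [RHS]eq_integral do rewrite ge0_integralZl//.
  by rewrite ge0_integralZl//; [exact: mKf|move=> t _; exact: integral_ge0].
- move=> h f mh h0 hnd hf IH.
  have key (m1 : {measure set S -> \bar R}) :
      \int[m1]_x f x = limn (fun n => \int[m1]_x h n x).
    rewrite -monotone_convergence//.
    + by apply: eq_integral => x _; apply/esym/(cvg_lim (@ereal_hausdorff R)); exact: hf.
  rewrite key; under [RHS]eq_integral do rewrite key.
  rewrite monotone_convergence//.
  + by under eq_fun do rewrite IH.
  + by move=> n; exact: mKf.
  + by move=> n t _; exact: integral_ge0.
  + move=> t _ a b ab; apply: ge0_le_integral => // x _; exact: hnd.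
Qed.

End integral_toolbox.

Section restricted_law.
Local Open Scope ereal_scope.
Context {R : realType} d (T : measurableType d) d' (W : measurableType d').

Section measure.
Variables (m : {measure set T -> \bar R}) (E : set T) (mE : measurable E).
Variables (q : T -> W) (mq : measurable_fun setT q).

(** The law of [q] on the event [E]. Its density with respect to the law of [q] is the conditional
    probability of [E] given [q]. *)
Definition rlaw (D : set W) : \bar R := m (E `&` q @^-1` D).

Let mpre D : measurable D -> measurable (q @^-1` D).
Proof. by move=> mD; rewrite -[X in measurable X]setTI; exact: mq. Qed.

Let rlaw0 : rlaw set0 = 0.
Proof. by rewrite /rlaw preimage_set0 setI0 measure0. Qed.

Let rlaw_ge0 D : 0 <= rlaw D.
Proof. exact: measure_ge0. Qed.

Let rlaw_sigma_additive : semi_sigma_additive rlaw.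
Proof.
move=> F mF tF mUF; rewrite /rlaw preimage_bigcup setI_bigcupr.
apply: measure_semi_sigma_additive.
- by move=> n; apply: measurableI => //; exact: mpre.
- apply/trivIsetP => /= i j _ _ ij; rewrite setIACA -preimage_setI.
  by move/trivIsetP : tF => /(_ _ _ _ _ ij) ->//; rewrite preimage_set0 setI0.
- by apply: bigcup_measurable => k _; apply: measurableI => //; exact: mpre.
Qed.

Definition rlaw_measure_of := rlaw.
HB.instance Definition _ := isMeasure.Build _ _ _
  rlaw_measure_of rlaw0 rlaw_ge0 rlaw_sigma_additive.

Definition rlaw_measure : {measure set W -> \bar R} := rlaw_measure_of.

End measure.

Section finite.
Variables (m : {finite_measure set T -> \bar R}) (E : set T) (mE : measurable E).
Variables (q : T -> W) (mq : measurable_fun setT q).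

Definition rlaw_finite_of := rlaw_measure m mE mq : set W -> \bar R.
HB.instance Definition _ := Measure.on rlaw_finite_of.
Let rlaw_fin : fin_num_fun rlaw_finite_of.
Proof.
move=> D mD; apply: fin_num_measure; apply: measurableI => //.
by rewrite -[X in measurable X]setTI; exact: mq.
Qed.
HB.instance Definition _ := Measure_isFinite.Build _ _ _ rlaw_finite_of rlaw_fin.

Definition rlaw_finite : {finite_measure set W -> \bar R} := rlaw_finite_of.

End finite.

Section probability.
Variables (P : probability T R) (q : T -> W) (mq : measurable_fun setT q).

Definition plaw_of : set W -> \bar R := fun D => P (q @^-1` D).
Let plaw0 : plaw_of set0 = 0.
Proof. by rewrite /plaw_of preimage_set0 measure0. Qed.
Let plaw_ge0 D : 0 <= plaw_of D. Proof. exact: measure_ge0. Qed.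
Let plaw_sigma_additive : semi_sigma_additive plaw_of.
Proof.
have -> : plaw_of = rlaw_measure P measurableT mq :> (set W -> \bar R).
  by apply/funext => D /=; rewrite /rlaw_measure /= /rlaw_measure_of /rlaw setTI.
exact: measure_semi_sigma_additive.
Qed.
HB.instance Definition _ := isMeasure.Build _ _ _
  plaw_of plaw0 plaw_ge0 plaw_sigma_additive.
Let plawT : plaw_of setT = 1.
Proof. by rewrite /plaw_of preimage_setT probability_setT. Qed.
HB.instance Definition _ := Measure_isProbability.Build _ _ _ plaw_of plawT.

Definition plaw : probability W R := plaw_of.

Lemma plawE D : plaw D = P (q @^-1` D). Proof. by []. Qed.

End probability.
End restricted_law.

Section integral_toolbox2.
Local Open Scope ereal_scope.
Context {R : realType}.

Lemma measurable_pre d d' (T : measurableType d) (W : measurableType d')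
    (q : T -> W) D : measurable_fun setT q -> measurable D ->
  measurable (q @^-1` D).
Proof. by move=> mq mD; rewrite -[X in measurable X]setTI; exact: mq. Qed.

Lemma integral_indic_pre d (T : measurableType d) d' (W : measurableType d')
    (m : {measure set T -> \bar R}) (q : T -> W) (D : set W) :
  measurable_fun setT q -> measurable D ->
  \int[m]_x (\1_D (q x))%:E = m (q @^-1` D).
Proof. by move=> mq mD; rewrite -integral_setT_indic//; exact: measurable_pre. Qed.

Lemma measurable_indic_comp d (T : measurableType d) d' (W : measurableType d')
    (q : T -> W) (D : set W) : measurable_fun setT q -> measurable D ->
  measurable_fun setT (fun x => (\1_D (q x))%:E : \bar R).
Proof.
by move=> mq mD; exact: measurableT_comp (measurable_EFin_indic mD) mq.
Qed.

Lemma ge0_measurable_mul_indic d (T : measurableType d) d' (W : measurableType d')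
    (q : T -> W) (D : set W) (u : T -> \bar R) :
  measurable_fun setT q -> measurable D -> measurable_fun setT u ->
  measurable_fun setT (fun x => u x * (\1_D (q x))%:E).
Proof.
by move=> mq mD mu; apply: emeasurable_funM => //; exact: measurable_indic_comp.
Qed.

(* Uniqueness of measures on a generating pi-system, for the two measures on W
   obtained from the densities u and v by the maps q and q'. *)
Lemma density_unique d (T : measurableType d) d' (T' : measurableType d')
    d'' (W : measurableType d'')
    (m : {measure set T -> \bar R}) (m' : {measure set T' -> \bar R})
    (q : T -> W) (q' : T' -> W) (u : T -> \bar R) (v : T' -> \bar R)
    (G : set (set W)) :
  measurable_fun setT q -> measurable_fun setT q' ->
  measurable_fun setT u -> measurable_fun setT v ->
  (forall x, 0 <= u x) -> (forall x, 0 <= v x) ->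
  \int[m]_x u x < +oo -> @measurable _ W = <<s G >> -> setI_closed G ->
  \int[m]_x u x = \int[m']_x v x ->
  (forall D, G D -> \int[m]_x (u x * (\1_D (q x))%:E) =
                    \int[m']_x (v x * (\1_D (q' x))%:E)) ->
  forall D, measurable D -> \int[m]_x (u x * (\1_D (q x))%:E) =
                            \int[m']_x (v x * (\1_D (q' x))%:E).
Proof.
move=> mq mq' mu mv u0 v0 uoo WG GI uv HG D.
rewrite WG; move: D; apply: (@dynkin_induction _ W G
  (fun D => \int[m]_x (u x * (\1_D (q x))%:E) =
            \int[m']_x (v x * (\1_D (q' x))%:E))) => //.
- under eq_integral do rewrite indicT mule1.
  by under [RHS]eq_integral do rewrite indicT mule1.
- move=> S mS HS.
  have split d1 (T1 : measurableType d1) (m1 : {measure set T1 -> \bar R})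
      (p : T1 -> W) (w : T1 -> \bar R) : measurable_fun setT p ->
      measurable_fun setT w -> (forall x, 0 <= w x) ->
      \int[m1]_x w x = \int[m1]_x (w x * (\1_S (p x))%:E) +
        \int[m1]_x (w x * (\1_(~` S) (p x))%:E).
    move=> mp mw w0; rewrite -ge0_integralD//.
    + apply: eq_integral => x _; rewrite !indicE in_setC.
      by case: (p x \in S); rewrite /= ?mule1 ?mule0 ?adde0 ?add0e.
    + by move=> x _; rewrite mule_ge0// lee_fin.
    + exact: ge0_measurable_mul_indic.
    + by move=> x _; rewrite mule_ge0// lee_fin.
    + by apply: ge0_measurable_mul_indic => //; exact: measurableC.
  have := uv; rewrite (split _ _ m q u)// (split _ _ m' q' v)// -HS.
  have fin : \int[m]_x (u x * (\1_S (q x))%:E) \is a fin_num.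
    rewrite ge0_fin_numE; last first.
      by apply: integral_ge0 => x _; rewrite mule_ge0// lee_fin.
    apply: le_lt_trans uoo; apply: ge0_le_integral => //.
    + by move=> x _; rewrite mule_ge0// lee_fin.
    + exact: ge0_measurable_mul_indic.
    + move=> x _; rewrite indicE; case: (_ \in _); rewrite /= ?mule1//.
      by rewrite mule0.
  by move/(congr1 (fun z => z - \int[m]_x (u x * (\1_S (q x))%:E)));
    rewrite !(addeC (\int[m]_x (u x * (\1_S (q x))%:E))) !addeK.
- move=> F mF tF HF.
  have key d1 (T1 : measurableType d1) (m1 : {measure set T1 -> \bar R})
      (p : T1 -> W) (w : T1 -> \bar R) : measurable_fun setT p ->
      measurable_fun setT w -> (forall x, 0 <= w x) ->
      \int[m1]_x (w x * (\1_(\bigcup_k F k) (p x))%:E) =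
      \sum_(k <oo) \int[m1]_x (w x * (\1_(F k) (p x))%:E).
    move=> mp mw w0; rewrite -integral_nneseries//.
    + apply: eq_integral => x _.
      have [[i _ Fi]|nF] := pselect ((\bigcup_k F k) (p x)).
        rewrite indicE mem_set; last by exists i.
        rewrite (@nneseriesD1 _ _ i)//; last first.
          by move=> n _; rewrite mule_ge0// lee_fin.
        rewrite eseries0 ?adde0 ?indicE ?mem_set// => j _ /= ji.
        rewrite indicE memNset ?mule0// => Fj.
        move/trivIsetP : tF => /(_ j i Logic.I Logic.I ji).
        by apply/eqP/set0P; exists (p x).
      rewrite indicE memNset// mule0 eseries0// => j _ _.
      by rewrite indicE memNset ?mule0// => Fj; apply: nF; exists j.
    + by move=> n; exact: ge0_measurable_mul_indic.
    + by move=> n x _; rewrite mule_ge0// lee_fin.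
  by rewrite !key//; apply: eq_eseriesr => k _; exact: HF.
Qed.

Lemma ae_eq_density d (T : measurableType d) (m : {measure set T -> \bar R})
    (u v : T -> \bar R) :
  measurable_fun setT u -> measurable_fun setT v ->
  (forall x, 0 <= u x) -> (forall x, 0 <= v x) -> \int[m]_x u x < +oo ->
  (forall D, measurable D -> \int[m]_x (u x * (\1_D x)%:E) =
                             \int[m]_x (v x * (\1_D x)%:E)) ->
  {ae m, forall x, u x = v x}.
Proof.
move=> mu mv u0 v0 uoo H.
have : ae_eq m setT u v.
  apply: integral_ae_eq => //.
    apply/integrableP; split => //.
    by under eq_integral do rewrite gee0_abs//.
  by move=> E _ mE; rewrite -(integral_mul_indic m u mE) -(integral_mul_indic m v mE) H.
by apply: filterS => x; apply.
Qed.

(** Radon-Nikodym theorem for [rlaw]. The derivative is finite almost everywhere, so its [fine] part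
    serves as a density with real values everywhere. *)
Lemma RN_rlaw d (T : measurableType d) d' (W : measurableType d')
    (m : {finite_measure set T -> \bar R}) (n : {finite_measure set W -> \bar R})
    (E : set T) (q : T -> W) :
  measurable E -> measurable_fun setT q ->
  (forall D, measurable D -> n D = 0 -> m (E `&` q @^-1` D) = 0) ->
  exists f : W -> R, [/\ measurable_fun setT f, (forall x, (0 <= f x)%R) &
    forall D, measurable D ->
      m (E `&` q @^-1` D) = \int[n]_x ((f x)%:E * (\1_D x)%:E)].
Proof.
move=> mE mq Hac.
have : rlaw_finite m mE mq `<< n.
  by apply/null_content_dominatesP => D mD nD; exact: Hac.
move/radon_nikodym_finite => [f [f0 fi fE]].
have mf : measurable_fun setT f by exact: (measurable_int _ fi).
have fiR := integrable_ae measurableT fi.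
exists (fine \o f); split.
- exact: measurableT_comp.
- by move=> x; exact: fine_ge0.
- move=> D mD; have := fE _ mD; rewrite -(integral_mul_indic n f mD) => H.
  transitivity (rlaw_finite m mE mq D) => //; rewrite H.
  apply: ge0_ae_eq_integral => //.
  + by apply: (ge0_measurable_mul_indic (q := id)).
  + apply: (ge0_measurable_mul_indic (q := id)) => //.
    by apply/measurable_EFinP; exact: measurableT_comp.
  + by move=> x _; rewrite mule_ge0// lee_fin.
  + by move=> x _; rewrite mule_ge0// lee_fin ?fine_ge0.
  + by apply: filterS fiR => x /(_ I) fx _ /=; rewrite fineK.
Qed.

(** [e] composed with [q] is a version of the conditional probability of [E] given [q]: the
    derivative of [rlaw] with respect to the law of [q], pulled back. *)
Lemma cond_prob d (T : measurableType d) d' (W : measurableType d')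
    (m : probability T R) (E : set T) (q : T -> W) :
  measurable E -> measurable_fun setT q ->
  exists e : W -> R, [/\ measurable_fun setT e, (forall x, (0 <= e x)%R) &
    forall D, measurable D ->
      m (E `&` q @^-1` D) = \int[m]_x ((e (q x))%:E * (\1_D (q x))%:E)].
Proof.
move=> mE mq.
have [D mD nD|e [me e0 H]] := @RN_rlaw _ _ _ _ m (plaw m mq) E q mE mq.
  have {}nD : m (q @^-1` D) = 0 by exact: nD.
  apply/eqP; rewrite eq_le measure_ge0 andbT -nD.
  apply: le_measure; rewrite ?inE; [|exact: measurable_pre|exact: subIsetr].
  by apply: measurableI => //; exact: measurable_pre.
exists e; split => // D mD; rewrite H//.
transitivity (\int[plaw m mq]_x (1 * ((e x)%:E * (\1_D x)%:E))).
  by apply: eq_integral => x _; rewrite mul1e.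
transitivity (\int[m]_x (1 * ((e (q x))%:E * (\1_D (q x))%:E))); last first.
  by apply: eq_integral => x _; rewrite mul1e.
apply: (@density_integral _ _ _ _ _ _ _ (plaw m mq) m id q (cst 1) (cst 1) _ _
  _ _ _ _ _ (fun x => (e x)%:E * (\1_D x)%:E)) => //.
- move=> C mC; under eq_integral do rewrite mul1e.
  under [RHS]eq_integral do rewrite mul1e.
  by rewrite integral_setT_indic// integral_indic_pre.
- by apply: (ge0_measurable_mul_indic (q := id)) => //; exact/measurable_EFinP.
- by move=> x; rewrite mule_ge0// lee_fin.
Qed.

End integral_toolbox2.

(** * Coding of standard Borel spaces by bits and by real numbers *)

Section first_index.
Context d (T : measurableType d).

Lemma measurable_forall_nat (P : nat -> T -> Prop) :
  (forall n, measurable [set t | P n t]) -> measurable [set t | forall n, P n t].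
Proof.
move=> mP; have -> : [set t | forall n, P n t] = \bigcap_n [set t | P n t].
  by apply/seteqP; split => [t Pt n _|t Pt n]; exact: Pt.
exact: bigcapT_measurable.
Qed.

Lemma measurable_exists_nat (P : nat -> T -> Prop) :
  (forall n, measurable [set t | P n t]) -> measurable [set t | exists n, P n t].
Proof.
move=> mP; have -> : [set t | exists n, P n t] = \bigcup_n [set t | P n t].
  by apply/seteqP; split => [t [n Pt]|t [n _ Pt]]; exists n.
exact: bigcup_measurable.
Qed.

Lemma measurable_imply_cst (P : Prop) (Q : set T) :
  measurable Q -> measurable [set t | P -> Q t].
Proof.
move=> mQ; have [p|np] := pselect P.
  by have -> : [set t | P -> Q t] = Q by apply/seteqP; split => t /=; tauto.
by have -> : [set t | P -> Q t] = setT by apply/seteqP; split => t /=; tauto.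
Qed.

(** The least index whose set contains [t], with default 0 when there is none. *)
Definition first_index (F : nat -> set T) (t : T) : nat :=
  xget 0%N [set n | F n t /\ forall m, (m < n)%N -> ~ F m t].

Lemma first_indexP (F : nat -> set T) t : (exists n, F n t) ->
  F (first_index F t) t.
Proof.
move=> Ft; rewrite /first_index; case: xgetP => [n -> []//|nF]; exfalso.
have {Ft} : exists n, `[< F n t >] by case: Ft => n Fn; exists n; exact/asboolP.
move=> Ft; case: (ex_minnP Ft) => n /asboolP Fn nmin.
apply: (nF n); split=> // m mn Fm.
by have := nmin m (asboolT Fm); rewrite leqNgt mn.
Qed.

Lemma measurable_first_index (F : nat -> set T) n :
  (forall k, measurable (F k)) -> measurable [set t | first_index F t = n].
Proof.
move=> mF.
pose B k := [set t | F k t /\ forall m, (m < k)%N -> ~ F m t].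
have mB k : measurable (B k).
  apply: measurableI => //; apply: measurable_forall_nat => m.
  by apply: measurable_imply_cst; exact: measurableC.
(* [Z] is the contribution of the default value, present only for [n = 0]. *)
pose Z := [set t | n = 0%N /\ forall k, (~` B k) t].
have mZ : measurable Z.
  rewrite /Z; have [->|n0] := eqVneq n 0%N.
    rewrite (_ : [set t | _] = [set t | forall k, (~` B k) t]).
      by apply: measurable_forall_nat => k; exact: measurableC.
    by apply/seteqP; split => t /=; [case|].
  rewrite (_ : [set t | _] = set0)//; apply/seteqP; split => t //= -[/eqP].
  by rewrite (negbTE n0).
rewrite (_ : [set t | _] = B n `|` Z); first exact: measurableU.
apply/seteqP; split => t /=; rewrite /first_index.
  case: xgetP => [m _ Bm mn|nB n0]; first by left; rewrite -mn.
  by right; split => // k Bk; exact: nB Bk.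
case=> [Bn|[-> nB]].
  case: xgetP => [m _ [Fm Hm]|/(_ n)/(_ Bn)//].
  case: Bn => Fn Hn; have [mn|nm|//] := ltngtP m n.
    by have := Hn _ mn.
  by have := Hm _ nm.
by case: xgetP => [m _ Bm|//]; have := nB m Bm.
Qed.

Lemma measurable_countable_fun (N : T -> nat) (Q : nat -> set T) :
  (forall n, measurable [set t | N t = n]) -> (forall n, measurable (Q n)) ->
  measurable [set t | Q (N t) t].
Proof.
move=> mN mQ; rewrite (_ : [set t | _] =
    [set t | exists n, ([set t | N t = n] `&` Q n) t]).
  by apply: measurable_exists_nat => n; exact: measurableI.
by apply/seteqP; split => t /=; [move=> Qt; exists (N t)|case=> n [<-]].
Qed.

End first_index.

Section bit_coding.
Context (R : realType) d (X : measurableType d).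

(* s decodes a point from its bits and is measurable in the bits,
   whether or not these are the bits of a point. *)
Lemma standard_borel_bits : standard_borel R X ->
  exists (O : nat -> set X) (s : (nat -> bool) -> X),
  [/\ forall n, measurable (O n),
      forall x, s (fun n => `[< O n x >]) = x &
      forall d' (T : measurableType d') (O' : nat -> set T),
        (forall n, measurable (O' n)) ->
        measurable_fun setT (fun t => s (fun n => `[< O' n t >]))].
Proof.
move=> [P [f [hP [D cD dD] [g fK gK] mf]]].
have D0 : D !=set0.
  have [y [_ Dy]] := dD setT (ex_intro _ (f point) I) openT.
  by exists y.
have [e eD] : exists e : nat -> P, D `<=` range e.
  have /pfcard_geP[D_0|[e]] := cD; first by move: D0; rewrite D_0 => -[].
  by exists e => y Dy; have [n _ <-] := 'surj_e Dy; exists n.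
pose r i : R := i.+1%:R^-1.
have r0 i : 0 < r i by rewrite invr_gt0 ltr0n.
have rlt (eps : R) : 0 < eps -> exists N, forall i, (N <= i)%N -> r i < eps.
  move=> e0; have [N _ HN] := near_infty_natSinv_lt (PosNum e0).
  by exists N => i Ni; exact: HN.
pose U n i := (ball (e n) (r i))°.
have dense_e x i : exists n, U n i x.
  pose V := (ball x (r i / 2))°.
  have Vx : V x by apply: nbhsx_ballx; rewrite divr_gt0.
  have [y [Vy Dy]] := dD V (ex_intro _ x Vx) (@open_interior _ _).
  have [n _ eny] := eD _ Dy; exists n.
  suff : nbhs x (ball (e n) (r i)) by [].
  have xy : ball x (r i / 2) y by exact: interior_subset Vy.
  apply: filterS (nbhsx_ballx x (r i / 2) _); last by rewrite divr_gt0.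
  by move=> z xz; rewrite eny; apply: (ball_splitr xy xz).
pose code (n i : nat) : nat := choice.pickle (n, i).
pose prs k : nat * nat := odflt (0, 0)%N (choice.unpickle k).
pose O k := f @^-1` (U (prs k).1 (prs k).2).
have prsK n i : prs (code n i) = (n, i) by rewrite /prs choice.pickleK.
(* The bits of a point record which balls of radius [r i] around which points [e n] have it in their
   interior; [idx b i] is the first centre allowed at scale [i]. For the bits of a point the chosen
   centres converge to its image under [f]. *)
pose idx (b : nat -> bool) i : nat :=
  @first_index _ bool (fun n => [set _ | b (code n i)]) true.
pose pt b i : P := e (idx b i).
(* The default [point] is taken when the chosen centres diverge, which cannot happen for the bits of
   a point. *)
pose s b : X := if pselect (cvg (pt b @ \oo)) then g (lim (pt b @ \oo))
                else point.
have mUopen V : open V -> measurable (f @^-1` V).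
  move=> oV; apply/mf; rewrite (_ : f @` _ = V); first exact: sub_sigma_algebra.
  apply/seteqP; split => [_ [x Vx <-]//|y Vy].
  by exists (g y); rewrite /= ?gK.
exists O, s; split.
- by move=> n; apply: mUopen; exact: open_interior.
- move=> x; set b := fun n => _.
  have Hidx i : U (idx b i) i (f x).
    have [n Un] := dense_e (f x) i.
    have Hf := @first_indexP _ bool (fun n => [set _ | b (code n i)]) true.
    have : exists n, b (code n i) by exists n; apply/asboolP; rewrite /O prsK.
    by move=> /Hf/asboolP; rewrite /O prsK.
  have cvgx : pt b @ \oo --> f x.
    apply/cvg_ballP => eps e0; have [N HN] := rlt _ e0.
    exists N => // i Ni /=; apply: ball_sym.
    by apply: (le_ball (ltW (HN _ Ni))); exact: (interior_subset (Hidx i)).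
  rewrite /s; case: pselect => [cv|[]]; last exact: cvgP cvgx.
  by rewrite /= (cvg_lim hP cvgx) fK.
- move=> d' T O' mO'.
  pose bb t n := `[< O' n t >].
  have mbb n : measurable [set t | bb t n].
    by rewrite (_ : [set t | _] = O' n)//; apply/seteqP; split => t /asboolP.
  have midx i n : measurable [set t | idx (bb t) i = n].
    rewrite (_ : [set t | _] =
        [set t | first_index (fun n => [set t | bb t (code n i)]) t = n]).
      by apply: measurable_first_index.
    by [].
  have mpt1 i (Q : set P) : measurable [set t | Q (pt (bb t) i)].
    rewrite (_ : [set t | _] = [set t | [set t | Q (e (idx (bb t) i))] t])//.
    apply: (measurable_countable_fun (N := fun t => idx (bb t) i)
      (Q := fun n => [set t | Q (e n)])) => // n.
    have [q|nq] := pselect (Q (e n)).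
      by rewrite (_ : [set t | _] = setT)//; apply/seteqP; split.
    by rewrite (_ : [set t | _] = set0)//; apply/seteqP; split.
  have mpt2 i j (Q : P -> set P) :
      measurable [set t | Q (pt (bb t) i) (pt (bb t) j)].
    apply: (measurable_countable_fun (N := fun t => idx (bb t) i)
      (Q := fun n => [set t | Q (e n) (pt (bb t) j)])) => //.
  pose C := [set t | cvg (pt (bb t) @ \oo)].
  (* By completeness, convergence is the Cauchy condition, which involves only countable quantifiers
     over conditions on the indices. *)
  have CE : C = [set t | forall k, exists N, forall i, (N <= i)%N -> forall j,
      (N <= j)%N -> ball (pt (bb t) i) (r k) (pt (bb t) j)].
    apply/seteqP; split => t /=.
      move=> /cvg_ballP cv k; have /cv[N _ HN] : 0 < r k / 2 by rewrite divr_gt0.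
      exists N => i Ni j Nj; apply: ball_splitr (HN i Ni) (HN j Nj).
    move=> H; apply: cauchy_cvg; apply: cauchy_exP => eps e0.
    have [N0 HN0] := rlt _ e0; have [N HN] := H N0.
    exists (pt (bb t) N); exists N => // j Nj /=.
    exact: (le_ball (ltW (HN0 _ (leqnn _)))) (HN _ (leqnn _) _ Nj).
  have mC : measurable C.
    rewrite CE; apply: measurable_forall_nat => k.
    apply: measurable_exists_nat => N; apply: measurable_forall_nat => i.
    apply: measurable_imply_cst; apply: measurable_forall_nat => j.
    by apply: measurable_imply_cst; apply: (mpt2 _ _ (fun y => ball y (r k))).
  move=> _ A mA; rewrite setTI.
  have : <<s @open P >> (f @` A) by apply/mf.
  have -> : (fun t => s (bb t)) @^-1` A = (fun t => f (s (bb t))) @^-1` (f @` A).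
    apply/seteqP; split => t /=; first by move=> At; exists (s (bb t)).
    by move=> [x Ax /(can_inj fK) <-].
  move: (f @` A); apply: smallest_sub; first split.
  + by rewrite /= preimage_set0.
  + by move=> B /= mB; rewrite setTD preimage_setC; exact: measurableC.
  + by move=> F /= mF; rewrite preimage_bigcup; exact: bigcup_measurable.
  move=> V oV /=.
  (* Where the centres converge, their limit lies in the open set [V] exactly when, for some [k],
     the balls of radius [r k] around all late centres are inside [V]; this depends on countably
     many indices. *)
  have -> : (fun t => f (s (bb t))) @^-1` V =
      (C `&` [set t | exists k, exists N, forall i, (N <= i)%N ->
        ball (pt (bb t) i) (r k) `<=` V])
      `|` (~` C `&` [set t | V (f point)]).
    apply/seteqP; split => t /=; rewrite /s /C /=.
      case: pselect => [cv|ncv] Vt; [left|right] => //; split => //.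
      move: Vt; rewrite gK => Vl; set l := lim _ in Vl.
      have /nbhs_ballP[eps /= e0 He] : nbhs l V by exact: open_nbhs_nbhs.
      have /rlt[k Hk] : 0 < eps / 2 by rewrite divr_gt0.
      have /cvg_ballP/(_ _ (r0 k))[N _ HN] := cv.
      exists k, N => i Ni z Hz; apply: He.
      have h1 := le_ball (ltW (Hk k (leqnn _))) (HN i Ni).
      have h2 := le_ball (ltW (Hk k (leqnn _))) Hz.
      by rewrite (splitr eps); exact: ball_triangle h1 h2.
    case=> -[]; case: pselect => // cv _.
    move=> [k [N HN]]; rewrite gK.
    have /cvg_ballP/(_ _ (r0 k))[M _ HM] := cv.
    apply: (HN (maxn M N) (leq_maxr _ _)).
    by apply: ball_sym; apply: HM; exact: leq_maxl.
  apply: measurableU; apply: measurableI => //.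
  + apply: measurable_exists_nat => k; apply: measurable_exists_nat => N.
    apply: measurable_forall_nat => i; apply: measurable_imply_cst.
    exact: (mpt1 i (fun y => ball y (r k) `<=` V)).
  + exact: measurableC.
  + have [q|nq] := pselect (V (f point)).
      by rewrite (_ : [set t | _] = setT)//; apply/seteqP; split.
    by rewrite (_ : [set t | _] = set0)//; apply/seteqP; split.
Qed.

End bit_coding.

Section real_coding.
Context (R : realType).
Implicit Types (b : nat -> bool) (r : R).

Let term b i : R := (b i)%:R * 4^-1 ^+ i.

Let term_ge0 b i : 0 <= term b i.
Proof. by rewrite mulr_ge0// exprn_ge0// invr_ge0. Qed.

(** Base 4 with digits 0 and 1: all digits after the leading one add at most 1/3, so comparison with
    1 reads off the leading digit without ambiguity. *)
Definition ebits b : \bar R := (\sum_(0 <= i <oo) (term b i)%:E)%E.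

Lemma ebits_ge0 b : (0 <= ebits b)%E.
Proof. by apply: nneseries_ge0 => n _ _; rewrite lee_fin. Qed.

Lemma ebits_le b : (ebits b <= (4 / 3)%:E)%E.
Proof.
rewrite /ebits; apply: lime_le.
  by apply: is_cvg_nneseries => n _ _; rewrite lee_fin.
apply: nearW => n; rewrite sumEFin lee_fin big_mkord.
(* The bound 4/3 is sharpened by the geometric remainder so that it passes through the induction. *)
suff : \sum_(i < n) term b i <= 4 / 3 * (1 - 4^-1 ^+ n).
  move=> /le_trans; apply; rewrite ger_pMr// lerBlDr lerDl exprn_ge0//.
elim: n => [|n IH]; first by rewrite big_ord0 expr0 subrr mulr0.
rewrite big_ord_recr /=; apply: le_trans (lerD IH (_ : _ <= 4^-1 ^+ n)) _.
  by rewrite /term; case: (b n); rewrite ?mul1r// mul0r exprn_ge0.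
rewrite exprS; set x := _ ^+ n; lra.
Qed.

Lemma ebits_rec b :
  ebits b = ((b 0%N)%:R%:E + 4^-1%:E * ebits (fun n => b n.+1))%E.
Proof.
rewrite /ebits nneseries_recl//; last by move=> n _; rewrite lee_fin.
rewrite /term expr0 mulr1; congr (_ + _)%E.
rewrite -nneseriesZl; last by move=> n _; rewrite lee_fin.
rewrite -nneseries_addn; last by move=> n; rewrite lee_fin.
apply: eq_eseriesr => n _; rewrite -EFinM addn1 exprS; congr EFin.
by rewrite mulrCA.
Qed.

Definition rbits b : R := fine (ebits b).

Lemma rbitsE b : ebits b = (rbits b)%:E.
Proof.
rewrite fineK// ge0_fin_numE ?ebits_ge0//.
by apply: le_lt_trans (ebits_le b) _; exact: ltry.
Qed.

(** Removes the leading base 4 digit and shifts the expansion by one place. *)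
Definition bit_shift r : R := 4 * (r - (1 <= r)%R%:R).

Definition real_bit r (n : nat) : bool := 1 <= iter n bit_shift r.

Lemma rbits_rec b : rbits b = (b 0%N)%:R + 4^-1 * rbits (fun n => b n.+1).
Proof. by apply: EFin_inj; rewrite -rbitsE ebits_rec rbitsE. Qed.

Lemma rbits_ge1 b : (1 <= rbits b) = b 0%N.
Proof.
rewrite rbits_rec; set c := rbits _.
have c0 : 0 <= c by rewrite -lee_fin -rbitsE ebits_ge0.
have c1 : c <= 4 / 3 by rewrite -lee_fin -rbitsE ebits_le.
by case: (b 0%N); [rewrite lerDl mulr_ge0// invr_ge0|apply/negbTE; rewrite -ltNge add0r; lra].
Qed.

Lemma real_bitK b : real_bit (rbits b) = b.
Proof.
apply/funext => n; rewrite /real_bit.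
suff -> : iter n bit_shift (rbits b) = rbits (fun m => b (n + m)%N).
  by rewrite rbits_ge1 addn0.
elim: n b => [|n IH] b //; rewrite iterSr.
have -> : bit_shift (rbits b) = rbits (fun m => b m.+1).
  by rewrite /bit_shift rbits_ge1 [X in X - _]rbits_rec addrC addKr mulrA divff// mul1r.
by rewrite IH.
Qed.

Lemma measurable_rbits d (T : measurableType d) (b : T -> nat -> bool) :
  (forall n, measurable [set t | b t n]) -> measurable_fun setT (rbits \o b).
Proof.
move=> mb; apply: measurableT_comp; first exact: fine_measurable.
apply: ge0_emeasurable_sum => [n t _ _|n _]; first by rewrite lee_fin.
apply/measurable_EFinP; apply: measurable_funM => //.
rewrite (_ : (fun t => _) = \1_[set t | b t n]); first exact: measurable_indic.
by apply/funext => t; rewrite indicE; congr (nat_of_bool _)%:R;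
  apply/idP/idP => [bt|/set_mem//]; exact/mem_set.
Qed.

Lemma measurable_real_bit n : measurable [set r | real_bit r n].
Proof.
have mshift : measurable_fun [set: R] bit_shift.
  apply: measurable_funM => //; apply: measurable_funB => //.
  rewrite (_ : (fun r => _) = \1_[set r | 1 <= r]).
    apply: measurable_indic.
    rewrite (_ : [set _ | _] = `[1, +oo[%classic); first exact: measurable_itv.
    by apply/seteqP; split => r /=; rewrite in_itv /= andbT.
  apply/funext => r; rewrite indicE; congr (nat_of_bool _)%:R.
  by apply/idP/idP => [bt|/set_mem//]; exact/mem_set.
have miter : measurable_fun [set: R] (iter n bit_shift).
  by elim: n => [|n IH]; [exact: measurable_id|exact: measurableT_comp mshift IH].
rewrite (_ : [set r | _] = iter n bit_shift @^-1` `[1, +oo[%classic).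
  by apply: measurable_pre => //; exact: measurable_itv.
by apply/seteqP; split => r /=; rewrite in_itv /= andbT.
Qed.

(** Bits are turned into a real number and decoded again. The codes stay below 4/3; the bound 2
    gives an integer beyond which a distribution function of the code is 1. *)
Lemma standard_borel_real d (X : measurableType d) : standard_borel R X ->
  exists (t : X -> R) (s : R -> X),
    [/\ measurable_fun setT t, measurable_fun setT s, cancel t s &
        forall x, 0 <= t x <= 2].
Proof.
move=> /standard_borel_bits[Q [s [mQ sK ms]]].
exists (fun x => rbits (fun n => `[< Q n x >])), (s \o real_bit); split.
- apply: measurable_rbits => n.
  by rewrite (_ : [set _ | _] = Q n)//; apply/seteqP; split => x /asboolP.
- have := ms _ R (fun n => [set r | real_bit r n]) measurable_real_bit.
  congr (measurable_fun _ _); apply/funext => r /=; congr (s _).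
  by apply/funext => n; exact: asboolb.
- by move=> x /=; rewrite real_bitK.
- move=> x; set b := fun n => _; rewrite -!lee_fin -rbitsE ebits_ge0 /=.
  by apply: le_trans (ebits_le b) _; rewrite lee_fin; lra.
Qed.

End real_coding.

(** * The uniform law and the existence of disintegrations *)

Section uniform01.
Context (R : realType).

Let idR : measurableTypeR R -> R := idfun.
Let midR : measurable_fun setT idR. Proof. exact: (@measurable_id _ _ setT). Qed.

Definition unif01_of : set R -> \bar R :=
  rlaw_measure (@lebesgue_measure R) (measurable_itv `[(0 : R), 1[) midR.
HB.instance Definition _ := Measure.on unif01_of.
Let unif01T : unif01_of setT = 1%E.
Proof.
rewrite /unif01_of /= /rlaw_measure_of /rlaw setIT lebesgue_measure_itv /= lte_fin ltr01.
by rewrite oppr0 adde0.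
Qed.
HB.instance Definition _ := Measure_isProbability.Build _ _ _ unif01_of unif01T.

Definition unif01 : probability R R := unif01_of.

Lemma unif01_lt (a : R) : 0 <= a <= 1 ->
  unif01 [set u | 0 <= u < 1 /\ u < a] = a%:E.
Proof.
move=> /andP[a0 a1]; rewrite /unif01 /= /unif01_of /= /rlaw_measure_of /rlaw /= setIC.
have -> : [set u | 0 <= u < 1 /\ u < a] `&` `[0, 1[ = `[0, a[%classic.
  apply/seteqP; split => u /=; rewrite !in_itv /=.
    by move=> [[/andP[-> _] ->]].
  move=> /andP[u0 ua]; rewrite u0 (lt_le_trans ua a1).
  by split.
rewrite lebesgue_measure_itv /= lte_fin; case: ltP => [_|a0'].
  by rewrite oppr0 adde0.
by congr EFin; apply/eqP; rewrite eq_le a0 a0'.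
Qed.

Lemma unif01_ico : unif01 `[(0 : R), 1[%classic = 1%E.
Proof.
rewrite -[RHS](@unif01_lt 1) ?ler01 ?lexx//; congr (unif01 _).
apply/seteqP; split => u /=; rewrite in_itv /=; last by case.
by move=> /andP[-> ->].
Qed.

End uniform01.

Lemma measure_eq_off_null (R : realType) d (T : measurableType d)
    (m : {measure set T -> \bar R}) (A B N : set T) :
  measurable A -> measurable B -> measurable N -> m N = 0%E ->
  A `\` N = B `\` N -> m A = m B.
Proof.
move=> mA mB mN N0 AB; rewrite (measureDI m mA mN) (measureDI m mB mN) AB.
congr (_ + _)%E; transitivity (0%E : \bar R).
  apply/eqP; rewrite eq_le measure_ge0 andbT -N0.
  by apply: le_measure; rewrite ?inE//; exact: measurableI.
apply/esym/eqP; rewrite eq_le measure_ge0 andbT -N0.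
by apply: le_measure; rewrite ?inE//; exact: measurableI.
Qed.

Lemma prod_probE (R : realType) d (T : measurableType d) d' (S : measurableType d')
    (P : probability T R) (Q : probability S R) (A : set T) (B : set S) :
  measurable A -> measurable B -> (P \x Q)%E (A `*` B) = (P A * Q B)%E.
Proof. by move=> mA mB; exact: product_measure1E. Qed.

Section disintegration_existence.
Local Open Scope ereal_scope.
Context (R : realType) d (A : measurableType d) d' (Z : measurableType d').
Variables (alpha : probability A R) (zeta : probability Z R) (p : A -> Z).
Hypotheses (mp : measurable_fun setT p)
  (pE : forall F, measurable F -> alpha (p @^-1` F) = zeta F).

Let isdens (E : set A) (f : Z -> R) := [/\ measurable_fun setT f,
  (forall z, (0 <= f z)%R) &
  forall D, measurable D ->
    alpha (E `&` p @^-1` D) = \int[zeta]_z ((f z)%:E * (\1_D z)%:E)].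

Let isdens_ex E : measurable E -> exists f, isdens E f.
Proof.
move=> mE; apply: (RN_rlaw (m := alpha) (n := zeta)) => // D mD zD.
have aD : alpha (p @^-1` D) = 0 by rewrite pE.
apply/eqP; rewrite eq_le measure_ge0 andbT -aD.
apply: le_measure; rewrite ?inE; [|exact: measurable_pre|exact: subIsetr].
by apply: measurableI => //; exact: measurable_pre.
Qed.

(** The difference of the two sets has its own nonnegative density, and densities add. *)
Let isdens_le E E' f f' : measurable E -> measurable E' -> E `<=` E' ->
  isdens E f -> isdens E' f' -> {ae zeta, forall z, (f z <= f' z)%R}.
Proof.
move=> mE mE' EE' [mf f0 fE] [mf' f'0 f'E].
have mD := measurableD mE' mE.
have [g [mg g0 gE]] := isdens_ex mD.
have : {ae zeta, forall z, (f' z)%:E = (f z)%:E + (g z)%:E}.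
  apply: ae_eq_density.
  - exact/measurable_EFinP.
  - by apply: emeasurable_funD; exact/measurable_EFinP.
  - by move=> z; rewrite lee_fin.
  - by move=> z; rewrite adde_ge0// lee_fin.
  - rewrite (_ : \int[zeta]_z _ = alpha (E' `&` p @^-1` setT)).
      by rewrite ltey_eq fin_num_measure//= preimage_setT setIT.
    by rewrite f'E//; apply: eq_integral => z _; rewrite indicT mule1.
  - move=> D mD'; rewrite -f'E//.
    under eq_integral do rewrite ge0_muleDl ?lee_fin//.
    rewrite ge0_integralD//; last 4 first.
    + by move=> z _; rewrite mule_ge0// lee_fin.
    + by apply: (ge0_measurable_mul_indic (q := id)) => //; exact/measurable_EFinP.
    + by move=> z _; rewrite mule_ge0// lee_fin.
    + by apply: (ge0_measurable_mul_indic (q := id)) => //; exact/measurable_EFinP.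
    rewrite -fE// -gE//.
    have mpD : measurable (p @^-1` D) by exact: measurable_pre.
    rewrite -measureU//; [|exact: measurableI|exact: measurableI|].
    + by rewrite -setIUl setDUK.
    + by rewrite setDE setIACA setIA -(setIA E) (setIC E') !setIA setICr !set0I.
by apply: filterS => z; rewrite -EFinD => -[->]; rewrite lerDl.
Qed.

(** With [A] coded in the reals by [t], the densities [f q] of the events [t <= q], for rational
    [q], are conditional distribution functions given [p]. For almost every [z] they are monotone
    with values from 0 to 1, and the fibre measure is the image of the uniform law under the
    quantile function, decoded by [s]. *)
Lemma disintegration_exists : standard_borel R A ->
  exists kappa : Z -> probability A R, disintegration alpha zeta p kappa.
Proof.
move=> /standard_borel_real[t [s [mt ms tK t02]]].
pose E (q : rat) := t @^-1` `]-oo, ratr q].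
have mE q : measurable (E q) by apply: measurable_pre => //; exact: measurable_itv.
have [f fP] := choice (fun q => isdens_ex (mE q)).
have mf q : measurable_fun setT (f q) by have [] := fP q.
(* The quantile function of the distribution function [f ^~ z] at level [u], computed over rationals
   so that it is jointly measurable. *)
pose Q (zu : Z * R) : \bar R :=
  ereal_inf [set (ratr q)%:E | q in [set q | (zu.2 < f q zu.1)%R]].
have QltP zu c : (Q zu < c%:E) <->
    exists q, (ratr q < c)%R /\ (zu.2 < f q zu.1)%R.
  split.
    move=> /ereal_inf_lt[_ [q /= qf <-]]; rewrite lte_fin => qc.
    by exists q.
  move=> [q [qc qf]]; apply: le_lt_trans (_ : (ratr q)%:E < _); last by rewrite lte_fin.
  by apply: ereal_inf_lbound; exists q.
have mlt q : measurable [set zu : Z * R | (zu.2 < f q zu.1)%R].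
  rewrite (_ : [set _ | _] = setT `&`
      [set zu : Z * R | (zu.2)%:E < (f q zu.1)%:E]).
    apply: measurable_lte => //; apply/measurable_EFinP => //.
    exact: measurableT_comp (mf q) measurable_fst.
  by apply/seteqP; split => zu /=; rewrite lte_fin; tauto.
have mQ : measurable_fun setT Q.
  apply: (measurability _ (ErealGenInftyO.measurableE R)) => // _ [_ [c ->] <-].
  rewrite setTI (_ : _ @^-1` _ = \bigcup_q
      (if (ratr q < c)%R then [set zu : Z * R | (zu.2 < f q zu.1)%R] else set0)).
    by apply: bigcupT_measurable_rat => q; case: ifP.
  apply/seteqP; split => zu /=; rewrite in_itv /=.
    by move=> /QltP[q [qc qf]]; exists q => //; rewrite qc.
  by move=> [q _]; case: ifP => // qc qf; apply/QltP; exists q.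
pose K := fun zu => s (fine (Q zu)).
have mK : measurable_fun setT K.
  by apply: measurableT_comp ms _; exact: measurableT_comp.
have mKz z : measurable_fun setT (fun u => K (z, u)).
  exact: measurableT_comp mK (pair1_measurable z).
(* This is a probability for every [z], also where the [f q z] fail to form a distribution
   function. *)
pose kappa z : probability A R := plaw (unif01 R) (mKz z).
have mkappa E' : measurable E' -> measurable_fun setT (kappa ^~ E').
  move=> mE'; rewrite (_ : (fun z => _) =
      (fun z => unif01 R (xsection (K @^-1` E') z))).
    apply: measurable_fun_xsection.
    exact: measurable_pre mK mE'.
  apply/funext => z; congr (unif01 R _); apply/seteqP; split => u /=.
    by move=> Ku; rewrite /xsection /= inE.
  by rewrite /xsection /= inE.
exists kappa; split => //.
pose good z := [/\ forall q q', (q <= q')%R -> (f q z <= f q' z)%R,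
  forall q, (f q z <= 1)%R, forall q, (q < 0)%R -> (f q z <= 0)%R &
  forall q, (2 <= q)%R -> (1 <= f q z)%R].
have dens_cst (E' : set A) (r : R) : (0 <= r)%R -> (forall D, measurable D ->
    alpha (E' `&` p @^-1` D) = r%:E * zeta D) -> isdens E' (cst r).
  move=> r0 H; split => // D mD; rewrite H//.
  rewrite -[RHS]/(\int[zeta]_z (r%:E * (\1_D z)%:E)).
  by rewrite ge0_integralZl//; [rewrite integral_setT_indic|
    exact: measurable_EFin_indic].
have dens0 : isdens set0 (cst 0%R).
  by apply: dens_cst => // D mD; rewrite set0I measure0 mul0e.
have dens1 : isdens setT (cst 1%R).
  by apply: dens_cst => // D mD; rewrite setTI mul1e pE.
have aerat (P : rat -> Z -> Prop) : (forall q, {ae zeta, forall z, P q z}) ->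
    {ae zeta, forall z, forall q, P q z}.
  move=> H; have : {ae zeta, forall z n, P (odflt 0%R (choice.unpickle n)) z}.
    by apply: ae_foralln => n; exact: H.
  by apply: filterS => z Hz q; have := Hz (choice.pickle q); rewrite choice.pickleK.
have aeimp (b : Prop) (P : Z -> Prop) : (b -> {ae zeta, forall z, P z}) ->
    {ae zeta, forall z, b -> P z}.
  have [hb H|hb _] := pselect b; first by apply: filterS (H hb).
  exact: aeW.
have aegood : {ae zeta, forall z, good z}.
  have h1 : {ae zeta, forall z, forall q q', (q <= q')%R -> (f q z <= f q' z)%R}.
    apply: (aerat (fun q z => forall q', (q <= q')%R -> (f q z <= f q' z)%R)).
    move=> q; apply: aerat => q'; apply: aeimp => qq'.
    apply: isdens_le (fP q) (fP q') => // x; rewrite /E /= !in_itv /=.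
    by move=> /le_trans; apply; rewrite ler_rat.
  have h2 : {ae zeta, forall z, forall q, (f q z <= 1)%R}.
    apply: (aerat (fun q z => (f q z <= 1)%R)) => q.
    exact: (isdens_le _ _ _ (fP q) dens1).
  have h3 : {ae zeta, forall z, forall q, (q < 0)%R -> (f q z <= 0)%R}.
    apply: (aerat (fun q z => (q < 0)%R -> (f q z <= 0)%R)) => q.
    apply: aeimp => q0; apply: (isdens_le _ _ _ (fP q) dens0) => //.
    move=> x; rewrite /E /= in_itv /= => tq; have /andP[t0 _] := t02 x.
    by have := le_trans t0 tq; rewrite ler0q leNgt q0.
  have h4 : {ae zeta, forall z, forall q, (2 <= q)%R -> (1 <= f q z)%R}.
    apply: (aerat (fun q z => (2 <= q)%R -> (1 <= f q z)%R)) => q.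
    apply: aeimp => q2; apply: (isdens_le _ _ _ dens1 (fP q)) => //.
    move=> x _; rewrite /E /= in_itv /=; have /andP[_ t2] := t02 x.
    by apply: le_trans t2 _; rewrite -(ler_rat R) rmorph_nat in q2.
  by apply: filterS3 h1 h2 (filterI h3 h4) => z ? ? [? ?]; split.
have [N [mN zN gN]] := aegood.
have {}gN z : (~` N) z -> good z by move=> Nz; apply: contrapT => /gN.
move=> E' F mE' mF.
pose PP := zeta \x unif01 R.
have Qsplit z u c : good z -> (0 <= u < 1)%R ->
    ((fine (Q (z, u)) < c)%R <-> exists q, (ratr q < c)%R /\ (u < f q z)%R).
  move=> [_ _ g0 g2] /andP[u0 u1].
  have Qlty : Q (z, u) < 3%:E.
    apply/QltP; exists 2%R; split => /=; last exact: lt_le_trans u1 (g2 _ _).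
    by rewrite rmorph_nat ltr_nat.
  have Q0 : 0 <= Q (z, u).
    apply: le_ereal_inf_tmp => _ [q /= uq <-]; rewrite lee_fin ler0q leNgt.
    by apply/negP => /g0; apply/negP; rewrite -ltNge (le_lt_trans u0).
  rewrite -lte_fin fineK; first exact: QltP.
  by rewrite ge0_fin_numE// (lt_trans Qlty)// ltry.
(* Off this null set [u] lies in the unit interval and [z] is good, so the quantile is finite and
   [Qsplit] describes its sublevel sets. *)
pose Bad := (N `*` [set: R]) `|` ([set: Z] `*` ~` `[0%R, (1%R : R)[%classic).
have mBad : measurable Bad.
  by apply: measurableU; apply: measurableX => //; apply: measurableC.
have mC01 : measurable (~` `[0%R, (1%R : R)[%classic) by exact: measurableC.
have B1 : PP (N `*` setT) = 0 by rewrite /PP prod_probE// zN mul0e.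
have B2 : PP (setT `*` ~` `[0%R, (1%R : R)[%classic) = 0.
  rewrite /PP prod_probE//.
  have -> : unif01 R (~` `[0%R, (1%R : R)[%classic) = 0.
    by rewrite probability_setC// unif01_ico subee.
  by rewrite mule0.
have Bad0 : PP Bad = 0.
  apply/eqP; rewrite eq_le measure_ge0 andbT.
  apply: le_trans (measureU2 _ _ _) _; [exact: measurableX|exact: measurableX|].
  by rewrite [X in X + _]B1 [X in _ + X]B2 adde0.
pose F' := F `&` ~` N.
have mF' : measurable F' by apply: measurableI => //; exact: measurableC.
pose G := [set zu : Z * R | F' zu.1 /\ (0 <= zu.2 < 1)%R].
have GE : G = F' `*` `[0%R, (1%R : R)[%classic.
  by apply/seteqP; split => zu /=; rewrite in_itv.
have mG : measurable G by rewrite GE; apply: measurableX.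
have law c : PP (G `&` [set zu | (fine (Q zu) < c)%R]) =
    alpha (p @^-1` F' `&` t @^-1` `]-oo, c[).
  have [q0 q0c] : exists q0 : rat, (ratr q0 < c)%R.
    have h : (c - 1 < c)%R by rewrite ltrBlDr ltrDl.
    have [q0] := rat_in_itvoo h; rewrite in_itv /= => /andP[_ q0c].
    by exists q0.
  pose en n : rat := odflt q0 (choice.unpickle n).
  (* Running maximum of the enumerated rationals below [c]: a nondecreasing sequence cofinal below
     [c], which turns both sublevel sets into increasing unions. *)
  pose fix r n : rat := if n is m.+1 then
    (if (ratr (en m) < c)%R then Num.max (r m) (en m) else r m) else q0.
  have rc n : (ratr (r n) < c)%R.
    elim: n => [//|n IH] /=; case: ifP => // h.
    by case: (leP (r n) (en n)).
  have rnd n : (r n <= r n.+1)%R.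
    by rewrite /=; case: ifP => // _; rewrite le_max lexx.
  have rcof q : (ratr q < c)%R -> exists n, (q <= r n)%R.
    move=> qc; exists (choice.pickle q).+1 => /=.
    by rewrite /en choice.pickleK /= qc le_max lexx orbT.
  have rmono : {homo r : m n / (m <= n)%N >-> (m <= n)%R}.
    exact: homo_leq (@lexx _ _) (@le_trans _ _) rnd.
  pose S n := G `&` [set zu | (zu.2 < f (r n) zu.1)%R].
  have mS n : measurable (S n) by exact: measurableI.
  have SE : G `&` [set zu | (fine (Q zu) < c)%R] = \bigcup_n S n.
    apply/seteqP; split => [[z u] [[/= zF u01]] | [z u] [n _ [[/= zF u01] uf]]].
      move=> /(Qsplit z u c (gN _ zF.2) u01)[q [/rcof[n qn] uq]].
      exists n => //; split => //=; apply: lt_le_trans uq _.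
      by have [+ _ _ _] := gN _ zF.2; exact.
    split => //=; apply/(Qsplit z u c (gN _ zF.2) u01).
    by exists (r n).
  pose T n := p @^-1` F' `&` E (r n).
  have mT n : measurable (T n).
    by apply: measurableI => //; exact: measurable_pre.
  have TE : p @^-1` F' `&` t @^-1` `]-oo, c[ = \bigcup_n T n.
    rewrite -setI_bigcupr; congr (_ `&` _); apply/seteqP; split => x /=.
      rewrite in_itv /= => /rat_in_itvoo[q]; rewrite in_itv /= => /andP[tq qc].
      have [n qn] := rcof _ qc; exists n => //; rewrite /E /= in_itv /=.
      by apply: le_trans (ltW tq) _; rewrite ler_rat.
    by move=> [n _]; rewrite /E /= !in_itv /= => /le_lt_trans; apply.
  have ST n : PP (S n) = alpha (T n).
    rewrite /T setIC; have [_ _ ->//] := fP (r n).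
    rewrite /PP /= /product_measure1 /=; apply: eq_integral => z _.
    have [zF|zF] := pselect (F' z); last first.
      rewrite indicE memNset// mule0 (_ : xsection _ _ = set0) ?measure0//.
      by apply/seteqP; split => u //; rewrite /xsection /= inE => -[[]].
    rewrite indicE mem_set// mule1.
    have [_ g1 _ _] := gN _ zF.2.
    rewrite -(@unif01_lt _ (f (r n) z)); last first.
      by rewrite g1 andbT; have [] := fP (r n).
    congr (unif01 R _); apply/seteqP; split => u; rewrite /xsection /= inE.
      by move=> [[]].
    by move=> [u01 uf]; split.
  rewrite SE TE; apply: (cvg_unique (@ereal_hausdorff R)
      (nondecreasing_cvg_mu mS _ _)).
  - by apply: bigcup_measurable.
  - move=> m n mn; apply/subsetPset => -[z u] [[/= zF u01] /= uf]; split => //=.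
    by apply: lt_le_trans uf _; have [+ _ _ _] := gN _ zF.2; apply; exact: rmono.
  rewrite (_ : PP \o S = alpha \o T); last by apply/funext => n /=; rewrite ST.
  apply: nondecreasing_cvg_mu => //; first exact: bigcup_measurable.
  move=> m n mn; apply/subsetPset => x [Fx]; rewrite /E /= !in_itv /= => tx.
  by split => //; rewrite /E /= in_itv /=; apply: le_trans tx _; rewrite ler_rat rmono.
have mQr : measurable_fun setT (fine \o Q) by exact: measurableT_comp.
have key D : measurable D -> PP (G `&` (fine \o Q) @^-1` D) =
    alpha (p @^-1` F' `&` t @^-1` D).
  move=> mD.
  have mpF : measurable (p @^-1` F') by exact: measurable_pre.
  have ind1 H : measurable H -> PP (G `&` (fine \o Q) @^-1` H) =
      \int[PP]_x ((\1_G x)%:E * (\1_H ((fine \o Q) x))%:E).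
    move=> mH; have mGH : measurable (G `&` (fine \o Q) @^-1` H).
      by apply: measurableI => //; exact: measurable_pre.
    transitivity (\int[PP]_x (\1_(G `&` (fine \o Q) @^-1` H) x)%:E).
      by rewrite integral_setT_indic.
    by apply: eq_integral => x _; rewrite indicI.
  have ind2 H : measurable H -> alpha (p @^-1` F' `&` t @^-1` H) =
      \int[alpha]_x ((\1_(p @^-1` F') x)%:E * (\1_H (t x))%:E).
    move=> mH; have mFH : measurable (p @^-1` F' `&` t @^-1` H).
      by apply: measurableI => //; exact: measurable_pre.
    transitivity (\int[alpha]_x (\1_(p @^-1` F' `&` t @^-1` H) x)%:E).
      by rewrite integral_setT_indic.
    by apply: eq_integral => x _; rewrite indicI.
  have PPG : PP G = alpha (p @^-1` F').
    rewrite GE /PP prod_probE// pE//.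
    by rewrite unif01_ico mule1.
  rewrite ind1// ind2//.
  apply: (@density_unique _ _ _ _ _ _ _ PP alpha (fine \o Q) t
    (fun x => (\1_G x)%:E) (fun x => (\1_(p @^-1` F') x)%:E)
    (@RGenInftyO.G R)) => //.
  - exact: measurable_EFin_indic.
  - exact: measurable_EFin_indic.
  - by rewrite integral_setT_indic// [X in X < _]PPG ltey_eq fin_num_measure.
  - exact: (RGenInftyO.measurableE R).
  - move=> _ _ [x ->] [y ->]; exists (Num.min x y).
    by apply/seteqP; split => u /=; rewrite !in_itv /= lt_min => /andP.
  - by rewrite !integral_setT_indic.
  - move=> _ [c ->]; rewrite -ind1// -ind2// -law.
    suff -> : (fine \o Q) @^-1` `]-oo, c[ = [set zu | (fine (Q zu) < c)%R] by [].
    by apply/seteqP; split => zu /=; rewrite in_itv.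
have mKE : measurable (K @^-1` E') by exact: measurable_pre.
transitivity (PP ((F `*` setT) `&` K @^-1` E')).
  rewrite integral_mkcond /PP /= /product_measure1 /=.
  apply: eq_integral => z _; rewrite patchE.
  have [zF|zF] := boolP (z \in F); last first.
    rewrite (_ : xsection _ _ = set0) ?measure0//.
    apply/seteqP; split => u //; rewrite /xsection /= inE => -[[Fz _] _].
    by move: zF; rewrite mem_set.
  congr (unif01 R _); apply/seteqP; split => u; rewrite /xsection /= inE.
    by move=> Ku; split => //; split => //; rewrite inE in zF.
  by case.
transitivity (PP (G `&` (fine \o Q) @^-1` (s @^-1` E'))).
  apply: (measure_eq_off_null (N := Bad)) => //.
  - by apply: measurableI => //; exact: measurableX.
  - by apply: measurableI => //; apply: measurable_pre => //; exact: measurable_pre.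
  rewrite GE; apply/seteqP; split => [[z u] [[[/= Fz _] Kz] nB]|[z u]].
    have nzN : ~ N z by move=> Nz; apply: nB; left.
    have u01 : `[0%R, (1%R : R)[%classic u.
      by apply: contrapT => u01; apply: nB; right.
    by split.
  by move=> [[[[/= Fz _] _] Kz] nB].
rewrite key; last exact: measurable_pre.
rewrite (_ : t @^-1` (s @^-1` E') = E'); last first.
  by apply/seteqP; split => x /=; rewrite tK.
apply: (measure_eq_off_null (N := p @^-1` N)).
- by apply: measurableI => //; exact: measurable_pre.
- by apply: measurableI => //; exact: measurable_pre.
- exact: measurable_pre.
- by have pN : alpha (p @^-1` N) = 0 by rewrite pE.
- apply/seteqP; split => x; first by move=> [[[Fx _] Ex] Nx].
  by move=> [[Ex Fx] Nx]; do !split.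
Qed.

End disintegration_existence.

(** * Countable separating families generate modulo null sets *)

Section mackey.
Local Open Scope ereal_scope.
Context (R : realType).

Lemma ae_all_nat d (T : measurableType d) (m : {measure set T -> \bar R})
    (P : nat -> T -> Prop) : (forall n, {ae m, forall x, P n x}) ->
  {ae m, forall x n, P n x}.
Proof. exact: ae_foralln. Qed.

Lemma ae_prob1 d (T : measurableType d) (m : probability T R) (E : set T) :
  measurable E -> {ae m, forall x, E x} -> m E = 1.
Proof.
move=> mE aeE; have nE0 : m (~` E) = 0.
  by apply: measure_negligible; [exact: measurableC|exact: aeE].
by rewrite -[E]setCK probability_setC ?nE0 ?sube0//; exact: measurableC.
Qed.

Lemma prob1_setC d (T : measurableType d) (m : probability T R) (E : set T) :
  measurable E -> m E = 1 -> m (~` E) = 0.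
Proof. by move=> mE mE1; rewrite probability_setC// mE1 subee. Qed.

(* A countable separating family of measurable sets generates the Borel sets
   on a conull set: the fibre measures over the itinerary map are
   concentrated on fibres, which are singletons. *)
Lemma separating_generates d (X : measurableType d) (nu : probability X R)
    (O : nat -> set X) : standard_borel R X ->
  (forall n, measurable (O n)) ->
  (forall x y, (forall n, O n x <-> O n y) -> x = y) ->
  exists Y : set X, [/\ <<s range O >> Y, nu Y = 1 &
    forall E, measurable E ->
      exists2 E', <<s range O >> E' & E `&` Y = E' `&` Y].
Proof.
move=> sbX mO sepO.
pose Z := prodm (fun _ : nat => bool : measurableType _).
pose i (x : X) : Z := fun n => `[< O n x >].
have cyl (D : set Z) : measurable D -> <<s range O >> (i @^-1` D).
  move: D; apply: smallest_sub; first split.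
  - rewrite /= preimage_set0; exact: sigma_algebra0.
  - move=> D /= iD; rewrite setTD preimage_setC.
    by have := sigma_algebraCD iD; rewrite setTD.
  - move=> F /= iF; rewrite preimage_bigcup; exact: sigma_algebra_bigcup.
  move=> _ [n [C [_ ->]]] /=.
  have sO : <<s range O >> (O n) by apply: sub_sigma_algebra; exists n.
  have [Ct|nCt] := pselect (C true); have [Cf|nCf] := pselect (C false).
  - rewrite (_ : _ @^-1` _ = setT).
      by have := sigma_algebraCD (@sigma_algebra0 _ setT (range O)); rewrite setD0.
    by apply/seteqP; split => x //= _; rewrite /i; case: asboolP.
  - rewrite (_ : _ @^-1` _ = O n)//.
    by apply/seteqP; split => x /=; rewrite /i; case: asboolP.
  - rewrite (_ : _ @^-1` _ = setT `\` O n); first exact: sigma_algebraCD.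
    by apply/seteqP; split => x /=; rewrite /i; case: asboolP => //; tauto.
  - rewrite (_ : _ @^-1` _ = set0); first exact: sigma_algebra0.
    by apply/seteqP; split => x //=; rewrite /i; case: asboolP.
have sOm : <<s range O >> `<=` @measurable _ X.
  by apply: smallest_sub; [exact: sigma_algebra_measurable|move=> _ [n _ <-]].
have mi : measurable_fun setT i.
  by move=> _ D mD; rewrite setTI; apply: sOm; exact: cyl.
have [kappa [mkappa kappaE]] :=
  disintegration_exists (zeta := plaw nu mi) mi (fun F mF => erefl) sbX.
pose C n : set Z := [set z | z n].
have mC n : measurable (C n).
  by apply: sub_sigma_algebra; exists n, [set true]; split.
have iC n : i @^-1` (C n) = O n.
  by apply/seteqP; split => x /asboolP.
(* The itineraries [z] whose fibre measure gives each [O n] the mass 0 or 1 prescribed by [z]. For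
   [z = i x] in [Y0] the fibre measure lives on the points sharing the itinerary of [x], that is on
   [x] alone. *)
pose Y0 : set Z := [set z | forall n, kappa z (O n) = (\1_(C n) z)%:E].
have mY0 : measurable Y0.
  apply: measurable_forall_nat => n.
  rewrite -[X in measurable X]setTI.
    apply: (@measurable_eqe _ Z R setT measurableT (fun z => kappa z (O n))
      (fun z => (\1_(C n) z)%:E)); first exact: mkappa.
    exact: measurable_EFin_indic.
have zY0 : plaw nu mi Y0 = 1.
  apply: ae_prob1 => //; apply: ae_all_nat => n.
  apply: ae_eq_density => //.
  - exact: mkappa.
  - exact: measurable_EFin_indic.
  - apply: le_lt_trans (_ : \int[plaw nu mi]_z cst 1 z < _).
      apply: ge0_le_integral => //; first exact: mkappa.
      by move=> z _; exact: probability_le1.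
    by rewrite integral_cst// mul1e [X in X < _]probability_setT ltry.
  - move=> D mD; rewrite integral_mul_indic// kappaE//.
    transitivity (plaw nu mi (C n `&` D)).
      by rewrite /plaw /= /plaw_of preimage_setI iC.
    rewrite -(integral_setT_indic (plaw nu mi) (measurableI _ _ (mC n) mD)).
    by apply: eq_integral => z _; rewrite indicI.
exists (i @^-1` Y0); split; [exact: cyl|exact: zY0|].
(* Over [Y0] the fibre measure at [i x] is the Dirac mass at [x], so it gives [E] mass 1 exactly
   when [x] is in [E]. *)
move=> E mE; exists (i @^-1` [set z | kappa z E = 1]).
  apply: cyl; rewrite -[X in measurable X]setTI.
    apply: (@measurable_eqe _ Z R setT measurableT (fun z => kappa z E)
      (cst 1)); [exact: mkappa|exact: measurable_cst].
have Dirac x : Y0 (i x) -> kappa (i x) E = (\1_E x)%:E.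
  move=> Yx; pose Fib := [set y | forall n, O n y <-> O n x].
  have FibE : Fib = \bigcap_n (if `[< O n x >] then O n else ~` O n).
    apply/seteqP; split => y /= yF n; first by move=> _; case: asboolP => Ox;
      [exact/yF|move/yF].
    have := yF n I; case: asboolP => Ox Oy; split => //.
  have mF : measurable Fib.
    by rewrite FibE; apply: bigcapT_measurable => n; case: ifP => // _; exact: measurableC.
  have kF : kappa (i x) Fib = 1.
    apply: ae_prob1 => //.
    have : {ae kappa (i x), forall y n, O n y <-> O n x}.
      apply: ae_all_nat => n; have := Yx n; rewrite indicE.
      have [Ox|nOx] := pselect (O n x).
        rewrite mem_set; last by rewrite /C /= /i; exact/asboolP.
        move=> k1; exists (~` O n); split; first exact: measurableC.
          exact: prob1_setC.
        by move=> y /= Hy Oy; apply: Hy.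
      rewrite memNset; last by rewrite /C /= /i => /asboolP.
      move=> k0; exists (O n); split => // y /= Hy; apply: contrapT => nOy.
      by apply: Hy.
    by [].
  rewrite indicE; have [Ex|nEx] := boolP (x \in E).
    apply/eqP; rewrite eq_le probability_le1//= -kF.
    apply: le_measure; rewrite ?inE// => y Fy; rewrite (sepO _ _ Fy).
    by rewrite inE in Ex.
  apply/eqP; rewrite eq_le measure_ge0 andbT.
  apply: le_trans (_ : _ <= kappa (i x) (~` Fib)) _; last first.
    by rewrite (prob1_setC mF kF).
  apply: le_measure; rewrite ?inE//; first exact: measurableC.
  move=> y Ey Fy; move: nEx; rewrite -(sepO _ _ Fy) => /negP; apply.
  by rewrite inE.
apply/seteqP; split => x [xE Yx]; split => //=; move: xE => /=; rewrite Dirac//.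
  by move=> Ex; rewrite indicE mem_set.
by rewrite indicE; case: (boolP (x \in E)) => [/set_mem//|_ /eqP]; rewrite eqe eq_sym oner_eq0.
Qed.

End mackey.

(** * Countable bases, and subgroups of positive Haar measure *)

Section countable_base.

Definition base_enum (T : topologicalType) (b : nat -> set T) :=
  (forall n, open (b n)) /\
  forall x W, nbhs x W -> exists n, b n x /\ b n `<=` W.

Lemma second_countable_enum (T : topologicalType) :
  @second_countable T -> exists b : nat -> set T, base_enum b.
Proof.
move=> [B cB [Bo Bb]].
have HB x W : nbhs x W -> exists U, [/\ B U, U x & U `<=` W].
  by move=> /Bb[U [BU Ux] UW]; exists U.
have /pfcard_geP[B0|[e]] := cB.
  exists (fun=> set0); split=> [n|x W xW]; first exact: open0.
  by have [U []] := HB _ _ xW; rewrite B0.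
exists e; split=> [n|x W xW]; first by apply: Bo; exact: 'funS_e.
have [U [BU Ux UW]] := HB _ _ xW.
by have [n _ en] := 'surj_e BU; exists n; rewrite en.
Qed.

Lemma open_bigcup_base (T : topologicalType) (b : nat -> set T) (W : set T) :
  base_enum b -> open W -> W = \bigcup_n (if `[< b n `<=` W >] then b n else set0).
Proof.
move=> [bo bb] oW; apply/seteqP; split => x.
  move=> Wx; have [n [bx bW]] := bb x W (open_nbhs_nbhs (conj oW Wx)).
  by exists n => //; case: asboolP.
by move=> [n _]; case: asboolP => // bW /bW.
Qed.

(* Second countability is what makes every open set of a product measurable
   for the product of the Borel sigma-algebras. *)
Lemma measurable_continuous_pair (G H : topGroupType) (K : topGroupType)
    (f : G * H -> K) (b : nat -> set G) (c : nat -> set H) :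
  base_enum b -> base_enum c -> continuous f ->
  measurable_fun [set: borel G * borel H]
    (fun x : borel G * borel H => f (x.1 : G, x.2 : H) : borel K).
Proof.
move=> bE cE /continuousP cf.
apply: (@measurability _ _ _ (borel K) _ _ (@open K)) => //.
move=> _ [U oU <-]; rewrite setTI; have oW := cf U oU; set W := f @^-1` U in oW.
pose box n m := if `[< b n `*` c m `<=` W >] then b n `*` c m else set0.
rewrite (_ : _ @^-1` _ = \bigcup_n \bigcup_m box n m).
  apply: bigcup_measurable => n _; apply: bigcup_measurable => m _.
  rewrite /box; case: ifP => _ //; apply: (@measurableX _ _ (borel G) (borel H)).
    by apply: sub_sigma_algebra; exact: bE.1.
  by apply: sub_sigma_algebra; exact: cE.1.
apply/seteqP; split => [[x y] /= fxy|[x y] [n _ [m _]]].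
  have /= : nbhs (x, y) W by exact: open_nbhs_nbhs.
  move=> [[P Q] /= [xP yQ] PQW].
  have [n [bx bP]] := bE.2 _ _ xP; have [m [cy cQ]] := cE.2 _ _ yQ.
  exists n => //; exists m => //; rewrite /box asboolT// => -[u v] [/= /bP Pu /cQ Qv].
  exact: PQW.
by rewrite /box; case: asboolP => // bcW /bcW.
Qed.

Lemma measurable_continuous_borel (G K : topGroupType) (f : G -> K) :
  continuous f -> measurable_fun [set: borel G] (f : borel G -> borel K).
Proof.
move=> /continuousP cf.
apply: (@measurability _ _ _ (borel K) _ _ (@open K)) => //.
by move=> _ [U oU <-]; rewrite setTI; apply: sub_sigma_algebra; exact: cf.
Qed.

Lemma measurable_open_borel (G : topGroupType) (U : set G) : open U ->
  measurable (U : set (borel G)).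
Proof. by move=> oU; exact: sub_sigma_algebra. Qed.

End countable_base.

Lemma lee_cancelr (R : realType) (a b c : \bar R) (e : R) : b \is a fin_num ->
  a = (c + b)%E -> (a - e%:E <= b)%E -> (c <= e%:E)%E.
Proof.
move=> bfin ->; case: b bfin => // b _; case: c => [c| |].
- by rewrite -!EFinD !lee_fin; lra.
- by [].
- by move=> _; exact: leNye.
Qed.

Section steinhaus.
Local Open Scope ereal_scope.
Context (R : realType) (G : topGroupType).

Lemma continuous_mulgl (g : G) : continuous (fun x : G => (g * x)%g).
Proof.
move=> x; have h : (fun z : G => (g, z)) @ x --> (g, x).
  by apply: cvg_pair => /=; [exact: cvg_cst|exact: cvg_id].
exact: cvg_comp h (@mulg_continuous G (g, x)).
Qed.

Lemma continuous_mulgr (g : G) : continuous (fun x : G => (x * g)%g).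
Proof.
move=> x; have h : (fun z : G => (z, g)) @ x --> (x, g).
  by apply: cvg_pair => /=; [exact: cvg_id|exact: cvg_cst].
exact: cvg_comp h (@mulg_continuous G (x, g)).
Qed.

Variables (m : {measure set (borel G) -> \bar R}).
Hypothesis mH : left_haar m.
Variable b : nat -> set G.
Hypothesis bE : base_enum b.

Let tr (g : G) (E : set (borel G)) : set (borel G) := [set x | E ((g * x)%g)].

Let mtr g E : measurable E -> measurable (tr g E).
Proof.
move=> mE; have := measurable_pre (measurable_continuous_borel (@continuous_mulgl g)) mE.
by [].
Qed.

Let trE g E : measurable E -> m (tr g E) = m E.
Proof. by move=> mE; have [+ _ _] := mH; exact. Qed.

Let symD g E : measurable E -> m E < +oo ->
  m (tr g E `\` E) = m (E `\` tr g E).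
Proof.
move=> mE Eoo; have mT := mtr g mE.
have h1 : m E = m (tr g E `\` E) + m (E `&` tr g E).
  by rewrite -(trE g mE) setIC; exact: measureDI.
have h2 : m E = m (E `\` tr g E) + m (E `&` tr g E) by exact: measureDI.
have fin : m (E `&` tr g E) \is a fin_num.
  rewrite ge0_fin_numE ?measure_ge0//; apply: le_lt_trans Eoo.
  by apply: le_measure; rewrite ?inE//; exact: measurableI.
by move: h1; rewrite h2 => /(congr1 (fun z => z - m (E `&` tr g E))); rewrite !addeK.
Qed.

(* If H were not a neighbourhood of 1, some g_n -> 1 would lie outside H, so
   that S and g_n^-1 S would be disjoint; but translation is continuous in
   measure. *)
Lemma subgroup_nbhs1 (H S : set G) : is_subgroup H ->
  measurable (S : set (borel G)) -> S `<=` H -> 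
  (exists V : set G, [/\ open V, m V < +oo & 0 < m (S `&` V)]) -> nbhs (1%g : G) H.
Proof.
move=> [H1 HM HV] mS SH [V [oV Voo SV0]]; apply: contrapT => nH.
have [g [gH gcvg]] : exists g : nat -> G, (forall n, ~ H (g n)) /\
    forall W, nbhs (1%g : G) W -> exists N, forall n, (N <= n)%N -> W (g n).
  (* Finite intersections of basic neighbourhoods of 1; points of [W n] outside [H] give a sequence
     tending to 1. *)
  pose W n := \bigcap_(i in [set i | (i < n)%N /\ b i (1%g : G)]) b i.
  have nW n : nbhs (1%g : G) (W n).
    elim: n => [|n IH].
      suff -> : W 0%N = setT by exact: filterT.
      by apply/seteqP; split => // x _ i [].
    have [bn|nbn] := pselect (b n (1%g : G)).
      have : nbhs (1%g : G) (W n `&` b n).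
        by apply: filterI => //; apply: open_nbhs_nbhs; split => //; exact: bE.1.
      apply: filterS => x [Wx bx] i [+ bi]; rewrite ltnS leq_eqVlt => /orP[/eqP->//|ltin].
      exact: Wx.
    apply: filterS IH => x Wx i [+ bi]; rewrite ltnS leq_eqVlt => /orP[/eqP in_|ltin].
      by move: bi; rewrite in_.
    exact: Wx.
  have ex n : exists x, W n x /\ ~ H x.
    apply: contrapT => /forallNP nex; apply: nH; apply: filterS (nW n) => x Wx.
    by apply: contrapT => nHx; apply: (nex x).
  have [g gP] := choice ex; exists g; split => [n|U nU]; first by case: (gP n).
  have [i [bi1 biU]] := bE.2 _ _ nU; exists i.+1 => n lin; apply: biU.
  by case: (gP n) => + _; apply.
(* [Pr E]: the part of [E] in [V] that is lost by translating by [g n] becomes negligible. It holds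
   for open sets and passes to complements and countable unions, hence to Borel sets. Cutting by
   [V], of finite measure, makes the subtractions legitimate. *)
pose Pr (E : set (borel G)) := forall e : R, (0 < e)%R -> exists N, forall n, (N <= n)%N ->
  (m ((E `&` V) `\` tr (g n) (E `&` V)) <= e%:E)%E.
have mV : measurable (V : set (borel G)) by exact: measurable_open_borel.
have VE (E : set (borel G)) : measurable E -> m (E `&` V) < +oo.
  move=> mE; apply: le_lt_trans Voo; apply: le_measure; rewrite ?inE//.
  exact: measurableI.
have Pro (E : set (borel G)) : open (E : set G) -> Pr E.
  move=> oE e e0; set D := E `&` V.
  have oD : open (D : set G) by exact: openI.
  have mD : measurable D by exact: measurable_open_borel.
  have mE : measurable E by exact: measurable_open_borel.
  have Dfin : m D \is a fin_num by rewrite ge0_fin_numE ?measure_ge0//; exact: VE.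
  pose F N := \bigcap_(n in [set n | (N <= n)%N]) (D `&` tr (g n) D).
  have mF N : measurable (F N).
    apply: bigcap_measurable; first by exists N => /=.
    by move=> n _; apply: measurableI => //; exact: mtr.
  have ndF : nondecreasing_seq F.
    move=> p q pq; apply/subsetPset => x Fx n /= qn; apply: Fx => /=.
    exact: leq_trans pq qn.
  have UF : \bigcup_N F N = D.
    apply/seteqP; split => x; first by move=> [N _ Fx]; have [] := Fx N (leqnn _).
    move=> Dx; have : nbhs (1%g : G) (fun h => D ((h * x)%g)).
      apply: (@continuous_mulgr x (1%g : G)); rewrite mul1g.
      exact: open_nbhs_nbhs.
    by move=> /gcvg[N HN]; exists N => // n /= Nn; split => //; exact: HN.
  have FD : m \o F @ \oo --> m D by rewrite -UF; apply: nondecreasing_cvg_mu; rewrite ?UF.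
  have [N HN] : exists N, m D - e%:E < m (F N).
    apply: contrapT => /forallNP nN.
    have : m D <= m D - e%:E.
      by apply: (cvge_to_le FD); apply: nearW => N; rewrite leNgt; exact/negP/nN.
    by apply/negP; rewrite -ltNge lteBlDr// lteDl// lte_fin.
  exists N => n Nn; have FT : F N `<=` D `&` tr (g n) D by move=> x; exact.
  have mDT : measurable (D `&` tr (g n) D) by apply: measurableI => //; exact: mtr.
  have mDF : m (F N) <= m (D `&` tr (g n) D) by apply: le_measure; rewrite ?inE.
  have h := measureDI m mD (mtr (g n) mD).
  have fin2 : m (D `&` tr (g n) D) \is a fin_num.
    rewrite ge0_fin_numE ?measure_ge0//; apply: le_lt_trans (VE E mE).
    by apply: le_measure; rewrite ?inE//.
  exact: lee_cancelr fin2 h (le_trans (ltW HN) mDF).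
have PrD (E E' : set (borel G)) : measurable E -> measurable E' -> Pr E -> Pr E' -> Pr (E `|` E').
  move=> mE mE' PE PE' e e0; have e20 : (0 < e / 2)%R by rewrite divr_gt0.
  have [N HN] := PE _ e20; have [N' HN'] := PE' _ e20.
  exists (maxn N N') => n; rewrite geq_max => /andP[Nn N'n].
  have mEV := measurableI _ _ mE mV; have mEV' := measurableI _ _ mE' mV.
  apply: le_trans (_ : m (((E `&` V) `\` tr (g n) (E `&` V)) `|`
      ((E' `&` V) `\` tr (g n) (E' `&` V))) <= _).
    apply: le_measure; rewrite ?inE.
    - apply: measurableD; first by apply: measurableI => //; exact: measurableU.
      by apply: mtr; apply: measurableI => //; exact: measurableU.
    - by apply: measurableU; apply: measurableD => //; exact: mtr.
    - move=> x [[[Ex|E'x] Vx] /= nT].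
        by left; split => //= -[? ?]; apply: nT; split => //; left.
      by right; split => //= -[? ?]; apply: nT; split => //; right.
  apply: le_trans (measureU2 _ _ _) _; try by apply: measurableD => //; exact: mtr.
  by rewrite (splitr e) EFinD; apply: leeD; [exact: HN|exact: HN'].
have PrV : Pr setT by apply: Pro; exact: openT.
have PrC (E : set (borel G)) : measurable E -> Pr E -> Pr (~` E).
  move=> mE PE e e0; have e20 : (0 < e / 2)%R by rewrite divr_gt0.
  have [N HN] := PE _ e20; have [N' HN'] := PrV _ e20.
  exists (maxn N N') => n; rewrite geq_max => /andP[Nn N'n].
  have mEV := measurableI _ _ mE mV; have mCV := measurableI _ _ (measurableC mE) mV.
  have mTV : measurable ((setT : set (borel G)) `&` V) by exact: measurableI.
  apply: le_trans (_ : m ((((setT : set (borel G)) `&` V) `\` tr (g n) ((setT : set (borel G)) `&` V)) `|`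
      (tr (g n) (E `&` V) `\` (E `&` V))) <= _).
    apply: le_measure; rewrite ?inE.
    - by apply: measurableD => //; exact: mtr.
    - by apply: measurableU; apply: measurableD => //; exact: mtr.
    - move=> x [[/= nEx Vx] nT].
      have [VT|nVT] := pselect (V (g n * x)%g); last first.
        by left; split => //= -[].
      right; split => /=; last by case.
      by split => //; apply: contrapT => nE; apply: nT.
  apply: le_trans (measureU2 _ _ _) _; try by apply: measurableD => //; exact: mtr.
  rewrite (splitr e) EFinD; apply: leeD; first exact: HN'.
  (* By invariance of [m], a set of finite measure gains under translation as much mass as it
     loses. *)
  by rewrite [X in X <= _](symD (g n) mEV (VE _ mE)); exact: HN.
have PrU (E : nat -> set (borel G)) : (forall n, measurable (E n)) ->
    (forall n, Pr (E n)) -> Pr (\bigcup_n E n).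
  move=> mE PE; pose F n := \big[setU/set0]_(i < n) E i.
  have mF n : measurable (F n) by exact: bigsetU_measurable.
  have PF n : Pr (F n).
    elim: n => [|n IH].
      move=> e e0; exists 0%N => n _.
      by rewrite /F big_ord0 set0I set0D measure0 lee_fin ltW.
    rewrite /F big_ord_recr /=.
    by apply: PrD; [exact: mF|exact: mE|exact: IH|exact: PE].
  move=> e e0; have e20 : (0 < e / 2)%R by rewrite divr_gt0.
  have mUE : measurable (\bigcup_n E n) by exact: bigcup_measurable.
  set D : set (borel G) := (\bigcup_n E n) `&` V.
  have mD : measurable D by exact: measurableI.
  have DU : \bigcup_n (F n `&` V) = D.
    rewrite -setI_bigcupl; congr (_ `&` _); apply/seteqP; split => x.
      by move=> [n _]; rewrite /F -bigcup_mkord => -[i _ Ei]; exists i.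
    move=> [n _ En]; exists n.+1 => //; rewrite /F -bigcup_mkord.
    by exists n => /=.
  have mFV n : measurable (F n `&` V) by exact: measurableI.
  have FD : (fun n => m (F n `&` V)) @ \oo --> m D.
    rewrite -DU; apply: nondecreasing_cvg_mu => //; first by rewrite DU.
    by move=> p q pq; apply/subsetPset; apply: setSI; exact: subset_bigsetU.
  have Dfin : m D \is a fin_num by rewrite ge0_fin_numE ?measure_ge0//; exact: VE.
  have [k Hk] : exists k, m D - (e / 2)%:E < m (F k `&` V).
    apply: contrapT => /forallNP nN.
    have : m D <= m D - (e / 2)%:E.
      by apply: (cvge_to_le FD); apply: nearW => N; rewrite leNgt; exact/negP/nN.
    by apply/negP; rewrite -ltNge lteBlDr// lteDl// lte_fin.
  have FkD : F k `&` V `<=` D by rewrite -DU => x; exists k.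
  have hk : m (D `\` (F k `&` V)) <= (e / 2)%:E.
    have := measureDI m mD (mFV k); rewrite (setIidr FkD) => h.
    have fin2 : m (F k `&` V) \is a fin_num.
      by rewrite ge0_fin_numE ?measure_ge0//; exact: VE.
    exact: lee_cancelr fin2 h (ltW Hk).
  have [N HN] := PF k _ e20; exists N => n Nn.
  apply: le_trans (_ : m (((F k `&` V) `\` tr (g n) (F k `&` V)) `|`
      (D `\` (F k `&` V))) <= _).
    apply: le_measure; rewrite ?inE.
    - by apply: measurableD => //; exact: mtr.
    - by apply: measurableU; apply: measurableD => //; exact: mtr.
    - move=> x [Dx nT]; have [Fx|nFx] := pselect ((F k `&` V) x); last by right.
      by left; split => // Tx; apply: nT; apply: FkD.
  apply: le_trans (measureU2 _ _ _) _; try by apply: measurableD => //; exact: mtr.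
  by rewrite (splitr e) EFinD; apply: leeD => //; exact: HN.
have PrS : Pr S.
  have : <<s @open G >> S by exact: mS.
  move: S {mS SH SV0}; apply: (@dynkin_induction _ (borel G) (@open G) Pr) => //.
    by move=> X Y; exact: openI.
  by move=> E mE _ PE; exact: PrU.
have mSV : measurable ((S : set (borel G)) `&` V) by exact: measurableI.
have : m (S `&` V) <= 0.
  apply/lee_addgt0Pr => e e0; rewrite add0e; have [N HN] := PrS _ e0.
  apply: le_trans (HN N (leqnn _)); apply: le_measure; rewrite ?inE//.
    by apply: measurableD => //; exact: mtr.
  move=> x [Sx Vx]; split => //= -[Sgx _]; apply: (gH N).
  have -> : g N = (g N * x * x^-1)%g by rewrite mulgK.
  by apply: HM; [exact: SH|apply: HV; exact: SH].
by rewrite leNgt SV0.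
Qed.

End steinhaus.

(** * Products of groups: base, Borel sets, Haar measure and the law [mu] *)

Section product_of_groups.
Context (k : nat) (Gs : 'I_k -> topGroupType) (hG : forall i, lcsc (Gs i)).
Local Notation G := (prod_group Gs).

Definition box (U : forall i, set (Gs i)) : set G := [set g | forall i, U i (g i)].

Lemma box_nbhs (U : forall i, set (Gs i)) (g : G) :
  (forall i, nbhs (g i) (U i)) -> nbhs g (box U).
Proof.
move=> gU; apply: (@filter_forall G 'I_k (fun i (h : G) => U i (h i)) (nbhs g) _) => i.
exact: (prod_group_proj_continuous (gU i)).
Qed.

Lemma box_open (U : forall i, set (Gs i)) : (forall i, open (U i)) -> open (box U).
Proof.
move=> oU; rewrite openE => g gU; apply: box_nbhs => i.
by apply: open_nbhs_nbhs; split; [exact: oU|exact: gU].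
Qed.

Lemma prod_group_base : exists b : nat -> set G, base_enum b /\
  forall n, exists2 U : forall i, set (Gs i), (forall i, open (U i)) & b n = box U.
Proof.
have /(_ _)/cid-/all_sig[bi biE] i : exists b : nat -> set (Gs i), base_enum b.
  by apply: second_countable_enum; case: (hG i).
pose bx (c : {ffun 'I_k -> nat}) := box (fun i => bi i (c i)).
have obx c : open (bx c) by apply: box_open => i; exact: (biE i).1.
have base g (U : forall i, set (Gs i)) : (forall i, nbhs (g i) (U i)) ->
    exists c, bx c g /\ forall i, bi i (c i) `<=` U i.
  move=> gU; have /(_ _)/cid-/all_sig[c cP] i := (biE i).2 _ _ (gU i).
  exists [ffun i => c i]; split => i; rewrite ffunE; first exact: (cP i).1.
  exact: (cP i).2.
pose b n := bx (odflt [ffun=> 0%N] (choice.unpickle n)).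
exists b; split; last first.
  by move=> n; eexists; last reflexivity; move=> i; exact: (biE i).1.
split=> [n|g W]; first exact: obx.
(* The product topology is the supremum of the coordinate topologies, so convergence of the filter
   of basic boxes around [g] can be checked one coordinate at a time. *)
pose F := filter_from [set c | bx c g] bx.
have FF : Filter F.
  apply: filter_from_filter.
    have [c [gc _]] := base g (fun=> setT) (fun=> filterT).
    by exists c.
  move=> c c' gc gc'.
  have [|c'' [gc'' c''P]] := base g (fun i => bi i (c i) `&` bi i (c' i)).
    move=> i; apply: filterI; apply: open_nbhs_nbhs; split;
      [exact: (biE i).1|exact: gc|exact: (biE i).1|exact: gc'].
  by exists c'' => // h hc''; split => i; have [] := c''P i _ (hc'' i).
have Fg : F --> g.
  apply/cvg_sup => i U [V] [[W' oW <-] Wg] WU.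
  apply: (filterS WU).
  have [c [gc _]] := base g (fun=> setT) (fun=> filterT).
  have [n [gn nW]] := (biE i).2 _ _ (open_nbhs_nbhs (conj oW Wg)).
  exists [ffun j => if j == i then n else c j].
    by move=> j; rewrite ffunE; case: eqP => [->|_] //; exact: gc.
  by move=> h /(_ i); rewrite ffunE eqxx => /nW.
move=> /Fg[c gc cW]; exists (choice.pickle c).
by rewrite /b choice.pickleK.
Qed.

End product_of_groups.

Section product_measurability.
Context (k : nat) (Gs : 'I_k -> topGroupType) (hG : forall i, lcsc (Gs i)).
Local Notation G := (prod_group Gs).

Lemma measurable_coord i : measurable_fun [set: borel G] (fun g : borel G => g i : borel (Gs i)).
Proof. exact: (measurable_continuous_borel (@prod_group_proj_continuous _ Gs i)). Qed.

Lemma measurable_box (U : forall i, set (borel (Gs i))) :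
  (forall i, measurable (U i)) -> measurable (box U : set (borel G)).
Proof.
move=> mU; rewrite (_ : box U =
    \bigcap_(i in [set: 'I_k]) ((fun g : borel G => g i : borel (Gs i)) @^-1` U i)).
  apply: fin_bigcap_measurable => // i _.
  exact: measurable_pre (@measurable_coord i) (mU i).
by apply/seteqP; split => [g gU i _|g gU i]; exact: gU.
Qed.

Definition measurable_boxes : set (set (borel G)) :=
  [set E | exists2 U : forall i, set (borel (Gs i)),
     (forall i, measurable (U i)) & E = box U].

(** An open set is a countable union of open boxes, by second countability; so the Borel structure
    of the product is the product of the Borel structures. *)
Lemma borel_boxes : @measurable _ (borel G) = <<s measurable_boxes >>.
Proof.
have [b [bE bbox]] := prod_group_base hG.
apply/seteqP; split.
  apply: smallest_sub; first exact: smallest_sigma_algebra.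
  move=> W oW; rewrite (open_bigcup_base bE oW).
  apply: sigma_algebra_bigcup => n; case: asboolP => _; last exact: sigma_algebra0.
  have [U oU ->] := bbox n; apply: sub_sigma_algebra; exists U => // i.
  exact: measurable_open_borel.
apply: smallest_sub; first exact: sigma_algebra_measurable.
by move=> _ [U mU ->]; exact: measurable_box.
Qed.

Lemma measurable_boxesI : setI_closed measurable_boxes.
Proof.
move=> _ _ [U mU ->] [V mV ->]; exists (fun i => U i `&` V i).
  by move=> i; exact: measurableI.
apply/seteqP; split => [g [gU gV] i|g gUV]; first by split; [exact: gU|exact: gV].
by split => i; have [] := gUV i.
Qed.

Lemma measurable_prod_group d (T : measurableType d) (f : T -> borel G) :
  (forall i, measurable_fun setT (fun t => f t i : borel (Gs i))) ->
  measurable_fun setT f.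
Proof.
move=> mf; apply: (measurability _ borel_boxes) => // _ [_ [U mU ->] <-].
rewrite setTI (_ : _ @^-1` _ =
    \bigcap_(i in [set: 'I_k]) ((fun t => f t i : borel (Gs i)) @^-1` U i)).
  by apply: fin_bigcap_measurable => // i _; exact: measurable_pre (mf i) (mU i).
by apply/seteqP; split => [t ft i _|t ft i]; exact: ft.
Qed.

Lemma measurable_mulg : measurable_fun [set: borel G * borel G]
  (fun z : borel G * borel G => (z.1 * z.2 : G)%g : borel G).
Proof.
have [b [bE _]] := prod_group_base hG.
exact: (measurable_continuous_pair bE bE (@mulg_continuous G)).
Qed.

(** With [proj_off] this splits [g] into commuting parts in $G_j$ and in its cofactor, both kept
    inside [G] so that they act on the same spaces. *)
Definition proj_at (j : 'I_k) (g : G) : G := fun i => if i == j then g i else 1%g.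
Definition proj_off (j : 'I_k) (g : G) : G := fun i => if i == j then 1%g else g i.

Lemma measurable_proj_at j : measurable_fun [set: borel G] (proj_at j : borel G -> borel G).
Proof.
apply: measurable_prod_group => i; rewrite /proj_at.
by case: (i == j); [exact: measurable_coord|exact: measurable_cst].
Qed.

Lemma measurable_proj_off j : measurable_fun [set: borel G] (proj_off j : borel G -> borel G).
Proof.
apply: measurable_prod_group => i; rewrite /proj_off.
by case: (i == j); [exact: measurable_cst|exact: measurable_coord].
Qed.

Lemma proj_at1 j : proj_at j 1%g = 1%g.
Proof. by apply: functional_extensionality_dep => i; rewrite /proj_at; case: ifP. Qed.
Lemma proj_off1 j : proj_off j 1%g = 1%g.
Proof. by apply: functional_extensionality_dep => i; rewrite /proj_off; case: ifP. Qed.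
Lemma proj_atM j (g h : G) : proj_at j (g * h)%g = (proj_at j g * proj_at j h)%g.
Proof.
apply: functional_extensionality_dep => i; rewrite /proj_at /=.
rewrite -[RHS]/((proj_at j g i * proj_at j h i)%g) /proj_at.
by case: ifP => // _; rewrite mulg1.
Qed.
Lemma proj_offM j (g h : G) : proj_off j (g * h)%g = (proj_off j g * proj_off j h)%g.
Proof.
apply: functional_extensionality_dep => i; rewrite /proj_off /=.
rewrite -[RHS]/((proj_off j g i * proj_off j h i)%g) /proj_off.
by case: ifP => // _; rewrite mulg1.
Qed.
Lemma proj_at_off j (g h : G) :
  (proj_at j g * proj_off j h)%g = (fun i => if i == j then g i else h i) :> G.
Proof.
apply: functional_extensionality_dep => i.
rewrite -[LHS]/((proj_at j g i * proj_off j h i)%g) /proj_at /proj_off.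
by case: ifP => // _; rewrite ?mulg1 ?mul1g.
Qed.
Lemma proj_off_at j (g h : G) :
  (proj_off j h * proj_at j g)%g = (proj_at j g * proj_off j h)%g.
Proof.
rewrite proj_at_off; apply: functional_extensionality_dep => i.
rewrite -[LHS]/((proj_off j h i * proj_at j g i)%g) /proj_at /proj_off.
by case: ifP => // _; rewrite ?mulg1 ?mul1g.
Qed.
Lemma proj_at_offK j (g : G) : (proj_at j g * proj_off j g)%g = g.
Proof.
by rewrite proj_at_off; apply: functional_extensionality_dep => i; case: ifP.
Qed.
Lemma proj_off_cofactor j (g : G) : cofactor_subgroup j g -> proj_off j g = g.
Proof.
move=> gj; apply: functional_extensionality_dep => i; rewrite /proj_off.
by case: eqP => // ->; rewrite [RHS]gj.
Qed.
Lemma cofactor_proj_off j (g : G) : cofactor_subgroup j (proj_off j g).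
Proof. by rewrite /cofactor_subgroup /= /proj_off eqxx. Qed.

Context (R : realType).

(* The Haar measure of a product group is finite on a countable cover. *)
Lemma haar_cover (m : {measure set (borel G) -> \bar R}) (S : set (borel G)) :
  left_haar m -> measurable S -> m S <> 0%E ->
  exists V : set G, [/\ open V, (m V < +oo)%E & (0 < m (S `&` V))%E].
Proof.
move=> [_ mcpt _] mS mS0; have [b [bE _]] := prod_group_base hG.
apply: contrapT => /forallNP nV; apply: mS0.
pose D n : set (borel G) := if `[< (m (b n) < +oo)%E >] then b n else set0.
have mb n : measurable (b n : set (borel G)).
  by apply: measurable_open_borel; exact: bE.1.
have mD n : measurable (D n) by rewrite /D; case: ifP.
have SD n : m (S `&` D n) = 0%E.
  rewrite /D; case: asboolP => bn; last by rewrite setI0 measure0.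
  apply/eqP; rewrite eq_le measure_ge0 andbT leNgt; apply/negP => Sb.
  by apply: (nV (b n)); split => //; exact: bE.1.
have cover : \bigcup_n D n = setT.
  apply/seteqP; split => // g _.
  (* A box of compact neighbourhoods is compact, so it has finite Haar measure, and so has any basic
     open set inside it. *)
  have /(_ _)/cid-/all_sig[K KP] i : exists K : set (Gs i),
      [/\ nbhs (g i) K, compact K & closed K].
    have [_ lc _] := hG i; have [K gK [cK clK]] := lc (g i) I.
    by exists K; split => //; move: gK; rewrite withinET.
  have gK : nbhs g (box K) by apply: box_nbhs => i; case: (KP i).
  have [n [bg bK]] := bE.2 _ _ gK; exists n => //; rewrite /D asboolT//.
  apply: le_lt_trans (mcpt (box K) _).
    apply: le_measure; rewrite ?inE//; apply: measurable_box => i.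
    rewrite -[K i]setCK; apply: measurableC; apply: measurable_open_borel.
    by apply: closed_openC; case: (KP i).
  by apply: (@tychonoff _ Gs K) => i; case: (KP i).
apply/(negligibleP m mS).
rewrite -[S]setIT -cover setI_bigcupr.
apply: negligible_bigcup => n; apply/negligibleP; last exact: SD.
exact: measurableI.
Qed.

(** Since [mu] is not singular to Haar measure, the complement of a [mu]-null set containing
    everything outside [H] has positive Haar measure, so [H] is a neighbourhood of 1. An open
    subgroup of full measure contains the support of [mu], which generates. *)
Lemma subgroup_ae_full (mu : probability (borel G) R) (H : set G) :
  admissible mu -> is_subgroup H -> {ae mu, forall g, H g} -> H = setT.
Proof.
move=> [[m mH nsing] supp] sH [N [mN N0 NH]].
have mS := measurableC mN; set S := ~` N in mS.
have SH : S `<=` H by move=> g gN; apply: contrapT => nHg; apply: gN; exact: NH.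
have mS0 : m S <> 0%E by move=> mS0; apply: nsing; exists N; split.
have [b [bE _]] := prod_group_base hG.
have H1 := subgroup_nbhs1 mH bE sH mS SH (haar_cover mH mS mS0).
have [H_1 HM HV] := sH.
apply: supp => // g gsupp; apply: contrapT => nHg.
(* The coset of [g]: an open neighbourhood of [g] which misses [H] if [g] is not in [H], hence is
   null, against [g] being in the support. *)
pose W : set G := (fun x => (g^-1 * x)%g) @^-1` H°.
have oW : open W.
  by have /continuousP := @continuous_mulgl G g^-1%g; apply; exact: open_interior.
have Wg : W g by rewrite /W /= mulVg.
have := gsupp W oW Wg; rewrite lt0e => /andP[/eqP W0 _]; apply: W0.
apply: subset_measure0 N0 => //; first exact: measurable_open_borel.
move=> x Wx; apply: NH => /= Hx; apply: nHg.
have Hgx : H (g^-1 * x)%g by exact: interior_subset Wx.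
have -> : g = (x * (g^-1 * x)^-1)%g by rewrite invgM invgK mulgA mulgV mul1g.
by apply: HM => //; exact: HV.
Qed.

Context (mu : probability (borel G) R)
  (mus : forall i, probability (borel (Gs i)) R)
  (hprod : is_product_law
      (fun i (g : borel (prod_group Gs)) => g i : borel (Gs i)) mus mu).

Let mix j (z : borel G * borel G) : borel G := (proj_at j z.1 * proj_off j z.2)%g.

Let mmix j : measurable_fun setT (mix j).
Proof.
apply: measurable_prod_group => i; rewrite /mix.
under eq_fun do rewrite proj_at_off.
case: (i == j).
  exact: measurableT_comp (@measurable_coord i) measurable_fst.
exact: measurableT_comp (@measurable_coord i) measurable_snd.
Qed.

Local Open Scope ereal_scope.

(* mu is the law of the product of two independent elements, one of G_j and
   one of its cofactor. *)
Lemma integral_mix j (F : borel G -> \bar R) :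
  measurable_fun setT F -> (forall g, 0 <= F g) ->
  \int[mu]_g F g = \int[mu]_g \int[mu]_h F (proj_at j g * proj_off j h)%g.
Proof.
move=> mF F0.
have -> : \int[mu]_g \int[mu]_h F (proj_at j g * proj_off j h)%g =
    \int[mu \x mu]_z F (mix j z).
  by rewrite fubini_tonelli1//; exact: measurableT_comp mF (mmix j).
transitivity (\int[mu]_g (1 * F g)); first by apply: eq_integral => g _; rewrite mul1e.
transitivity (\int[mu \x mu]_z (1 * F (mix j z))); last first.
  by apply: eq_integral => g _; rewrite mul1e.
apply: (@density_integral R _ _ _ _ _ _ mu (mu \x mu) id (mix j) (cst 1) (cst 1)) => //.
apply: (@density_unique R _ _ _ _ _ _ mu (mu \x mu) id (mix j) (cst 1) (cst 1)
  measurable_boxes) => //.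
- by rewrite integral_cst// mul1e [X in X < _]probability_setT ltry.
- exact: borel_boxes.
- exact: measurable_boxesI.
- have e : (mu \x mu) [set: borel G * borel G] = 1.
    by rewrite -setXTT prod_probE// probability_setT mul1e.
  by rewrite !integral_cst// !mul1e [LHS]probability_setT [RHS]e.
move=> _ [U mU ->].
under eq_integral do rewrite mul1e.
under [RHS]eq_integral do rewrite mul1e.
have mbU : measurable (box U : set (borel G)) by exact: measurable_box.
transitivity (mu (box U)); first by rewrite integral_setT_indic.
transitivity ((mu \x mu) (mix j @^-1` (box U))); last by rewrite integral_indic_pre.
(* The coordinates other than [j]. The product law applied to [j :: s], to [s] and to [j] alone
   gives the factorization on boxes. *)
pose s := [seq i <- enum 'I_k | i != j].
have us : uniq s by rewrite filter_uniq// enum_uniq.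
have js : j \notin s by rewrite mem_filter eqxx.
have cap1 : \bigcap_(i in [set` (j :: s)]) ((fun g : borel G => g i : borel (Gs i)) @^-1` U i)
    = box U.
  apply/seteqP; split => g gU i; last by move=> _; exact: gU.
  by apply: gU; rewrite /= inE mem_filter mem_enum andbT; case: eqP.
have h1 := hprod (s := j :: s) (E := U); rewrite /= js us in h1.
have h2 := hprod us mU.
have h3 := hprod (s := [:: j]) (E := U) isT mU.
rewrite cap1 in h1; rewrite (h1 isT mU) big_cons EFinM.
rewrite big_seq1 in h3; rewrite -h2 -h3.
have mcap (t : seq 'I_k) : measurable (\bigcap_(i in [set` t]) ((fun g : borel G => g i : borel (Gs i)) @^-1` U i)).
  apply: fin_bigcap_measurable => // i _.
  exact: measurable_pre (@measurable_coord i) (mU i).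
rewrite -prod_probE//; congr ((mu \x mu) _); apply/seteqP; split => [[g h]|[g h]].
  move=> [/= gU hU] i; rewrite /mix /= proj_at_off; case: eqP => [->|/eqP ij].
    by apply: gU; rewrite /= inE.
  by apply: hU; rewrite /= mem_filter ij mem_enum.
rewrite /mix /= => ghU; split => /= i.
  move=> hi; have -> : i = j by apply/eqP; rewrite -mem_seq1; exact: hi.
  by have := ghU j; rewrite proj_at_off eqxx.
move=> hi; have : i \in s by exact: hi.
rewrite mem_filter => /andP[ij _]; have := ghU i.
by rewrite proj_at_off (negbTE ij).
Qed.

End product_measurability.

(** * Stationary measures absolutely continuous with respect to an ergodic one *)

Section total_integrals.
Local Open Scope ereal_scope.
Context (R : realType) d (T : measurableType d) d' (U : measurableType d').

Lemma ge0_integralTZl (m : {measure set T -> \bar R}) (f : T -> \bar R) (c : \bar R) :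
  measurable_fun setT f -> (forall x, 0 <= f x) -> 0 <= c ->
  \int[m]_x (c * f x) = c * \int[m]_x f x.
Proof. by move=> mf f0 c0; exact: (ge0_integralZl m measurableT mf (fun x _ => f0 x)). Qed.

Lemma ge0_integralTD (m : {measure set T -> \bar R}) (f g : T -> \bar R) :
  measurable_fun setT f -> measurable_fun setT g ->
  (forall x, 0 <= f x) -> (forall x, 0 <= g x) ->
  \int[m]_x (f x + g x) = \int[m]_x f x + \int[m]_x g x.
Proof.
move=> mf mg f0 g0.
exact: (ge0_integralD m measurableT (fun x _ => f0 x) mf (fun x _ => g0 x) mg).
Qed.

Lemma ge0_integral_eq0_ae (m : {measure set T -> \bar R}) (f : T -> \bar R) :
  measurable_fun setT f -> (forall x, 0 <= f x) -> \int[m]_x f x = 0 ->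
  {ae m, forall x, f x = 0}.
Proof.
move=> mf f0 i0; have i0' : \int[m]_x `|f x| = 0.
  by rewrite -i0; apply: eq_integral => x _; rewrite gee0_abs.
have /(ae_eq_integral_abs m measurableT mf) := i0'.
by apply: filterS => x; apply.
Qed.

Lemma measurable_integral_fst (P : probability U R) (f : T * U -> \bar R) :
  measurable_fun setT f -> (forall z, 0 <= f z) ->
  measurable_fun setT (fun x => \int[P]_y f (x, y)).
Proof. by move=> mf f0; exact: (@measurable_fun_fubini_tonelli_F _ _ _ _ _ P f mf f0). Qed.

Lemma measurable_integral_snd (P : probability T R) (f : T * U -> \bar R) :
  measurable_fun setT f -> (forall z, 0 <= f z) ->
  measurable_fun setT (fun y => \int[P]_x f (x, y)).
Proof. by move=> mf f0; exact: (@measurable_fun_fubini_tonelli_G _ _ _ _ _ P f mf f0). Qed.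

Lemma tonelli_exchange (P : probability T R) (Q : probability U R) (f : T * U -> \bar R) :
  measurable_fun setT f -> (forall z, 0 <= f z) ->
  \int[P]_x \int[Q]_y f (x, y) = \int[Q]_y \int[P]_x f (x, y).
Proof. by move=> mf f0; have := @fubini_tonelli _ _ _ _ _ P Q f mf f0. Qed.

End total_integrals.

Lemma ge0_addeI_fin (R : realType) (a b c : \bar R) : (0 <= a)%E -> (0 <= b)%E ->
  (a + b < +oo)%E -> (a + c = a + b)%E -> c = b /\ b \is a fin_num.
Proof.
move: a b c => [a| |] [b| |] [c| |] //= _ _ _ [] /addrI -> //.
Qed.

(** The weight [r] lives where [f <= c] and [q] where [f > c]. Equal masses and equal [f]-masses
    give $\int(f-c)q=\int(f-c)r\le 0$, while $f-c>0$ where [q] is not 0; so [q] vanishes almost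
    everywhere. *)
Lemma level_weights (R : realType) d (S : measurableType d) (nu : {measure set S -> \bar R})
    (f : S -> R) (c : R) (q r : S -> \bar R) :
  measurable_fun setT f -> measurable_fun setT q -> measurable_fun setT r ->
  (forall x, 0 <= f x)%R -> (forall x, 0 <= q x)%E -> (forall x, 0 <= r x)%E -> (0 <= c)%R ->
  (\int[nu]_x r x = \int[nu]_x q x)%E -> (\int[nu]_x q x)%E \is a fin_num ->
  (\int[nu]_x ((f x)%:E * r x) = \int[nu]_x ((f x)%:E * q x))%E ->
  (forall x, (f x <= c)%R \/ r x = 0%E) -> (forall x, (c < f x)%R \/ q x = 0%E) ->
  (\int[nu]_x q x = 0)%E.
Proof.
move=> mf mq mr f0 q0 r0 c0 rq qfin frq fr fq.
have mfE : measurable_fun setT (fun x => (f x)%:E) by exact/measurable_EFinP.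
have c0' : (0 <= c%:E)%E by rewrite lee_fin.
have le1 : (\int[nu]_x ((f x)%:E * r x) <= c%:E * \int[nu]_x r x)%E.
  rewrite -(ge0_integralTZl nu mr r0 c0'); apply: ge0_le_integral => //.
  - by move=> x _; rewrite mule_ge0// lee_fin.
  - exact: emeasurable_funM.
  - exact: measurable_funeM.
  - by move=> x _; have [fc|->] := fr x; [rewrite lee_wpmul2r// lee_fin|rewrite !mule0].
pose g x : \bar R := (Num.max 0 (f x - c))%:E.
have g0 x : (0 <= g x)%E by rewrite lee_fin le_max lexx.
have mg : measurable_fun setT g.
  apply/measurable_EFinP; apply: measurable_maxr => //.
  exact: measurable_funB.
have fgq x : ((f x)%:E * q x = c%:E * q x + g x * q x)%E.
  have [fc|->] := fq x; last by rewrite !mule0 adde0.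
  rewrite -ge0_muleDl//; congr (_ * _)%E.
  by rewrite -EFinD max_r ?subr_ge0 ?ltW// addrC subrK.
have gq0 x : (0 <= g x * q x)%E by rewrite mule_ge0.
have igq0 : (\int[nu]_x (g x * q x) = 0)%E.
  have hs : (\int[nu]_x ((f x)%:E * q x) =
      c%:E * \int[nu]_x q x + \int[nu]_x (g x * q x))%E.
    rewrite -(ge0_integralTZl nu mq q0 c0') -ge0_integralTD//.
    - by apply: eq_integral => x _; rewrite fgq.
    - exact: measurable_funeM.
    - exact: emeasurable_funM.
    - by move=> x; rewrite mule_ge0.
  move: le1; rewrite frq rq hs -[leRHS]adde0 leeD2lE ?fin_numM// => le1'.
  by apply/eqP; rewrite eq_le le1' integral_ge0.
rewrite (ge0_ae_eq_integral (g := cst 0%E))//; first by rewrite integral0.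
apply: filterS (ge0_integral_eq0_ae (emeasurable_funM mg mq) gq0 igq0).
move=> x /eqP; rewrite mule_eq0 => /orP[|/eqP//] /eqP[gx] _.
have [fc|//] := fq x.
by move: gx => /eqP; rewrite eq_maxl subr_le0 leNgt fc.
Qed.

Section stationary_densities.
Local Open Scope ereal_scope.
Context (R : realType) d (Om : measurableType d) d' (S : measurableType d').
Variables (P : probability Om R) (nu : probability S R) (a : Om * S -> S).
Hypothesis ma : measurable_fun setT a.
Variable f : S -> R.
Hypotheses (mf : measurable_fun setT f) (f0 : forall x, (0 <= f x)%R)
  (foo : \int[nu]_x (f x)%:E < +oo).
Hypothesis stat1 : forall E, measurable E ->
  \int[P]_w nu [set x | E (a (w, x))] = nu E.
Hypothesis stat2 : forall E, measurable E ->
  \int[P]_w \int[nu]_x ((f x)%:E * (\1_E (a (w, x)))%:E) =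
  \int[nu]_x ((f x)%:E * (\1_E x)%:E).

Let mfE : measurable_fun setT (fun x => (f x)%:E). Proof. exact/measurable_EFinP. Qed.

Let pr (E : set S) x : \bar R := \int[P]_w (\1_E (a (w, x)))%:E.

Let maE E : measurable E -> measurable_fun setT (fun z => (\1_E (a z))%:E : \bar R).
Proof. by move=> mE; exact: measurable_indic_comp. Qed.

Let mpr E : measurable E -> measurable_fun setT (pr E).
Proof.
move=> mE; apply: (@measurable_fun_fubini_tonelli_G _ _ _ _ _ P _ (maE mE)).
by move=> z; rewrite lee_fin.
Qed.

Let pr0 E x : 0 <= pr E x.
Proof. by apply: integral_ge0 => w _; rewrite lee_fin. Qed.

Let prD E x : measurable E -> pr E x + pr (~` E) x = 1.
Proof.
move=> mE; have mx F : measurable F -> measurable_fun setT (fun w => (\1_F (a (w, x)))%:E : \bar R).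
  by move=> mF; exact: measurableT_comp (maE mF) (pair2_measurable x).
rewrite -ge0_integralD//; [|exact: mx|exact: (mx _ (measurableC mE))].
rewrite (eq_integral (cst 1)); last first.
  move=> w _; rewrite !indicE in_setC.
  by case: (a (w, x) \in E); rewrite /= ?adde0 ?add0e.
by rewrite integral_cst// mul1e [LHS]probability_setT.
Qed.

Let intpr (u : S -> \bar R) E : measurable_fun setT u -> (forall x, 0 <= u x) ->
  measurable E ->
  \int[nu]_x (u x * pr E x) = \int[P]_w \int[nu]_x (u x * (\1_E (a (w, x)))%:E).
Proof.
move=> mu u0 mE.
have mF : measurable_fun setT (fun z : Om * S => u z.2 * (\1_E (a z))%:E).
  by apply: emeasurable_funM; [exact: measurableT_comp mu measurable_snd|exact: maE].
have F0 (z : Om * S) : 0 <= u z.2 * (\1_E (a z))%:E by rewrite mule_ge0// lee_fin.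
have := @fubini_tonelli _ _ _ _ _ P nu _ mF F0.
move=> /= ->; apply: eq_integral => x _; rewrite /pr ge0_integralZl//.
  by move: (measurableT_comp (maE mE) (pair2_measurable x)).
Qed.

(* Write p x for the probability that a(w,x) is in E = {f > c}. Stationarity of
   nu and of f.nu gives
     int_(~E) p f = int_E (1-p) f   and   int_(~E) p = int_E (1-p),
   while f <= c off E and f > c on E; so p must be the indicator of E. *)
Lemma level_set_invariant (c : R) : (0 <= c)%R ->
  let E := [set x | (c < f x)%R] in
  {ae P, forall w, nu ([set x | E (a (w, x))] `+` E) = 0}.
Proof.
move=> c0 E.
have mE : measurable E.
  rewrite (_ : E = f @^-1` `]c, +oo[%classic); first exact: measurable_pre.
  by apply/seteqP; split => x /=; rewrite in_itv /= andbT.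
have mC := measurableC mE.
pose e x : \bar R := (\1_E x)%:E; pose e' x : \bar R := (\1_(~` E) x)%:E.
have me : measurable_fun setT e by exact: measurable_EFin_indic.
have me' : measurable_fun setT e' by exact: measurable_EFin_indic.
have e0 x : 0 <= e x by rewrite lee_fin.
have e'0 x : 0 <= e' x by rewrite lee_fin.
have ee' x : e x + e' x = 1.
  by rewrite /e /e' !indicE in_setC; case: (x \in E); rewrite /= ?adde0 ?add0e.
(* Balance of flow: for a stationary density [u], the mass entering [E] from outside equals the mass
   leaving [E]. It is applied to [u = 1] and to [u = f]. *)
have bal (u : S -> \bar R) : measurable_fun setT u -> (forall x, 0 <= u x) ->
    \int[nu]_x u x < +oo ->
    \int[P]_w \int[nu]_x (u x * (\1_E (a (w, x)))%:E) = \int[nu]_x (u x * e x) ->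
    \int[nu]_x (u x * pr E x * e' x) = \int[nu]_x (u x * pr (~` E) x * e x) /\
    \int[nu]_x (u x * pr (~` E) x * e x) \is a fin_num.
  move=> mu u0 uoo ust.
  have m1 F : measurable F -> measurable_fun setT (fun x => u x * pr F x).
    by move=> mF; apply: emeasurable_funM => //; exact: mpr.
  have p0 F x : 0 <= u x * pr F x by rewrite mule_ge0.
  have h1 : \int[nu]_x (u x * e x) = \int[nu]_x (u x * pr E x * e x) +
      \int[nu]_x (u x * pr (~` E) x * e x).
    rewrite -ge0_integralD//; last 4 first.
    - by move=> x _; rewrite mule_ge0.
    - by apply: emeasurable_funM => //; exact: m1.
    - by move=> x _; rewrite mule_ge0.
    - by apply: emeasurable_funM => //; exact: m1.
    apply: eq_integral => x _.
    by rewrite -ge0_muleDl// -ge0_muleDr// prD// mule1.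
  have h2 : \int[nu]_x (u x * pr E x) = \int[nu]_x (u x * pr E x * e x) +
      \int[nu]_x (u x * pr E x * e' x).
    rewrite -ge0_integralD//; last 4 first.
    - by move=> x _; rewrite mule_ge0.
    - by apply: emeasurable_funM => //; exact: m1.
    - by move=> x _; rewrite mule_ge0.
    - by apply: emeasurable_funM => //; exact: m1.
    by apply: eq_integral => x _; rewrite -ge0_muleDr// ee' mule1.
  have ue : \int[nu]_x (u x * e x) < +oo.
    apply: le_lt_trans uoo; apply: ge0_le_integral => //.
    - by move=> x _; rewrite mule_ge0.
    - by apply: emeasurable_funM.
    - move=> x _; rewrite /e indicE; case: (x \in E); rewrite /= ?mule1//.
      by rewrite mule0.
  have A0 : 0 <= \int[nu]_x (u x * pr E x * e x).
    by apply: integral_ge0 => x _; rewrite mule_ge0.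
  have B0 : 0 <= \int[nu]_x (u x * pr (~` E) x * e x).
    by apply: integral_ge0 => x _; rewrite mule_ge0.
  have h3 := intpr mu u0 mE; rewrite ust h1 h2 in h3; rewrite h1 in ue.
  exact: ge0_addeI_fin A0 B0 ue h3.
have nuoo : \int[nu]_x (cst 1 x : \bar R) < +oo.
  by rewrite integral_cst// mul1e [X in X < _]probability_setT ltry.
have := bal (cst 1) (measurable_cst _) (fun=> lee01) nuoo.
case.  
  rewrite [RHS](_ : _ = nu E); last first.
    by rewrite -(integral_setT_indic nu mE); apply: eq_integral => x _; rewrite mul1e.
  rewrite -stat1//; apply: eq_integral => w _.
  rewrite -integral_setT_indic; first by apply: eq_integral => x _; rewrite mul1e.
  by have := measurable_pre (measurableT_comp ma (pair1_measurable w)) mE.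
move=> a12 afin.
have [b12 bfin] := bal (fun x => (f x)%:E) mfE (fun x => f0 x : 0 <= (f x)%:E) foo (stat2 mE).
have mq : measurable_fun setT (pr (~` E)) by exact: mpr.
have mp : measurable_fun setT (pr E) by exact: mpr.
pose q x := pr (~` E) x * e x.
have q0 x : 0 <= q x by rewrite mule_ge0.
have mqe : measurable_fun setT q by exact: emeasurable_funM.
pose r x := pr E x * e' x.
have r0 x : 0 <= r x by rewrite mule_ge0.
have mr : measurable_fun setT r by exact: emeasurable_funM.
have a12' : \int[nu]_x r x = \int[nu]_x q x.
  by move: a12; under eq_integral do rewrite mul1e; under [RHS]eq_integral do rewrite mul1e.
have afin' : \int[nu]_x q x \is a fin_num.
  by move: afin; under eq_integral do rewrite mul1e.
have b12' : \int[nu]_x ((f x)%:E * r x) = \int[nu]_x ((f x)%:E * q x).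
  move: b12; under eq_integral do rewrite -muleA.
  by under [RHS]eq_integral do rewrite -muleA.
have aeq0 : \int[nu]_x q x = 0.
  apply: (level_weights (f := f) (c := c) (r := r)) => //.
  - by move=> x; rewrite /r /e' indicE; have [|_] := boolP (x \in ~` E);
      [rewrite inE /E /= => /negP; rewrite -leNgt; left|rewrite mule0; right].
  - by move=> x; rewrite /q /e indicE; have [|_] := boolP (x \in E);
      [rewrite inE; left|rewrite mule0; right].
have mD (F F' : set S) : measurable F -> measurable F' ->
    measurable_fun setT (fun z : Om * S => (\1_F z.2)%:E * (\1_F' (a z))%:E : \bar R).
  move=> mF mF'; apply: emeasurable_funM; last exact: maE.
  exact: measurableT_comp (measurable_EFin_indic mF) measurable_snd.
have mDx F F' (mF : measurable F) (mF' : measurable F') w :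
    measurable_fun setT (fun x => (\1_F x)%:E * (\1_F' (a (w, x)))%:E : \bar R).
  exact: measurableT_comp (mD _ _ mF mF') (pair1_measurable w).
have nn (F F' : set S) z : 0 <= (\1_F z.2)%:E * (\1_F' (a z))%:E :> \bar R.
  by rewrite mule_ge0 ?lee_fin.
pose I1 w := \int[nu]_x (e' x * (\1_E (a (w, x)))%:E).
pose I2 w := \int[nu]_x (e x * (\1_(~` E) (a (w, x)))%:E).
have mI1 : measurable_fun setT I1.
  exact: (measurable_integral_fst nu (mD _ _ mC mE) (nn _ _)).
have mI2 : measurable_fun setT I2.
  exact: (measurable_integral_fst nu (mD _ _ mE mC) (nn _ _)).
have I10 w : 0 <= I1 w by apply: integral_ge0 => x _; exact: (nn _ _ (w, x)).
have I20 w : 0 <= I2 w by apply: integral_ge0 => x _; exact: (nn _ _ (w, x)).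
have i1 : \int[P]_w I1 w = 0.
  rewrite -(intpr me' e'0 mE) -[RHS]aeq0 -a12'.
  by apply: eq_integral => x _; rewrite muleC.
have i2 : \int[P]_w I2 w = 0.
  rewrite -(intpr me e0 mC) -[RHS]aeq0.
  by apply: eq_integral => x _; rewrite muleC.
have i12 : \int[P]_w (I1 w + I2 w) = 0 by rewrite ge0_integralTD// i1 i2 adde0.
have I120 w : 0 <= I1 w + I2 w by rewrite adde_ge0.
apply: filterS (ge0_integral_eq0_ae (emeasurable_funD mI1 mI2) I120 i12) => w <-.
have mDw : measurable ([set x | E (a (w, x))] `+` E).
  apply: measurableU; apply: measurableD => //;
  exact: (measurable_pre (measurableT_comp ma (pair1_measurable w)) mE).
rewrite -(integral_setT_indic nu mDw) /I1 /I2.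
rewrite -(ge0_integralTD nu (mDx _ _ mC mE w) (mDx _ _ mE mC w)
  (fun x => nn _ _ (w, x)) (fun x => nn _ _ (w, x))).
apply: eq_integral => x _; rewrite !indicE !in_setC.
have -> : (x \in [set x | E (a (w, x))] `+` E) = ((a (w, x) \in E) != (x \in E)).
  rewrite in_setU !in_setD.
  have -> : (x \in [set x | E (a (w, x))]) = (a (w, x) \in E).
    by apply/idP/idP; rewrite !inE.
  by case: (x \in E); case: (a (w, x) \in E).
by case: (x \in E); case: (a (w, x) \in E); rewrite /= ?mule0 ?mule1 ?adde0 ?add0e.
Qed.

End stationary_densities.

Section ergodic_density.
Local Open Scope ereal_scope.
Context (R : realType) d (Om : measurableType d) d' (S : measurableType d').
Variables (P : probability Om R) (nu : probability S R) (a : Om * S -> S).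
Hypothesis ma : measurable_fun setT a.
Hypothesis stat1 : forall E, measurable E ->
  \int[P]_w nu [set x | E (a (w, x))] = nu E.
Hypothesis erg : forall E, measurable E ->
  {ae P, forall w, nu ([set x | E (a (w, x))] `+` E) = 0} -> nu E = 0 \/ nu E = 1.

(** The set where [f] exceeds its mean is invariant, hence null or conull. The positive and negative
    parts of [f] minus its mean have equal integrals, and one of them vanishes almost everywhere, so
    both do. *)
Lemma ergodic_density_const (f : S -> R) :
  measurable_fun setT f -> (forall x, (0 <= f x)%R) -> \int[nu]_x (f x)%:E < +oo ->
  (forall E, measurable E ->
    \int[P]_w \int[nu]_x ((f x)%:E * (\1_E (a (w, x)))%:E) =
    \int[nu]_x ((f x)%:E * (\1_E x)%:E)) ->
  {ae nu, forall x, (f x)%:E = \int[nu]_x (f x)%:E}.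
Proof.
move=> mf f0 foo stat2.
have ifin : \int[nu]_x (f x)%:E \is a fin_num.
  by rewrite ge0_fin_numE// integral_ge0// => x _; rewrite lee_fin.
set c : R := fine (\int[nu]_x (f x)%:E).
have cE : \int[nu]_x (f x)%:E = c%:E by rewrite fineK.
have c0 : (0 <= c)%R by rewrite fine_ge0// integral_ge0// => x _; rewrite lee_fin.
clearbody c; rewrite cE.
pose g x : \bar R := (Num.max 0 (f x - c))%:E.
pose h x : \bar R := (Num.max 0 (c - f x))%:E.
have mg : measurable_fun setT g.
  by apply/measurable_EFinP; apply: measurable_maxr => //; exact: measurable_funB.
have mh : measurable_fun setT h.
  by apply/measurable_EFinP; apply: measurable_maxr => //; exact: measurable_funB.
have g0 x : 0 <= g x by rewrite lee_fin le_max lexx.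
have h0 x : 0 <= h x by rewrite lee_fin le_max lexx.
have mfE : measurable_fun setT (fun x => (f x)%:E) by exact/measurable_EFinP.
have fhcg : \int[nu]_x (f x)%:E + \int[nu]_x h x = c%:E + \int[nu]_x g x.
  have -> : c%:E = \int[nu]_x (cst c%:E x).
    by rewrite integral_cst// [X in _ * X]probability_setT mule1.
  rewrite -!ge0_integralTD//; apply: eq_integral => x _; rewrite /g /h -!EFinD.
  congr EFin; have [fc|/ltW cf] := leP (f x) c.
    have -> : Num.max 0%R (f x - c)%R = 0%R by apply: max_l; rewrite subr_le0.
    by rewrite max_r ?subr_ge0//; ring.
  have -> : Num.max 0%R (c - f x)%R = 0%R by apply: max_l; rewrite subr_le0.
  by rewrite max_r ?subr_ge0//; ring.
have hg : \int[nu]_x h x = \int[nu]_x g x.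
  move: fhcg; rewrite cE; move: (integral _ _ h) (integral _ _ g).
  by move=> [u| |] [v| |] //= [] /addrI ->.
have gh0 : {ae nu, forall x, g x = 0} -> {ae nu, forall x, (f x)%:E = c%:E}.
  move=> gae; have ig : \int[nu]_x g x = 0.
    rewrite (ge0_ae_eq_integral (g := cst 0))//; first by rewrite integral0.
    by apply: filterS gae => x gx _.
  have hae := ge0_integral_eq0_ae mh h0 (etrans hg ig).
  apply: filterS2 gae hae => x /eqP; rewrite eqe => /eqP /max_idPl fc /eqP.
  rewrite eqe => /eqP /max_idPl cf; congr EFin; apply/eqP.
  by rewrite eq_le -subr_le0 fc -subr_le0 cf.
have hh0 : {ae nu, forall x, h x = 0} -> {ae nu, forall x, (f x)%:E = c%:E}.
  move=> hae; have ih : \int[nu]_x h x = 0.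
    rewrite (ge0_ae_eq_integral (g := cst 0))//; first by rewrite integral0.
    by apply: filterS hae => x hx _.
  by apply: gh0; apply: ge0_integral_eq0_ae => //; rewrite -hg.
have mE : measurable [set x | (c < f x)%R].
  rewrite (_ : [set _ | _] = f @^-1` `]c, +oo[%classic); first exact: measurable_pre.
  by apply/seteqP; split => x /=; rewrite in_itv /= andbT.
have [E0|E1] := erg mE (level_set_invariant ma mf f0 foo stat1 stat2 c0).
  apply: gh0; exists [set x | (c < f x)%R]; split => // x /= gx.
  by rewrite ltNge; apply/negP => fc; apply: gx; rewrite /g (max_idPl _)// subr_le0.
apply: hh0; exists (~` [set x | (c < f x)%R]); split; [exact: measurableC|exact: prob1_setC|].
move=> x /= hx cf; apply: hx.
by rewrite /h (max_idPl _)// subr_le0 ltW.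
Qed.

(** Stationarity of [nu'] is the averaging property of its density with respect to [nu], and such a
    density is constant by ergodicity. *)
Lemma stationary_unique (nu' : {finite_measure set S -> \bar R}) :
  (forall E, measurable E -> nu E = 0 -> nu' E = 0) ->
  (forall E, measurable E -> \int[P]_w nu' [set x | E (a (w, x))] = nu' E) ->
  forall E, measurable E -> nu' E = nu' setT * nu E.
Proof.
move=> ac stat2.
have [|f [mf f0 fE]] := @RN_rlaw _ _ _ _ _ nu' nu setT id measurableT (@measurable_id _ _ _).
  by move=> D mD D0; rewrite setTI; exact: ac.
have fE' D : measurable D -> nu' D = \int[nu]_x ((f x)%:E * (\1_D x)%:E).
  by move=> mD; rewrite -fE// setTI.
have fT : nu' setT = \int[nu]_x (f x)%:E.
  by rewrite fE'//; apply: eq_integral => x _; rewrite indicT mule1.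
have foo : \int[nu]_x (f x)%:E < +oo by rewrite -fT ltey_eq fin_num_measure.
move=> E mE; rewrite fE'// fT.
have fc : {ae nu, forall x, (f x)%:E = \int[nu]_x (f x)%:E}.
  apply: ergodic_density_const => // D mD; rewrite -fE'// -stat2//.
  apply: eq_integral => w _; rewrite fE'//.
  exact: (measurable_pre (measurableT_comp ma (pair1_measurable w)) mD).
have mfE : measurable_fun setT (fun x => (f x)%:E) by exact/measurable_EFinP.
set c := (X in _ = X * _) in fc *.
have c0 : 0 <= c by apply: integral_ge0 => x _; rewrite lee_fin.
rewrite -(integral_setT_indic nu mE) -ge0_integralTZl//.
apply: ge0_ae_eq_integral => //.
- by apply: (ge0_measurable_mul_indic (q := id)).
- by apply: measurable_funeM; exact: measurable_EFin_indic.
- by move=> x _; rewrite mule_ge0// lee_fin.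
- by move=> x _; rewrite mule_ge0// lee_fin.
- by apply: filterS fc => x -> _.
- exact: measurable_EFin_indic.
Qed.

End ergodic_density.

(** * Almost invariant sets, and stationarity under each factor *)

Section almost_invariant_sets.
Local Open Scope ereal_scope.
Context (R : realType).

Lemma null_subset d (T : measurableType d) (m : {measure set T -> \bar R}) (A B : set T) :
  measurable A -> measurable B -> A `<=` B -> m B = 0 -> m A = 0.
Proof.
move=> mA mB AB B0; apply/eqP; rewrite eq_le measure_ge0 andbT -B0.
by apply: le_measure; rewrite ?inE.
Qed.

Lemma measurable_setY d (T : measurableType d) (A B : set T) :
  measurable A -> measurable B -> measurable (A `+` B).
Proof. by move=> mA mB; apply: measurableU; apply: measurableD. Qed.

Lemma setY_null_trans d (T : measurableType d) (m : {measure set T -> \bar R})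
    (A B C : set T) :
  measurable A -> measurable B -> measurable C ->
  m (A `+` B) = 0 -> m (B `+` C) = 0 -> m (A `+` C) = 0.
Proof.
move=> mA mB mC AB BC.
apply: (@null_subset _ _ m _ ((A `+` B) `|` (B `+` C))).
- exact: measurable_setY.
- by apply: measurableU; exact: measurable_setY.
- move=> x; have [Bx|nBx] := pselect (B x).
    by move=> [[Ax nCx]|[Cx nAx]]; [right; left|left; right].
  by move=> [[Ax nCx]|[Cx nAx]]; [left; left|right; right].
- by apply: null_set_setU => //; exact: measurable_setY.
Qed.

Lemma setY_null_eq d (T : measurableType d) (m : {measure set T -> \bar R})
    (A B : set T) : measurable A -> measurable B -> m (A `+` B) = 0 -> m A = m B.
Proof.
move=> mA mB AB; have mY := measurable_setY mA mB.
have le A' B' : measurable A' -> measurable B' -> A' `\` B' `<=` A `+` B -> m A' <= m B'.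
  move=> mA' mB' sub; rewrite -[leRHS]adde0 -AB.
  apply: le_trans (measureU2 _ mB' mY); apply: le_measure; rewrite ?inE//.
    exact: measurableU.
  move=> x A'x; have [?|nB] := pselect (B' x); first by left.
  by right; apply: sub.
by apply/eqP; rewrite eq_le !le// => x; [right|left].
Qed.

Variables (G : topGroupType) (Y : gspace G) (eta : probability Y R).

Lemma measurable_act_at (g : G) : measurable_fun setT (act g : Y -> Y).
Proof. exact: measurableT_comp (@measurable_act _ Y) (pair1_measurable (g : borel G)). Qed.

Lemma measurable_act_pre (g : G) (E : set Y) : measurable E -> measurable (act g @^-1` E).
Proof. exact: measurable_pre (measurable_act_at g). Qed.

Hypothesis qi : quasi_invariant eta.

Lemma ae_act (g : G) (Q : Y -> Prop) :
  {ae eta, forall y, Q y} -> {ae eta, forall y, Q (act g y)}.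
Proof.
move=> [N [mN N0 QN]]; exists (act g @^-1` N); split.
- exact: measurable_act_pre.
- by apply/qi.
- by move=> y nQ; exact: QN.
Qed.

(** Quasi-invariance lets null symmetric differences be translated and composed. The morphism [T]
    allows both the whole action and its restriction to a factor. *)
Lemma almost_stabilizer_subgroup (T : G -> G) (E : set Y) : measurable E ->
  T 1%g = 1%g -> {morph T : x y / (x * y)%g} ->
  is_subgroup [set g | eta ((act (T g) @^-1` E) `+` E) = 0].
Proof.
move=> mE T1 TM.
have m1 g (F : set Y) : measurable F -> measurable (act g @^-1` F).
  exact: measurable_act_pre.
have TV g : T (g^-1)%g = ((T g)^-1)%g.
  by apply: (mulIg (T g)); rewrite -TM !mulVg.
split => /=.
- rewrite T1 (_ : act 1%g @^-1` E = E) ?setYK ?measure0//.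
  by apply/funext => y /=; rewrite act1.
- move=> x y xE yE; rewrite TM.
  have -> : act (T x * T y)%g @^-1` E = act (T y) @^-1` (act (T x) @^-1` E).
    by apply/funext => z /=; rewrite actM.
  apply: (@setY_null_trans _ _ eta _ (act (T y) @^-1` E)) => //; do ?exact: m1.
    by apply: (m1); exact: m1.
  have := (qi (T y) (measurable_setY (m1 (T x) _ mE) mE)).2 xE.
  by [].
- move=> x xE; rewrite TV.
  have := (qi (T x)^-1%g (measurable_setY (m1 (T x) _ mE) mE)).2 xE.
  rewrite setYC => <-; congr (eta (_ `+` _)).
  by apply/funext => z /=; rewrite -actM mulgV act1.
Qed.

End almost_invariant_sets.

Section product_stationarity.
Local Open Scope ereal_scope.
Context (R : realType) (k : nat) (Gs : 'I_k -> topGroupType) (hG : forall i, lcsc (Gs i)).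
Local Notation G := (prod_group Gs).
Variables (mu : probability (borel G) R) (mus : forall i, probability (borel (Gs i)) R).
Hypothesis hprod : is_product_law
  (fun i (g : borel (prod_group Gs)) => g i : borel (Gs i)) mus mu.
Hypothesis hadm : admissible mu.

Variables (Y : gspace G) (eta : probability Y R).
Hypotheses (qi : quasi_invariant eta) (st : stationary mu eta).

(** The elements almost fixing [E] form a subgroup, and by admissibility a subgroup containing
    [mu]-almost every element is everything. This turns [mu]-almost sure invariance into
    invariance. *)
Lemma invariant_of_ae (T : G -> G) (E : set Y) : measurable E ->
  T 1%g = 1%g -> {morph T : x y / (x * y)%g} ->
  {ae mu, forall g, eta ((act (T g) @^-1` E) `+` E) = 0} ->
  forall g, eta ((act (T g) @^-1` E) `+` E) = 0.
Proof.
move=> mE T1 TM H.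
have := subgroup_ae_full hG hadm (almost_stabilizer_subgroup qi mE T1 TM) H.
by move=> HT g; have : [set: G] g by []; rewrite -HT.
Qed.

Lemma ergodic_zero_one : ergodic eta -> forall E, measurable E ->
  {ae mu, forall g, eta ([set y | E (act (g : G) y)] `+` E) = 0} ->
  eta E = 0 \/ eta E = 1.
Proof.
move=> erg E mE H; apply: erg; split => // g _.
exact: (@invariant_of_ae id).
Qed.

Section factor.
Variables (T U : borel G -> borel G).
Hypotheses (mT : measurable_fun setT T) (mU : measurable_fun setT U).
Hypothesis TU : forall g h, (U h * T g = T g * U h :> G)%g.
Hypothesis mix : forall F : borel G -> \bar R,
  measurable_fun setT F -> (forall g, 0 <= F g) ->
  \int[mu]_g F g = \int[mu]_g \int[mu]_h F (T g * U h : G)%g.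

Let mact : measurable_fun setT (fun z : borel G * Y => act (T z.1 : G) z.2 : Y).
Proof.
apply: (measurableT_comp (@measurable_act _ Y) (g := fun z => (T z.1, z.2))).
apply: measurable_fun_pair => //.
exact: measurableT_comp mT measurable_fst.
Qed.

Let avg := plaw (mu \x eta) mact.

Let meas_eta E : measurable E ->
  measurable_fun setT (fun g : borel G => eta (act (g : G) @^-1` E)).
Proof.
move=> mE.
have := measurable_fun_xsection eta (measurable_pre (@measurable_act _ Y) mE).
congr measurable_fun; apply/funext => g /=; congr (eta _).
by apply/seteqP; split => y /=; rewrite /xsection /= inE.
Qed.

Let avgE E : measurable E -> avg E = \int[mu]_g eta (act (T g : G) @^-1` E).
Proof.
move=> mE; rewrite /avg plawE /= /product_measure1 /=.
apply: eq_integral => g _; congr (eta _).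
by apply/seteqP; split => y /=; rewrite /xsection /= inE.
Qed.

Let mtrans (g : borel G) : measurable_fun setT (fun h : borel G => (g * h : G)%g : borel G).
Proof. exact: (measurableT_comp (measurable_mulg hG) (pair1_measurable g)). Qed.

Let mmul2 (f g : borel G * borel G -> borel G) : measurable_fun setT f ->
  measurable_fun setT g -> measurable_fun setT (fun z => (f z * g z : G)%g : borel G).
Proof.
move=> mf mg; exact: (measurableT_comp (measurable_mulg hG) (measurable_fun_pair mf mg)).
Qed.

Let mT1 : measurable_fun setT (fun z : borel G * borel G => T z.1).
Proof. exact: measurableT_comp mT measurable_fst. Qed.
Let mT2 : measurable_fun setT (fun z : borel G * borel G => T z.2).
Proof. exact: measurableT_comp mT measurable_snd. Qed.

(* Averaging along T gives a mu-stationary measure, since the factors commute. *)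
Let avg_stationary E : measurable E ->
  \int[mu]_h avg [set y | E (act (h : G) y)] = avg E.
Proof.
move=> mE; pose F (g : borel G) := eta (act (g : G) @^-1` E).
have mF : measurable_fun setT F by exact: meas_eta.
have F0 g : 0 <= F g by exact: measure_ge0.
transitivity (\int[mu]_h \int[mu]_g F (h * T g : G)%g).
  apply: eq_integral => h _.
  rewrite [LHS]avgE; last by exact: measurable_act_pre.
  apply: eq_integral => g _; congr (eta _); apply/funext => y /=.
  by rewrite actM.
rewrite [LHS](tonelli_exchange mu mu (f := fun z => F (z.1 * T z.2 : G)%g))//; last first.
  by apply: measurableT_comp mF _; exact: mmul2.
transitivity (\int[mu]_g \int[mu]_u F (T u * g : G)%g); last first.
  rewrite [LHS](tonelli_exchange mu mu (f := fun z => F (T z.2 * z.1 : G)%g))//; last first.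
    by apply: measurableT_comp mF _; exact: mmul2.
  rewrite avgE//; apply: eq_integral => u _ /=.
  rewrite -st; last by exact: measurable_act_pre.
  by apply: eq_integral => h _; congr (eta _); apply/funext => y /=; rewrite actM.
pose H (g : borel G) := \int[mu]_u F (T u * g : G)%g.
have mH : measurable_fun setT H.
  have mF2 : measurable_fun setT (fun z : borel G * borel G => F (T z.2 * z.1 : G)%g).
    by apply: measurableT_comp mF _; exact: mmul2.
  exact: measurable_integral_fst mF2 _.
have H0 g : 0 <= H g by exact: integral_ge0.
(* Both sides become triple integrals of [F] over products of two [T] factors and one [U] factor;
   they agree once [U v] is moved past [T g]. *)
rewrite (mix mH H0); apply: eq_integral => g _.
have -> : \int[mu]_h F (h * T g : G)%g =
    \int[mu]_u \int[mu]_v F (T u * U v * T g : G)%g.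
  apply: (mix (F := fun h => F (h * T g : G)%g)) => //.
  apply: measurableT_comp mF _.
  exact: (measurableT_comp (measurable_mulg hG) (pair2_measurable (T g))).
have mFg : measurable_fun setT (fun z : borel G * borel G => F (T z.1 * U z.2 * T g : G)%g).
  apply: measurableT_comp mF _; apply: mmul2 => //; apply: mmul2 => //.
  exact: measurableT_comp mU measurable_snd.
apply: (etrans (tonelli_exchange mu mu mFg (fun=> F0 _))).
apply: eq_integral => v _; apply: eq_integral => u _ /=.
by rewrite -mulgA TU.
Qed.

(** The average [avg] of [eta] along [T] is stationary, and absolutely continuous by
    quasi-invariance; uniqueness identifies it with [eta]. *)
Lemma factor_stationary : ergodic eta -> forall E, measurable E ->
  \int[mu]_g eta (act (T g : G) @^-1` E) = eta E.
Proof.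
move=> erg E mE; rewrite -(avgE mE).
have H := stationary_unique (@measurable_act _ Y) st (ergodic_zero_one erg) (nu' := avg) _ avg_stationary mE.
rewrite {}H; last first.
  move=> D mD D0; rewrite [LHS]avgE//.
  under eq_integral do rewrite (qi _ mD).2//.
  by rewrite integral0.
by rewrite [X in X * _]probability_setT mul1e.
Qed.

End factor.

Lemma proj_at_stationary j : ergodic eta -> forall E, measurable E ->
  \int[mu]_g eta (act (proj_at j (g : G)) @^-1` E) = eta E.
Proof.
apply: (@factor_stationary (@proj_at _ Gs j) (@proj_off _ Gs j)).
- exact: measurable_proj_at.
- exact: measurable_proj_off.
- by move=> g h; exact: proj_off_at.
- by move=> F; exact: (integral_mix hG hprod).
Qed.

Lemma proj_off_stationary j : ergodic eta -> forall E, measurable E ->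
  \int[mu]_g eta (act (proj_off j (g : G)) @^-1` E) = eta E.
Proof.
apply: (@factor_stationary (@proj_off _ Gs j) (@proj_at _ Gs j)).
- exact: measurable_proj_off.
- exact: measurable_proj_at.
- by move=> g h; rewrite proj_off_at.
- move=> F mF F0; rewrite (integral_mix hG hprod j mF F0).
  have mFg : measurable_fun setT (fun z : borel G * borel G => F (proj_at j z.1 * proj_off j z.2 : G)%g).
    apply: measurableT_comp mF _; exact: (measurableT_comp (measurable_mulg hG)
      (measurable_fun_pair (measurableT_comp (measurable_proj_at hG j) measurable_fst)
      (measurableT_comp (measurable_proj_off hG j) measurable_snd))).
  apply: (etrans (tonelli_exchange mu mu mFg (fun=> F0 _))).
  by apply: eq_integral => g _; apply: eq_integral => h _; rewrite /= proj_off_at.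
Qed.

End product_stationarity.

(** * Densities that factor through the invariant components *)

Section cofactor_stationary_density.
Local Open Scope ereal_scope.
Context (R : realType).

(** A nonnegative number is recovered from knowing which of the levels [q n] lie strictly below it;
    this rebuilds a function from its superlevel sets. *)
Lemma ereal_sup_levels (q : nat -> R) (f : R) : (0 <= f)%R ->
  (forall s : R, (0 <= s < f)%R -> exists n, (s < q n < f)%R) ->
  ereal_sup (range (fun n => if (q n < f)%R then (Num.max 0 (q n))%:E else 0)) = f%:E.
Proof.
move=> f0 hq; set S := range _.
have ub : ereal_sup S <= f%:E.
  apply: ge_ereal_sup => _ [n _ <-]; case: ifP => // qf; rewrite lee_fin.
  by rewrite ge_max f0 ltW.
have S0 : 0 <= ereal_sup S.
  apply: le_trans (_ : (if (q 0%N < f)%R then (Num.max 0 (q 0%N))%:E else 0) <= _).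
    by case: ifP => // _; rewrite lee_fin le_max lexx.
  by apply: ereal_sup_ubound; exists 0%N.
apply/eqP; rewrite eq_le ub /= leNgt; apply/negP => Sf.
have Sfin : ereal_sup S \is a fin_num.
  by rewrite ge0_fin_numE// (lt_trans Sf)// ltry.
have [|n /andP[sq qf]] := hq (fine (ereal_sup S)).
  by rewrite fine_ge0//= -lte_fin fineK.
have : (q n)%:E <= ereal_sup S.
  apply: le_trans (_ : (Num.max 0 (q n))%:E <= _); first by rewrite lee_fin le_max lexx orbT.
  by apply: ereal_sup_ubound; exists n => //; rewrite qf.
by rewrite leNgt => /negP; apply; rewrite -[ltLHS]fineK.
Qed.

Context (k : nat) (Gs : 'I_k -> topGroupType) (hG : forall i, lcsc (Gs i)).
Local Notation G := (prod_group Gs).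
Variables (mu : probability (borel G) R) (mus : forall i, probability (borel (Gs i)) R).
Hypothesis hprod : is_product_law
  (fun i (g : borel (prod_group Gs)) => g i : borel (Gs i)) mus mu.
Hypothesis hadm : admissible mu.
Variables (Y : gspace G) (eta : probability Y R).
Hypotheses (qi : quasi_invariant eta) (st : stationary mu eta) (erg : ergodic eta).
Variables (j : 'I_k) (Yj : gspace (Gs j)) (etaj : probability Yj R) (p : Y -> Yj).
Hypothesis hp : ergodic_components (cofactor_subgroup j) eta etaj p.

Let act_off (z : borel G * Y) : Y := act (proj_off j (z.1 : G)) z.2.

Let mact_off : measurable_fun setT act_off.
Proof.
exact: (measurableT_comp (@measurable_act _ Y) (measurable_fun_pair
  (measurableT_comp (measurable_proj_off hG j) measurable_fst) measurable_snd)).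
Qed.

(** The density of [eta'] has cofactor-invariant superlevel sets. Each of them is, up to a null set,
    pulled back from the component [Yj], and so is the density, as a supremum over countably many
    levels. *)
Lemma cofactor_stationary_density (eta' : {finite_measure set Y -> \bar R}) :
  (forall E, measurable E -> eta E = 0 -> eta' E = 0) ->
  (forall E, measurable E ->
    \int[mu]_g eta' (act (proj_off j (g : G)) @^-1` E) = eta' E) ->
  exists r : Yj -> R, [/\ measurable_fun setT r, (forall y, (0 <= r y)%R) &
    forall E, measurable E ->
      eta' E = \int[eta]_y ((r (p y))%:E * (\1_E y)%:E)].
Proof.
move=> ac stat; have [_ mp pE _ pinv] := hp.
have [|f [mf f0 fE]] := @RN_rlaw _ _ _ _ _ eta' eta setT id measurableT (@measurable_id _ _ _).
  by move=> D mD D0; rewrite setTI; exact: ac.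
have {}fE D : measurable D -> eta' D = \int[eta]_x ((f x)%:E * (\1_D x)%:E).
  by move=> mD; rewrite -fE// setTI.
have foo : \int[eta]_x (f x)%:E < +oo.
  apply: le_lt_trans (_ : eta' setT < +oo); last by rewrite ltey_eq fin_num_measure.
  by rewrite fE//; under [leRHS]eq_integral do rewrite indicT mule1.
(* An enumeration of the nonnegative rationals: absolute values are taken because
   [level_set_invariant] concerns nonnegative levels. *)
pose q n : R := `|ratr (odflt 0%R (choice.unpickle n : option rat))|%R.
have q0 n : (0 <= q n)%R by exact: normr_ge0.
have mE n : measurable [set x | (q n < f x)%R].
  rewrite (_ : [set _ | _] = f @^-1` `]q n, +oo[%classic); first exact: measurable_pre.
  by apply/seteqP; split => x /=; rewrite in_itv /= andbT.
have /choice[F FP] : forall n, exists F : set Yj, measurable F /\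
    eta ([set x | (q n < f x)%R] `+` (p @^-1` F)) = 0.
  move=> n.
  suff : invariant_set (cofactor_subgroup j) eta [set x | (q n < f x)%R].
    by move=> /pinv[F mF F0]; exists F.
  split => // g gj; rewrite -(proj_off_cofactor gj).
  apply: (invariant_of_ae hG hadm qi (T := proj_off j) (mE n)).
  - exact: proj_off1.
  - by move=> x y; exact: proj_offM.
  apply: (level_set_invariant mact_off mf f0 foo _ _ (q0 n)).
    by move=> E mE'; exact: (proj_off_stationary hG hprod hadm qi st j erg mE').
  move=> E mE'; rewrite -fE// -stat//; apply: eq_integral => g' _; rewrite fE//.
  exact: measurable_act_pre.
have mF n : measurable (F n) by have [] := FP n.
have F0 n : eta ([set x | (q n < f x)%R] `+` (p @^-1` F n)) = 0 by have [] := FP n.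
(* The density rebuilt on [Yj]: the largest level whose set [F n] contains the point. *)
pose r w := ereal_sup (range (fun n => (q n * \1_(F n) w)%:E)).
have mr : measurable_fun setT r.
  have -> : r = fun w => esups (fun n => (q n * \1_(F n) w)%:E) 0%N.
    apply/funext => w; rewrite /r /esups; congr ereal_sup.
    by apply/seteqP; split => [_ [n _ <-]|_ [n _ <-]]; exists n.
  apply: measurable_fun_esups => n; apply/measurable_EFinP.
  by apply: measurable_funM => //; exact: measurable_indic.
have rf : {ae eta, forall y, r (p y) = (f y)%:E}.
  have : {ae eta, forall y, forall n, (q n < f y)%R <-> F n (p y)}.
    apply: ae_all_nat => n; exists ([set x | (q n < f x)%R] `+` (p @^-1` F n)); split.
    - by apply: measurable_setY => //; exact: measurable_pre.
    - exact: F0.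
    move=> y /= nE; have [qf|qf] := pselect (q n < f y)%R.
      by left; split => // Fy; apply: nE.
    by right; split => //; apply: contrapT => nF; apply: nE; split.
  apply: filterS => y Hy; rewrite -(@ereal_sup_levels q (f y) (f0 y)); last first.
    move=> s /andP[s0 /rat_in_itvoo[x]]; rewrite in_itv /= => /andP[sx xf].
    exists (choice.pickle x); rewrite /q choice.pickleK /= ger0_norm ?sx//.
    exact: le_trans (ltW sx).
  have E n : (q n * \1_(F n) (p y))%:E =
      if (q n < f y)%R then (Num.max 0%R (q n))%:E else 0.
    case: ifPn => [/Hy Fn|nqf]; first by rewrite indicE mem_set// mulr1 max_r.
    by rewrite indicE memNset ?mulr0// => /Hy; exact/negP.
  by rewrite /r; congr ereal_sup; apply/seteqP; split => _ [n _ <-]; exists n.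
exists (fine \o r); split.
- exact: measurableT_comp.
- move=> y; apply: fine_ge0; apply: le_trans (_ : (q 0%N * \1_(F 0%N) y)%:E <= _).
    by rewrite lee_fin mulr_ge0.
  by apply: ereal_sup_ubound; exists 0%N.
move=> E mE'; rewrite fE//.
have rp0 y : (0 <= fine (r (p y)))%R.
  apply: fine_ge0; apply: le_trans (_ : (q 0%N * \1_(F 0%N) (p y))%:E <= _).
    by rewrite lee_fin mulr_ge0.
  by apply: ereal_sup_ubound; exists 0%N.
apply: ge0_ae_eq_integral => //.
- by apply: (ge0_measurable_mul_indic (q := id)) => //; exact/measurable_EFinP.
- apply: (ge0_measurable_mul_indic (q := id)) => //; apply/measurable_EFinP.
  by apply: measurableT_comp mp; exact: measurableT_comp.
- by move=> x _; apply: mule_ge0; rewrite lee_fin /=.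
- by move=> x _; apply: mule_ge0; rewrite lee_fin /=.
- by apply: filterS rf => y ry _; rewrite /= ry.
Qed.
End cofactor_stationary_density.

Section ae_sets.
Local Open Scope ereal_scope.
Context (R : realType) d (T : measurableType d) (m : {measure set T -> \bar R}).

Lemma setY_null_ae (A B : set T) : measurable A -> measurable B ->
  m (A `+` B) = 0 -> {ae m, forall x, A x <-> B x}.
Proof.
move=> mA mB AB; exists (A `+` B); split => //; first exact: measurable_setY.
move=> x nAB; have [Ax|nAx] := pselect (A x).
  by left; split => // Bx; apply: nAB.
by right; split => //; apply: contrapT => nBx; apply: nAB.
Qed.

Lemma ae_setY_null (A B : set T) : measurable A -> measurable B ->
  {ae m, forall x, A x <-> B x} -> m (A `+` B) = 0.
Proof.
move=> mA mB [N [mN N0 sN]]; apply: null_subset N0 => //; first exact: measurable_setY.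
by move=> x [[Ax nB]|[Bx nA]]; apply: sN => /= -[ab ba]; [apply: nB; exact: ab|apply: nA; exact: ba].
Qed.

Lemma ae_measure_eq (A B : set T) : measurable A -> measurable B ->
  {ae m, forall x, A x <-> B x} -> m A = m B.
Proof. by move=> mA mB AB; apply: setY_null_eq => //; exact: ae_setY_null. Qed.

Lemma measurable_prodm (I : Type) (e : I -> measure_display)
    (V : forall i, measurableType (e i)) (f : T -> prodm V) :
  (forall i, measurable_fun setT (fun t => f t i)) -> measurable_fun setT f.
Proof.
move=> mf; apply: (@measurability _ _ _ (prodm V) _ _ (cylinders V)) => //.
by move=> _ [_ [i [B [mB ->]]] <-]; rewrite setTI; exact: measurable_pre (mf i) mB.
Qed.

Lemma measurable_prodm_coord (I : Type) (e : I -> measure_display)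
    (V : forall i, measurableType (e i)) i :
  measurable_fun setT (fun y : prodm V => y i).
Proof. by move=> _ C mC; rewrite setTI; apply: sub_sigma_algebra; exists i, C. Qed.

End ae_sets.

Section action_density.
Local Open Scope ereal_scope.
Context (R : realType) (k : nat) (Gs : 'I_k -> topGroupType) (hG : forall i, lcsc (Gs i)).
Local Notation G := (prod_group Gs).
Variables (mu : probability (borel G) R) (mus : forall i, probability (borel (Gs i)) R).
Hypothesis hprod : is_product_law
  (fun i (g : borel (prod_group Gs)) => g i : borel (Gs i)) mus mu.
Hypothesis hadm : admissible mu.
Variables (Y : gspace G) (eta : probability Y R).
Hypotheses (qi : quasi_invariant eta) (st : stationary mu eta) (erg : ergodic eta).
Variables (Ys : forall j, gspace (Gs j)) (etas : forall j, probability (Ys j) R)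
  (p : forall j, Y -> Ys j).
Hypothesis hp : forall j, invariant_component eta (etas j) (p j).

Let mp j : measurable_fun setT (p j). Proof. by have [[]] := hp j. Qed.

Definition components (y : Y) : gspace_pi Ys := fun j => p j y.

Lemma measurable_components : measurable_fun setT components.
Proof. exact: measurable_prodm. Qed.

Lemma components_act g : {ae eta, forall y, components (act g y) = act g (components y)}.
Proof.
have : {ae eta, forall y j, p j (act g y) = act (g j) (p j y)}.
  by apply: filter_forall => j; have [_ _] := hp j.
by apply: filterS => y H; apply: functional_extensionality_dep => j; exact: H.
Qed.

(** The integral identity says that the image of [eta] under [g] has a density with respect to [eta]
    which factors through the components. *)
Definition has_density (g : G) := exists r : gspace_pi Ys -> R,
  [/\ measurable_fun setT r, (forall y, (0 <= r y)%R) &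
    forall F : Y -> \bar R, measurable_fun setT F -> (forall y, 0 <= F y) ->
      \int[eta]_y F (act g y) = \int[eta]_y ((r (components y))%:E * F y)].

Let mrc (r : gspace_pi Ys -> R) : measurable_fun setT r ->
  measurable_fun setT (fun y => (r (components y))%:E).
Proof. by move=> mr; apply/measurable_EFinP; exact: measurableT_comp mr measurable_components. Qed.

Let has_density1 : has_density 1%g.
Proof.
exists (cst 1%R); split => // F mF F0; apply: eq_integral => y _.
by rewrite mul1e act1.
Qed.

(** The translate of [eta] by an element of $G_j$ is still stationary under the cofactor, which
    commutes with it; its density is thus a function of the component [j]. *)
Let has_density_at j g : has_density (proj_at j g).
Proof.
pose eta' := plaw eta (@measurable_act_at _ Y (proj_at j g)).
have [hj _ _] := hp j.
have [||r [mr r0 H]] := @cofactor_stationary_density _ _ _ hG _ _ hprod hadm _ _ qi st erg _ _ _ _ hj eta'.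
- by move=> E mE E0; exact: (qi _ mE).2.
- move=> E mE; rewrite -[RHS](proj_off_stationary hG hprod hadm qi st j erg); last first.
    exact: measurable_act_pre.
  apply: eq_integral => h _; apply: (congr1 (fun D : set Y => eta D)).
  by apply/funext => y /=; rewrite -!actM proj_off_at.
exists (fun w => r (w j)); split => //.
  exact: (measurableT_comp mr (@measurable_prodm_coord _ _ Ys j)).
move=> F mF F0.
have mr' : measurable_fun setT (fun y => (r (p j y))%:E).
  by apply/measurable_EFinP; exact: (measurableT_comp mr (@mp j)).
transitivity (\int[eta]_y (1 * F (act (proj_at j g) y))).
  by apply: eq_integral => y _; rewrite mul1e.
apply: (@density_integral _ _ _ _ _ _ _ eta eta (act (proj_at j g)) id (cst 1) _) => //.
- exact: measurable_act_at.
- by move=> y; rewrite lee_fin.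
move=> D mD; rewrite -H// -[RHS]/(eta (act (proj_at j g) @^-1` D)).
rewrite -(integral_indic_pre eta (@measurable_act_at _ Y (proj_at j g)) mD).
by apply: eq_integral => y _; rewrite mul1e.
Qed.

(** Cocycle identity: the density for [g * h] at [y] is that for [g] at [y] times that for [h] at
    $g^{-1}y$. The components are equivariant, so the product is again a function of them. *)
Let has_densityM g h : has_density g -> has_density h -> has_density (g * h)%g.
Proof.
move=> [r [mr r0 H]] [s [ms s0 K]].
have ma : measurable_fun setT (act g^-1%g : gspace_pi Ys -> gspace_pi Ys).
  exact: measurable_act_at.
exists (fun w => r w * s (act g^-1%g w))%R; split.
- by apply: measurable_funM => //; exact: measurableT_comp ms ma.
- by move=> w; exact: mulr_ge0.
move=> F mF F0.
have mFg : measurable_fun setT (fun y => F (act g y)).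
  exact: measurableT_comp mF (measurable_act_at _).
have ms' : measurable_fun setT (fun y => (s (act g^-1%g (components y)))%:E).
  exact: (@mrc (fun w => s (act g^-1%g w)) (measurableT_comp ms ma)).
pose u y := (s (act g^-1%g (components y)))%:E * F y.
have mu' : measurable_fun setT u by exact: emeasurable_funM.
have u0 y : 0 <= u y by rewrite mule_ge0// lee_fin.
transitivity (\int[eta]_y F (act g (act h y))).
  by apply: eq_integral => y _; rewrite actM.
rewrite (K _ mFg (fun y => F0 _)).
transitivity (\int[eta]_y u (act g y)); last first.
  rewrite (H _ mu' u0); apply: eq_integral => y _.
  by rewrite /u muleA -EFinM.
apply: ge0_ae_eq_integral => //.
- by apply: emeasurable_funM => //; exact: mrc.
- exact: measurableT_comp mu' (measurable_act_at _).
- by move=> y _; rewrite mule_ge0// lee_fin.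
- apply: filterS (components_act g) => y Hy _.
  by rewrite /u Hy -actM mulVg act1.
Qed.

Lemma action_density g : has_density g.
Proof.
suff H (s : seq 'I_k) : uniq s -> has_density (fun i => if i \in s then g i else 1%g).
  have := H (enum 'I_k) (enum_uniq _).
  by congr has_density; apply: functional_extensionality_dep => i; rewrite mem_enum.
elim: s => [_|j s IH /= /andP[js us]].
  exact: has_density1.
have := has_densityM (has_density_at j g) (IH us).
congr has_density; apply: functional_extensionality_dep => i.
rewrite -[LHS]/((proj_at j g i * (if i \in s then g i else 1))%g) /proj_at in_cons.
by case: eqP => [->|_]; rewrite /= ?mul1g// (negPf js) mulg1.
Qed.

(** By induction on the coordinates. An event [E'] of components other than [j] is invariant under
    $G_j$, so the law of the component [j] on [E'] is stationary for the action of $G_j$; by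
    uniqueness it is a multiple of [etas j]. *)
Lemma components_independent :
  is_product_law (fun j (y : Y) => p j y) etas eta.
Proof.
move=> s E us mE; elim: s us => [_|j s IH /= /andP[js us]].
  by rewrite big_nil set_nil bigcap_set0 probability_setT.
have mpE i : measurable (p i @^-1` E i) by exact: measurable_pre.
set E' := \bigcap_(i in [set` s]) (p i @^-1` E i) in IH.
have mE' : measurable E' by apply: fin_bigcap_measurable => //; exact: finite_seq.
have [[_ _ pE _ _] qj eqj] := hp j.
have mact : measurable_fun setT (fun z : borel G * Ys j => act ((z.1 : G) j) z.2 : Ys j).
  exact: (measurableT_comp (@measurable_act _ (Ys j)) (measurable_fun_pair
    (measurableT_comp (@measurable_coord _ Gs j) measurable_fst) measurable_snd)).
have pact (g : G) (D : set (Ys j)) : measurable D ->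
    {ae eta, forall y, (act g @^-1` (p j @^-1` D)) y <-> (p j @^-1` (act (g j) @^-1` D)) y}.
  by move=> mD; apply: filterS (eqj g) => y Hy /=; rewrite Hy.
have mpD (D : set (Ys j)) : measurable D -> measurable (p j @^-1` D).
  by move=> mD; exact: measurable_pre.
have macg (g : G) (D : set (Ys j)) : measurable D -> measurable (act (g j) @^-1` D).
  by move=> mD; exact: measurable_act_pre.
have key := @stationary_unique _ _ _ _ _ mu (etas j) _ mact _ _ (rlaw_finite eta mE' (@mp j)).
have {}key D : measurable D -> eta (E' `&` p j @^-1` D) = eta E' * etas j D.
  move=> mD; have := key _ _ _ _ D mD.
  rewrite [X in _ = X * _](_ : _ = eta E'); last first.
    by congr (eta _); rewrite preimage_setT setIT.
  apply.
  - move=> C mC; rewrite -pE// -[RHS]st; last exact: mpD.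
    apply: eq_integral => g _; rewrite -pE; last exact: macg.
    apply/esym/ae_measure_eq; last exact: pact.
      by apply: measurable_act_pre; exact: mpD.
    by apply: mpD; exact: macg.
  - move=> C mC H; rewrite -pE//; apply: (ergodic_zero_one hG hadm qi erg (mpD _ mC)).
    apply: filterS H => g H; apply: (setY_null_trans (B := p j @^-1` (act ((g : G) j) @^-1` C))).
    + by apply: measurable_act_pre; exact: mpD.
    + by apply: mpD; exact: macg.
    + exact: mpD.
    + apply: ae_setY_null; last exact: pact.
        by apply: measurable_act_pre; exact: mpD.
      by apply: mpD; exact: macg.
    + by rewrite -H -pE//; apply: measurable_setY => //; exact: macg.
  - move=> C mC C0; have : eta (p j @^-1` C) = 0 by rewrite pE.
    apply: null_subset; [|exact: mpD|exact: subIsetr].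
    by apply: measurableI => //; exact: mpD.
  - move=> C mC.
    have mEC : measurable (E' `&` p j @^-1` C) by apply: measurableI => //; exact: mpD.
    rewrite -[RHS](proj_at_stationary hG hprod hadm qi st j erg mEC).
    apply: eq_integral => g _.
    rewrite -[LHS]/(eta (E' `&` p j @^-1` (act ((g : G) j) @^-1` C))).
    apply: ae_measure_eq.
    + by apply: measurableI => //; apply: mpD; exact: macg.
    + exact: measurable_act_pre.
    (* An element of $G_j$ lies in the cofactor of every [i] different from [j], so it moves no
       component but the one at [j]. *)
    have inv : {ae eta, forall y i, i != j -> p i (act (proj_at j (g : G)) y) = p i y}.
      apply: filter_forall => i; have [->|ij] := eqVneq i j; first exact: aeW.
      have [[_ _ _ + _] _ _] := hp i.
      move=> /(_ (proj_at j (g : G))) H; have {}H := H _.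
      apply: filterS (H _) => //.
      by rewrite /cofactor_subgroup /= /proj_at (negPf ij).
    apply: filterS2 inv (eqj (proj_at j (g : G))) => y iy jy /=.
    rewrite jy {2}/proj_at eqxx; split => -[Ey Cy]; split => // i /= si.
      by rewrite iy; [exact: Ey|apply: contraNneq js => <-].
    by have := Ey i si; rewrite /= iy//; apply: contraNneq js => <-.
have -> : [set` j :: s] = j |` [set` s].
  apply/seteqP; split => i /=; rewrite in_cons; first by case/orP => [/eqP|]; [left|right].
  by case=> ->; rewrite ?eqxx ?orbT.
rewrite bigcap_setU1 setIC big_cons EFinM -(IH us).
rewrite fineK; last by rewrite fin_num_measure.
by rewrite muleC -key.
Qed.

End action_density.

Section invariant_set_density.
Local Open Scope ereal_scope.
Context (R : realType) (k : nat) (Gs : 'I_k -> topGroupType) (hG : forall i, lcsc (Gs i)).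
Local Notation G := (prod_group Gs).
Variables (mu : probability (borel G) R) (mus : forall i, probability (borel (Gs i)) R).
Hypothesis hprod : is_product_law
  (fun i (g : borel (prod_group Gs)) => g i : borel (Gs i)) mus mu.
Hypothesis hadm : admissible mu.
Variables (X : gspace G) (nu : probability X R).
Hypotheses (qiX : quasi_invariant nu) (stX : stationary mu nu) (ergX : ergodic nu).
Variables (A : gspace G) (alpha : probability A R).
Hypotheses (qiA : quasi_invariant alpha) (stA : stationary mu alpha) (ergA : ergodic alpha).
Variables (rho : A -> X) (hrho : gmap alpha nu rho).
Variables (j : 'I_k) (Xj : gspace (Gs j)) (nuj : probability Xj R) (p : X -> Xj).
Hypothesis hp : ergodic_components (cofactor_subgroup j) nu nuj p.

(** The law of [rho] on [E] is stationary under the cofactor, because [alpha] is and [E] is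
    invariant; hence its density with respect to [nu] is a function on [Xj]. *)
Lemma invariant_set_density (E : set A) : invariant_set (cofactor_subgroup j) alpha E ->
  exists r : Xj -> R, [/\ measurable_fun setT r, (forall y, (0 <= r y)%R) &
    forall D, measurable D ->
      alpha (E `&` rho @^-1` D) = \int[nu]_x ((r (p x))%:E * (\1_D x)%:E)].
Proof.
move=> [mE Einv]; have [mrho rhoact rhoE] := hrho.
have mrD (D : set X) : measurable D -> measurable (rho @^-1` D).
  by move=> mD; exact: measurable_pre.
have [||r H] := @cofactor_stationary_density _ _ _ hG _ _ hprod hadm _ _ qiX stX ergX
    _ _ _ _ hp (rlaw_finite alpha mE mrho); last by exists r.
- move=> D mD D0; have : alpha (rho @^-1` D) = 0 by rewrite rhoE.
  apply: null_subset; [|exact: mrD|exact: subIsetr].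
  by apply: measurableI => //; exact: mrD.
move=> D mD.
have mED : measurable (E `&` rho @^-1` D) by apply: measurableI => //; exact: mrD.
rewrite -[RHS](proj_off_stationary hG hprod hadm qiA stA j ergA mED).
apply: eq_integral => g _.
rewrite -[LHS]/(alpha (E `&` rho @^-1` (act (proj_off j (g : G)) @^-1` D))).
have mgD : measurable (act (proj_off j (g : G)) @^-1` D) by exact: measurable_act_pre.
apply: ae_measure_eq.
- by apply: measurableI => //; exact: mrD.
- exact: measurable_act_pre.
have gE := setY_null_ae (measurable_act_pre _ mE) mE (Einv _ (cofactor_proj_off j (g : G))).
apply: filterS2 gE (rhoact (proj_off j (g : G))) => a Ea ra /=; rewrite ra.
by split => -[? ?]; split => //; apply/Ea.
Qed.

End invariant_set_density.

(** * Path space of the random walk and the boundary map *)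

Section path_space.
Local Open Scope ereal_scope.
Context (R : realType) (k : nat) (Gs : 'I_k -> topGroupType) (hG : forall i, lcsc (Gs i)).
Local Notation G := (prod_group Gs).
Local Notation paths := (prodm (fun _ : nat => borel G)).

Lemma measurable_path (i : nat) : measurable_fun setT (fun w : paths => w i : borel G).
Proof. by move=> _ C mC; rewrite setTI; apply: sub_sigma_algebra; exists i, C. Qed.

Definition path_cyl (U : nat -> set (borel G)) (n : nat) : set paths :=
  [set w | forall i, (i < n)%N -> U i (w i)].

Lemma path_cylE U n :
  path_cyl U n = \bigcap_(i in [set` iota 0 n]) ((fun w : paths => w i) @^-1` U i).
Proof.
by apply/seteqP; split => w H i; have := H i; rewrite /= mem_iota /= add0n.
Qed.

Lemma measurable_path_cyl U n : (forall i, measurable (U i)) -> measurable (path_cyl U n).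
Proof.
move=> mU; rewrite path_cylE; apply: fin_bigcap_measurable; first exact: finite_seq.
by move=> i _; exact: measurable_pre (measurable_path i) (mU i).
Qed.

Lemma path_cyl_widen U n m : path_cyl U n =
  path_cyl (fun i => if (i < n)%N then U i else setT) (n + m).
Proof.
apply/seteqP; split => w H i; first by case: ifP => // + _; exact: H.
by move=> lin; have := H i; rewrite lin; apply; apply: ltn_addr.
Qed.

Definition path_cyls : set (set paths) :=
  [set E | exists (U : nat -> set (borel G)) n, (forall i, measurable (U i)) /\ E = path_cyl U n].

Lemma path_cylsI : setI_closed path_cyls.
Proof.
move=> _ _ [U [n [mU ->]]] [V [m [mV ->]]].
rewrite (path_cyl_widen U n m) (path_cyl_widen V m n) (addnC m n).
exists (fun i => (if (i < n)%N then U i else setT) `&` (if (i < m)%N then V i else setT)).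
exists (n + m)%N; split.
  by move=> i; apply: measurableI; case: ifP.
apply/seteqP; split => [w [H1 H2] i lin|w H].
  by split; [exact: H1|exact: H2].
by split => i lin; have [] := H i lin.
Qed.

Lemma measurable_paths_cyls : @measurable _ paths = <<s path_cyls >>.
Proof.
apply/seteqP; split.
  apply: smallest_sub; first exact: smallest_sigma_algebra.
  move=> _ [i [B [mB ->]]]; apply: sub_sigma_algebra.
  exists (fun l => if l == i then B else setT), i.+1; split.
    by move=> l; case: ifP.
  apply/seteqP; split => w /=; first by move=> wB l _; case: eqP => // ->.
  by move=> H; have := H i (ltnSn i); rewrite eqxx.
apply: smallest_sub; first exact: sigma_algebra_measurable.
by move=> _ [U [n [mU ->]]]; exact: measurable_path_cyl.
Qed.

Definition path_cat n (z : paths * paths) : paths :=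
  fun i => if (i < n)%N then z.1 i else z.2 (i - n)%N.

Definition path_shift n (w : paths) : paths := fun i => w (n + i)%N.

Lemma measurable_path_cat n : measurable_fun setT (path_cat n).
Proof.
apply: measurable_prodm => i; rewrite /path_cat; case: (i < n)%N.
  exact: measurableT_comp (measurable_path i) measurable_fst.
exact: measurableT_comp (measurable_path _) measurable_snd.
Qed.

Lemma measurable_path_shift n : measurable_fun setT (path_shift n).
Proof. by apply: measurable_prodm => i; exact: measurable_path. Qed.

Lemma path_shift_cat n w w' : path_shift n (path_cat n (w, w')) = w'.
Proof.
apply/funext => i; rewrite /path_shift /path_cat ltnNge leq_addr /=.
by rewrite addKn.
Qed.

Lemma path_cyl_cat U n w w' : path_cyl U n (path_cat n (w, w')) <-> path_cyl U n w.
Proof.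
by split => H i lin; have := H i lin; rewrite /path_cat lin.
Qed.

Lemma walk_cat_prefix n w w' m : (m <= n)%N -> walk (path_cat n (w, w')) m = walk w m.
Proof.
elim: m => //= m IH mn; rewrite IH ?(ltnW mn)//.
by rewrite /path_cat mn.
Qed.

Lemma walk_add (w : paths) n m : walk w (n + m) = (walk w n * walk (path_shift n w) m)%g.
Proof.
elim: m => [|m IH]; first by rewrite addn0 /= mulg1.
by rewrite addnS /= IH mulgA.
Qed.

Lemma measurable_walk n : measurable_fun setT (fun w : paths => walk w n : borel G).
Proof.
elim: n => [|n IH] /=; first exact: measurable_cst.
exact: (measurableT_comp (measurable_mulg hG) (measurable_fun_pair IH (measurable_path n))).
Qed.

Lemma measurable_walks : measurable_fun setT (fun w : paths => walk w : paths).
Proof. by apply: measurable_prodm => n; exact: measurable_walk. Qed.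

Variables (mu : probability (borel G) R) (muN : probability paths R).
Hypothesis hmuN : is_iid_law mu muN.

Let muN_cyl U n : (forall i, measurable (U i)) ->
  muN (path_cyl U n) = (\prod_(i <- iota 0 n) fine (mu (U i)))%R%:E.
Proof. by move=> mU; rewrite path_cylE hmuN// iota_uniq. Qed.

(** Independence of the increments: the first [n] may be taken from one sequence and the others from
    an independent copy. It serves as conditioning on the first [n] steps. *)
Lemma integral_path_cat n (F : paths -> \bar R) :
  measurable_fun setT F -> (forall w, 0 <= F w) ->
  \int[muN]_w F w = \int[muN]_w \int[muN]_w' F (path_cat n (w, w')).
Proof.
move=> mF F0.
have -> : \int[muN]_w \int[muN]_w' F (path_cat n (w, w')) =
    \int[muN \x muN]_z F (path_cat n z).
  rewrite fubini_tonelli1//; exact: measurableT_comp mF (measurable_path_cat n).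
transitivity (\int[muN]_g (1 * F g)); first by apply: eq_integral => g _; rewrite mul1e.
transitivity (\int[muN \x muN]_z (1 * F (path_cat n z))); last first.
  by apply: eq_integral => g _; rewrite mul1e.
have mcat := measurable_path_cat n.
apply: (@density_integral R _ _ _ _ _ _ muN (muN \x muN) id (path_cat n) (cst 1) (cst 1)) => //.
apply: (@density_unique R _ _ _ _ _ _ muN (muN \x muN) id (path_cat n) (cst 1) (cst 1)
  path_cyls) => //.
- by rewrite integral_cst// [X in _ * X]probability_setT mul1e ltry.
- exact: measurable_paths_cyls.
- exact: path_cylsI.
- rewrite !integral_cst//; congr (_ * _).
  by rewrite [LHS]probability_setT [RHS]probability_setT.
move=> _ [U0 [m0 [mU0 ->]]]; rewrite (path_cyl_widen U0 m0 n) (addnC m0 n).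
set U := (fun i => if (i < m0)%N then U0 i else setT); set m := m0.
have mU i : measurable (U i) by rewrite /U; case: ifP.
have mC := measurable_path_cyl (n + m) mU.
under eq_integral do rewrite mul1e.
under [RHS]eq_integral do rewrite mul1e.
rewrite integral_setT_indic//.
rewrite (integral_indic_pre (muN \x muN) mcat mC).
have -> : path_cat n @^-1` path_cyl U (n + m) =
    path_cyl U n `*` path_cyl (fun i => U (n + i)%N) m.
  apply/seteqP; split => [[w w'] /= H|[w w'] [/= H1 H2] i].
    split => /= i lin.
      by have := H i (ltn_addr _ lin); rewrite /path_cat lin.
    have := H (n + i)%N; rewrite ltn_add2l => /(_ lin).
    by rewrite /path_cat ltnNge leq_addr /= addKn.
  rewrite /path_cat /=; case: (ltnP i n) => [lin _|nli lim]; first exact: H1.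
  by have := H2 (i - n)%N; rewrite subnKC//; apply; rewrite ltn_subLR.
rewrite [RHS](prod_probE muN muN); [|exact: measurable_path_cyl|exact: measurable_path_cyl].
rewrite [LHS]muN_cyl// !muN_cyl// -EFinM iotaD big_cat /= add0n; congr (_ * _)%:E.
by rewrite -{1}(addn0 n) iotaDl big_map.
Qed.

End path_space.

Lemma measurable_standard_eq (R : realType) d (T : measurableType d) d' (B : measurableType d')
    (f g : T -> B) : standard_borel R B -> measurable_fun setT f -> measurable_fun setT g ->
  measurable [set x | f x = g x].
Proof.
move=> /standard_borel_real[t [s [mt _ tK _]]] mf mg.
rewrite (_ : [set _ | _] = setT `&` [set x | (t (f x))%:E = (t (g x))%:E]).
  by apply: measurable_eqe => //; apply/measurable_EFinP; exact: measurableT_comp.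
apply/seteqP; split => x /=; first by move=> ->.
by move=> [_ [/(can_inj tK)]].
Qed.

Section boundary_map.
Local Open Scope ereal_scope.
Context (R : realType) (k : nat) (Gs : 'I_k -> topGroupType) (hG : forall i, lcsc (Gs i)).
Local Notation G := (prod_group Gs).
Local Notation paths := (prodm (fun _ : nat => borel G)).
Variables (mu : probability (borel G) R) (muN : probability paths R).
Hypothesis hmuN : is_iid_law mu muN.

Lemma ae_path_shift n (Q : paths -> Prop) :
  {ae muN, forall w, Q w} -> {ae muN, forall w, Q (path_shift n w)}.
Proof.
move=> [N [mN N0 QN]]; exists (path_shift n @^-1` N); split.
- exact: measurable_pre (@measurable_path_shift _ Gs n) mN.
- have mS := measurable_path_shift (Gs := Gs) n.
  rewrite -(integral_indic_pre muN mS mN) (integral_path_cat hmuN n); last 2 first.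
  + exact: measurable_indic_comp.
  + by move=> w; rewrite lee_fin.
  rewrite integral0_eq// => w _.
  under eq_integral do rewrite path_shift_cat.
  by rewrite integral_setT_indic.
- by move=> w nQ; exact: QN.
Qed.

Variables (B : gspace G) (beta : probability B R).

(** The boundary point of the trajectory, as a function of the increments. After [n] steps the walk
    restarts, translated by the position reached, so the boundary point is that position applied to
    the boundary point of the remaining increments. *)
Lemma poisson_boundary_map : poisson_boundary mu muN beta ->
  exists z : paths -> B, [/\ measurable_fun setT z,
    forall E, measurable E -> muN (z @^-1` E) = beta E &
    forall n, {ae muN, forall w, z w = act (walk w n) (z (path_shift n w))}].
Proof.
move=> [[sB _ _] [bnd [mbnd bndE bndG bndS _]]].
pose z (w : paths) := bnd (walk w).
have mz : measurable_fun setT z by exact: (measurableT_comp mbnd (measurable_walks hG)).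
exists z; split => //.
have step : {ae muN, forall w, z w = act (w 0%N) (z (path_shift 1 w))}.
  (* This is the trajectory with its initial point dropped, so shift invariance of [bnd] gives it
     the same boundary point. *)
  pose tr (w : paths) : paths := fun m => (w 0%N * walk (path_shift 1 w) m)%g.
  have mtr : measurable_fun setT tr.
    apply: measurable_prodm => m; exact: (measurableT_comp (measurable_mulg hG)
      (measurable_fun_pair (@measurable_path _ Gs 0)
        (measurableT_comp (measurable_walk hG m) (@measurable_path_shift _ Gs 1)))).
  have mact : measurable_fun setT (fun w : paths => act (w 0%N) (z (path_shift 1 w))).
    exact: (measurableT_comp (@measurable_act _ B)
      (measurable_fun_pair (@measurable_path _ Gs 0)
        (measurableT_comp mz (@measurable_path_shift _ Gs 1)))).
  pose D := ~` [set w : paths | bnd (tr w) = act (w 0%N) (z (path_shift 1 w))].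
  have mD : measurable D.
    exact: (measurableC (measurable_standard_eq sB (measurableT_comp mbnd mtr) mact)).
  have trE w w' : tr (path_cat 1 (w, w')) = (fun m => w 0%N * walk w' m)%g.
    by apply/funext => m; rewrite /tr path_shift_cat.
  have DE w w' : D (path_cat 1 (w, w')) ->
      bnd (fun m => w 0%N * walk w' m)%g <> act (w 0%N) (bnd (walk w')).
    by rewrite /D /= trE path_shift_cat.
  have D0 : muN D = 0.
    (* Equivariance of [bnd] holds off a null set depending on the group element; freezing the first
       increment leaves a single element at a time. *)
    rewrite -(integral_setT_indic muN mD) (integral_path_cat hmuN 1); last 2 first.
    + exact: measurable_EFin_indic.
    + by move=> w; rewrite lee_fin.
    apply: integral0_eq => w _.
    have mc : measurable_fun setT (fun w' => path_cat 1 (w, w')).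
      exact: (measurableT_comp (@measurable_path_cat _ Gs 1) (pair1_measurable w)).
    apply: (etrans (integral_indic_pre muN mc mD)).
    have [N [mN N0 sN]] := bndG (w 0%N).
    apply: null_subset N0 => //; first exact: measurable_pre mc mD.
    by move=> w' /DE Dw; apply: sN.
  have Dae : {ae muN, forall w, bnd (tr w) = act (w 0%N) (z (path_shift 1 w))}.
    by exists D; split.
  apply: filterS2 Dae bndS => w <- Sw; rewrite /z -Sw; congr bnd; apply/funext => m.
  by rewrite /tr -[m.+1]add1n walk_add /= mul1g.
elim=> [|n IH]; first by apply: aeW => w; rewrite /= act1.
apply: filterS2 IH (ae_path_shift n step) => w -> ->.
rewrite -actM /=; congr (act (_ * w _)%g _); first by rewrite addn0.
by congr z; apply/funext => i; rewrite /path_shift addnA addn1.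
Qed.

End boundary_map.

(** * Averages of measures, compact models and test functions *)

Section mixtures.
Local Open Scope ereal_scope.
Context (R : realType) d (T : measurableType d) d' (S : measurableType d').

Lemma measurable_kernel_pi (K : T -> probability S R) (G : set (set S)) :
  @measurable _ S = <<s G >> -> setI_closed G ->
  (forall E, G E -> measurable_fun setT (K ^~ E)) ->
  forall E, measurable E -> measurable_fun setT (K ^~ E).
Proof.
move=> SG GI HG E; rewrite SG; move: E.
apply: (@dynkin_induction _ S G (fun E => measurable_fun setT (K ^~ E))) => //.
- rewrite (_ : (fun t => _) = cst 1); first exact: measurable_cst.
  by apply/funext => t; rewrite [LHS]probability_setT.
- move=> E mE mKE; rewrite (_ : (fun t => _) = fun t => 1 - K t E); last first.
    by apply/funext => t; rewrite [LHS]probability_setC.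
  exact: emeasurable_funB.
- move=> F mF tF mKF.
  rewrite (_ : (fun t => _) = fun t => \sum_(n <oo) K t (F n)); last first.
    by apply/funext => t; rewrite measure_semi_bigcup//; exact: bigcup_measurable.
  apply: (ge0_emeasurable_sum (P := xpredT)) => //.
Qed.

Variables (P : probability T R) (K : T -> probability S R).
Hypothesis mK : forall E, measurable E -> measurable_fun setT (K ^~ E).

Definition mixture_of (E : set S) : \bar R := \int[P]_t K t E.

Let mixture0 : mixture_of set0 = 0.
Proof. by rewrite /mixture_of integral0_eq// => t _; rewrite measure0. Qed.

Let mixture_ge0 E : 0 <= mixture_of E.
Proof. exact: integral_ge0. Qed.

Let mixture_sigma_additive : semi_sigma_additive mixture_of.
Proof.
move=> F mF tF mUF.
rewrite [X in _ --> X](_ : _ = \sum_(n <oo) mixture_of (F n)).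
  by apply/cvg_closeP; split; [exact: is_cvg_nneseries|rewrite closeE].
rewrite /mixture_of -integral_nneseries//; last by move=> n; exact: mK.
by apply: eq_integral => t _; rewrite measure_semi_bigcup.
Qed.

HB.instance Definition _ := isMeasure.Build _ _ _
  mixture_of mixture0 mixture_ge0 mixture_sigma_additive.

Let mixtureT : mixture_of setT = 1.
Proof.
rewrite /mixture_of; under eq_integral do rewrite probability_setT.
by rewrite integral_cst// [X in _ * X]probability_setT mule1.
Qed.

HB.instance Definition _ := Measure_isProbability.Build _ _ _ mixture_of mixtureT.

Definition mixture : probability S R := mixture_of.

Lemma mixtureE E : mixture E = \int[P]_t K t E. Proof. by []. Qed.

End mixtures.

Section rectangles.
Local Open Scope ereal_scope.
Context (R : realType) d (T : measurableType d) d' (S : measurableType d').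

Definition rectangles : set (set (T * S)) :=
  [set A `*` B | A in measurable & B in measurable].

Lemma rectanglesI : setI_closed rectangles.
Proof.
move=> _ _ [A mA [B mB <-]] [A' mA' [B' mB' <-]].
exists (A `&` A'); first exact: measurableI.
exists (B `&` B'); first exact: measurableI.
by rewrite setXI.
Qed.

Lemma measurable_rectangles : @measurable _ (T * S)%type = <<s rectangles >>.
Proof. exact: measurable_prod_measurableType. Qed.

Lemma integral_plaw (P : probability T R) (q : T -> S) (mq : measurable_fun setT q)
    (f : S -> \bar R) : measurable_fun setT f -> (forall x, 0 <= f x) ->
  \int[plaw P mq]_x f x = \int[P]_x f (q x).
Proof.
move=> mf f0.
transitivity (\int[plaw P mq]_x (1 * f x)); first by apply: eq_integral => x _; rewrite mul1e.
transitivity (\int[P]_x (1 * f (q x))); last by apply: eq_integral => x _; rewrite mul1e.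
apply: (@density_integral _ _ _ _ _ _ _ (plaw P mq) P id q (cst 1) (cst 1)) => //.
move=> D mD; under eq_integral do rewrite mul1e.
under [RHS]eq_integral do rewrite mul1e.
by rewrite integral_setT_indic// integral_indic_pre.
Qed.

End rectangles.

Section joint_law.
Local Open Scope ereal_scope.
Context (R : realType) d (T : measurableType d) d' (S : measurableType d').
Variables (P : probability T R) (K : T -> probability S R).
Hypothesis mK : forall E, measurable E -> measurable_fun setT (K ^~ E).

Let KT (t : T) : probability (T * S)%type R := plaw (K t) (pair1_measurable t).

Let mKT E : measurable E -> measurable_fun setT (KT ^~ E).
Proof.
move: E; apply: (measurable_kernel_pi (@measurable_rectangles _ T _ S) (@rectanglesI _ T _ S)).
move=> _ [A mA [B mB <-]].
rewrite (_ : (fun t => _) = fun t => (\1_A t)%:E * K t B).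
  by apply: emeasurable_funM; [exact: measurable_EFin_indic|exact: mK].
apply/funext => t; rewrite /KT plawE indicE.
have [tA|tA] := boolP (t \in A).
  rewrite mul1e; congr (K t _); apply/seteqP; split => s /=; first by case.
  by split => //; rewrite inE in tA.
rewrite mul0e (_ : _ @^-1` _ = set0) ?measure0//.
by apply/seteqP; split => s //= -[At _]; rewrite mem_set in tA.
Qed.

(* The joint law of t, of law P, and of a point of law K t. *)
Definition joint_law : probability (T * S)%type R := mixture P mKT.

Lemma integral_joint_law (f : T * S -> \bar R) : measurable_fun setT f -> (forall z, 0 <= f z) ->
  \int[joint_law]_z f z = \int[P]_t \int[K t]_s f (t, s).
Proof.
move=> mf f0; rewrite (mixture_integral (P := P) (K := KT) mKT)//.
apply: eq_integral => t _; exact: (integral_plaw (K t) (pair1_measurable t) mf f0).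
Qed.

End joint_law.

Definition pointed_metric (R : realType) (K : metricType R) (x0 : K) : Type := K.
HB.instance Definition _ (R : realType) (K : metricType R) (x0 : K) :=
  Metric.copy (pointed_metric x0) K.
HB.instance Definition _ (R : realType) (K : metricType R) (x0 : K) :=
  isPointed.Build (pointed_metric x0) x0.

Section compact_models.
Context (R : realType).

Lemma compact_metric_dense (K : metricType R) : K -> compact [set: K] ->
  exists c : nat -> K, forall x e, 0 < e -> exists n, mdist (c n) x < e.
Proof.
move=> x0 cK.
have [b [bo bb]] : exists b : nat -> set K, base_enum b.
  apply: second_countable_enum.
  have h : @second_countable (pointed_metric x0) := @compact_second_countable R (pointed_metric x0) cK.
  exact: h.
have /choice[c cP] : forall n, exists c, b n !=set0 -> b n c.
  move=> n; have [[c bc]|nb] := pselect (b n !=set0); first by exists c.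
  by exists x0.
exists c => x e e0; have [n [bx be]] := bb x _ (nbhsx_ballx x e e0).
exists n; have := be _ (cP n (ex_intro _ _ bx)).
by rewrite ballEmdist /= metric_sym.
Qed.

Lemma mdist_continuous (K : metricType R) (c : K) :
  continuous (fun x => mdist c x : R).
Proof.
move=> x; apply/cvgrPdist_lt => e e0; near=> y.
have xy : mdist x y < e.
  near: y; have := nbhsx_ballx x e e0; apply: filterS => y.
  by rewrite ballEmdist.
apply: le_lt_trans xy; rewrite ler_norml.
have h1 := metric_triangle c y x; have h2 := metric_triangle c x y.
rewrite (metric_sym y x) in h1.
by apply/andP; split; lra.
Unshelve. all: by end_near. Qed.

Definition clip (t : R) : R := Num.min 1 (Num.max 0 t).

Lemma clip01 t : 0 <= clip t <= 1.
Proof. by rewrite /clip le_min ler01 le_max lexx /= ge_min lexx. Qed.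

Lemma clip_le s t : s <= t -> clip s <= clip t.
Proof.
move=> st; rewrite /clip le_min ge_min lexx /= ge_min; apply/orP; right.
by rewrite ge_max le_max lexx /= le_max st orbT.
Qed.

Lemma continuous_clip (K : topologicalType) (h : K -> R) :
  continuous h -> continuous (fun y => clip (h y)).
Proof.
move=> ch y; apply: (@continuous_min R K (cst 1) (fun y => Num.max 0 (h y))).
  exact: cst_continuous.
apply: (@continuous_max R K (cst 0) h); first exact: cst_continuous.
exact: ch.
Qed.

Context (G : topGroupType) (muN : probability (prodm (fun _ : nat => borel G)) R).
Variables (X : gspace G) (nu : probability X R)
  (nuw : prodm (fun _ : nat => borel G) -> probability X R).

(** What is kept of the compact model: [Tst] consists of the continuous functions with values in the
    unit interval and is stable under translation; [O] consists of the cozero sets, whose indicators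
    are increasing limits of tests; countably many cozero sets separate points. *)
Lemma conditional_measures_model : conditional_measures muN nu nuw ->
  exists Tst : set (X -> R), [/\
    forall f, Tst f -> measurable_fun setT f /\ forall x, 0 <= f x <= 1,
    forall f g, Tst f -> Tst (fun x => f (act g x)),
    {ae muN, forall w, forall f, Tst f ->
      (fun n => \int[nu]_x f (act (walk w n) x))%R @ \oo --> (\int[nuw w]_x f x)%R} &
    exists O : set (set X), [/\ O setT /\ setI_closed O,
      forall E, O E -> measurable E /\ exists f : nat -> X -> R,
        [/\ forall n, Tst (f n), forall x m n, (m <= n)%N -> f m x <= f n x &
            forall x, \forall n \near \oo, f n x = \1_E x] &
      exists Os : nat -> set X, (forall n, O (Os n)) /\
        forall x y, (forall n, Os n x <-> Os n y) -> x = y]].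
Proof.
move=> [_ [K [aK [iota [[cK caK _] [inj mio ioact cv]]]]]].
have ccl (h : K -> R) : continuous h -> measurable_fun setT (h \o iota).
  move=> ch; apply: (measurability _ (RGenOInfty.measurableE R)) => // _ [_ [c ->] <-].
  rewrite setTI comp_preimage; apply: mio.
  by apply: open_comp; [move=> x _; exact: ch|exact: rray_open].
exists [set f | exists2 h : K -> R, continuous h & (forall y, 0 <= h y <= 1) /\ f = h \o iota].
split.
- by move=> _ [h ch [h01 ->]]; split => [|x]; [exact: ccl|exact: h01].
- move=> _ g [h ch [h01 ->]]; exists (fun y => h (aK g y)).
    move=> y; apply: (@continuous_comp _ _ _ (fun y => aK g y) h); last exact: ch.
    have gy : (fun y => (g, y)) @ y --> (g, y).
      by apply: cvg_pair => /=; [exact: cvg_cst|exact: cvg_id].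
    exact: cvg_comp gy (caK (g, y)).
  by split => //; apply/funext => x /=; rewrite ioact.
- apply: filterS cv => w cvw _ [h ch [h01 ->]]; have := cvw h ch.
  by [].
pose coz (h : K -> R) := iota @^-1` [set y | 0 < h y].
exists [set E | exists2 h : K -> R, continuous h & E = coz h]; split.
- split.
    exists (cst 1); first by move=> y; exact: cst_continuous.
    by apply/seteqP; split => x //= _; rewrite /coz /= ltr01.
  move=> _ _ [h ch ->] [h' ch' ->]; exists (fun y => Num.min (h y) (h' y)).
    by move=> y; apply: (@continuous_min R K h h'); [exact: ch|exact: ch'].
  apply/seteqP; split => x /=; rewrite /coz /= lt_min.
    by move=> [-> ->].
  by move=> /andP[].
- move=> _ [h ch ->]; split.
    rewrite (_ : coz h = (h \o iota) @^-1` `]0, +oo[%classic).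
      exact: measurable_pre (ccl h ch) (measurable_itv _).
    by apply/seteqP; split => x; rewrite /coz /= in_itv /= andbT.
  exists (fun n x => clip (n.+1%:R * h (iota x))); split.
  + move=> n; exists (fun y => clip (n.+1%:R * h y)); last by split => // y; exact: clip01.
    apply: continuous_clip => y; apply: (@continuousM _ K (cst n.+1%:R) h).
      exact: cst_continuous.
    exact: ch.
  + move=> x m n mn; have [h0|h0] := leP 0 (h (iota x)).
      by apply: clip_le; rewrite ler_wpM2r// ler_nat ltnS.
    rewrite /clip !(max_idPl _)//; apply: mulr_ge0_le0 => //; exact: ltW.
  + move=> x; have [h0|h0] := leP (h (iota x)) 0.
      apply: nearW => n; rewrite indicE memNset; last by rewrite /coz /= ltNge h0.
      by rewrite /clip (max_idPl _) ?min_r//; exact: mulr_ge0_le0.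
    exists (Num.truncn (h (iota x))^-1) => // n /= nh.
    rewrite indicE mem_set// /clip.
    have h1 : 1 <= n.+1%:R * h (iota x).
      rewrite -ler_pdivrMr// mul1r; apply: le_trans (ltW (truncnS_gt _)) _.
      by rewrite ler_nat ltnS.
    by rewrite max_r ?min_l//; exact: le_trans h1.
have [c cd] := compact_metric_dense (iota point) cK.
pose q n : R := ratr (odflt 0%R (choice.unpickle n : option rat)).
pose e (n : nat) : nat * nat := odflt (0%N, 0%N) (choice.unpickle n).
(* Open balls with centres in a dense sequence and rational radii, written as cozero sets. *)
exists (fun n => coz (fun y => q (e n).2 - mdist (c (e n).1) y)); split.
  move=> n; exists (fun y => q (e n).2 - mdist (c (e n).1) y) => // y.
  apply: (@continuousB _ _ K (cst (q (e n).2)) (fun y => mdist (c (e n).1) y)).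
    exact: cst_continuous.
  exact: mdist_continuous.
move=> x y H; apply: inj; apply: contrapT => xy.
have d0 : 0 < mdist (iota x) (iota y) by rewrite mdist_gt0; exact/eqP.
have [d dE] : exists d, d = mdist (iota x) (iota y) by eexists.
rewrite -dE in d0.
have [d3 d32] : 0 < d / 3 /\ d / 3 < d / 2 by split; lra.
have [i ci] := cd (iota x) _ d3.
(* A centre within [d / 3] of [iota x] and a radius between [d / 3] and [d / 2]: the ball contains
   [iota x], and cannot contain [iota y], at distance [d]. *)
have [r] : exists r : rat, ratr r \in `](d / 3), (d / 2)[ by exact: rat_in_itvoo.
rewrite in_itv /= => /andP[r1 r2].
have := (H (choice.pickle (i, choice.pickle r))).1.
rewrite /coz /e /= choice.pickleK /= /q choice.pickleK /= subr_gt0.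
move=> /(_ (lt_trans ci r1)); rewrite subr_gt0 => ciy.
have := metric_triangle (iota x) (c i) (iota y).
by rewrite -dE (metric_sym (iota x)); lra.
Qed.

End compact_models.

Section bounded_integrals.
Local Open Scope ereal_scope.
Context (R : realType) d (T : measurableType d).

Lemma bounded_cvg_integral (P : probability T R) (f_ : nat -> T -> R) (f : T -> R) :
  (forall n, measurable_fun setT (f_ n)) -> measurable_fun setT f ->
  (forall n x, (0 <= f_ n x <= 1)%R) ->
  {ae P, forall x, (f_ ^~ x @ \oo --> f x)%R} ->
  (fun n => \int[P]_x (f_ n x)%:E) @ \oo --> \int[P]_x (f x)%:E.
Proof.
move=> mf_ mf f01 cvf.
have [] := @dominated_convergence _ _ _ P setT measurableT
    (fun n x => (f_ n x)%:E) (fun x => (f x)%:E) (cst 1).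
- by move=> n; exact/measurable_EFinP.
- exact/measurable_EFinP.
- apply: filterS cvf => x cvx _; by apply/fine_cvgP; split; [exact: nearW|exact: cvx].
- exact: finite_measure_integrable_cst.
- apply: aeW => x n _; rewrite gee0_abs lee_fin.
    by have /andP[] := f01 n x.
  by have /andP[] := f01 n x.
- by [].
Qed.

Lemma RintegralE01 (P : probability T R) (f : T -> R) : measurable_fun setT f ->
  (forall x, (0 <= f x <= 1)%R) ->
  (\int[P]_x f x)%R%:E = \int[P]_x (f x)%:E /\ (0 <= (\int[P]_x f x)%R <= 1)%R.
Proof.
move=> mf f01.
have f0 : 0 <= \int[P]_x (f x)%:E.
  by apply: integral_ge0 => x _; rewrite lee_fin; have /andP[] := f01 x.
have f1 : \int[P]_x (f x)%:E <= 1.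
  have P1 : \int[P]_x (cst 1 x) = 1 by rewrite integral_cst// [X in _ * X]probability_setT mule1.
  rewrite -P1; apply: ge0_le_integral => //.
  - by move=> x _; rewrite lee_fin; have /andP[] := f01 x.
  - exact/measurable_EFinP.
  - by move=> x _; rewrite lee_fin; have /andP[] := f01 x.
have ffin : \int[P]_x (f x)%:E \is a fin_num.
  by rewrite ge0_fin_numE// (le_lt_trans f1)// ltry.
by rewrite -!lee_fin /Rintegral fineK// f0 f1.
Qed.

Lemma measurable_integral_kernel d' (S : measurableType d') (K : T -> probability S R)
    (f : S -> \bar R) :
  (forall E, measurable E -> measurable_fun setT (K ^~ E)) ->
  measurable_fun setT f -> (forall x, 0 <= f x) ->
  measurable_fun setT (fun t => \int[K t]_x f x).
Proof.
move=> mK; move: f.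
apply: (ge0_measurable_ind (P := fun f => measurable_fun setT (fun t => \int[K t]_x f x))).
- move=> E mE; rewrite (_ : (fun t => _) = K ^~ E); first exact: mK.
  by apply/funext => t; rewrite integral_setT_indic.
- move=> f g mf mg f0 g0 If Ig.
  rewrite (_ : (fun t => _) = fun t => \int[K t]_x f x + \int[K t]_x g x).
    exact: emeasurable_funD.
  by apply/funext => t; rewrite ge0_integralTD.
- move=> r f r0 mf f0 If.
  rewrite (_ : (fun t => _) = fun t => r%:E * \int[K t]_x f x).
    exact: measurable_funeM.
  by apply/funext => t; rewrite ge0_integralTZl// lee_fin.
move=> h f mh h0 hnd hf IH.
apply: (emeasurable_fun_cvg (fun n t => \int[K t]_x h n x)) => // t _.
rewrite (_ : \int[K t]_x f x = \int[K t]_x limn (h ^~ x)); last first.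
  by apply: eq_integral => x _; rewrite (cvg_lim _ (hf x)).
by apply: cvg_monotone_convergence.
Qed.

End bounded_integrals.

Section ae_mp.
Context (R : realType) d (T : measurableType d) (m : probability T R).

Lemma ae_mp (Q Q' : T -> Prop) :
  {ae m, forall x, Q x} -> (forall x, Q x -> Q' x) -> {ae m, forall x, Q' x}.
Proof. by move=> aeQ QQ'; exact: filterS aeQ. Qed.

Lemma ae_mp2 (Q Q' Q'' : T -> Prop) :
  {ae m, forall x, Q x} -> {ae m, forall x, Q' x} ->
  (forall x, Q x -> Q' x -> Q'' x) -> {ae m, forall x, Q'' x}.
Proof. by move=> aeQ aeQ' QQ'; exact: filterS2 aeQ aeQ'. Qed.

End ae_mp.

Section product_kernels.
Local Open Scope ereal_scope.
Context (R : realType) d (T : measurableType d) d1 (S1 : measurableType d1)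
  d2 (S2 : measurableType d2).

Lemma measurable_prod_kernel (K1 : T -> probability S1 R) (K2 : T -> probability S2 R) :
  (forall E, measurable E -> measurable_fun setT (K1 ^~ E)) ->
  (forall E, measurable E -> measurable_fun setT (K2 ^~ E)) ->
  forall E, measurable E -> measurable_fun setT (fun t => (K1 t \x K2 t) E).
Proof.
move=> mK1 mK2; pose K t : probability (S1 * S2)%type R := (K1 t \x K2 t).
apply: (measurable_kernel_pi (K := K) (@measurable_rectangles _ S1 _ S2) (@rectanglesI _ S1 _ S2)).
move=> _ [A mA [B mB <-]].
rewrite (_ : (fun t => _) = fun t => K1 t A * K2 t B).
  by apply: emeasurable_funM; [exact: mK1|exact: mK2].
by apply/funext => t; exact: prod_probE.
Qed.

Lemma integral_prod_mul (P : probability S1 R) (Q : probability S2 R) (f : S1 -> R) (g : S2 -> R) :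
  measurable_fun setT f -> measurable_fun setT g ->
  (forall x, (0 <= f x)%R) -> (forall y, (0 <= g y)%R) ->
  \int[P \x Q]_z (f z.1 * g z.2)%:E = (\int[P]_x (f x)%:E) * (\int[Q]_y (g y)%:E).
Proof.
move=> mf mg f0 g0.
have mfE : measurable_fun setT (EFin \o f) by exact/measurable_EFinP.
have mgE : measurable_fun setT (EFin \o g) by exact/measurable_EFinP.
rewrite fubini_tonelli1; last 2 first.
- apply/measurable_EFinP; apply: measurable_funM.
    exact: measurableT_comp mf measurable_fst.
  exact: measurableT_comp mg measurable_snd.
- by move=> z; rewrite lee_fin mulr_ge0.
have Qg0 : 0 <= \int[Q]_y (g y)%:E by apply: integral_ge0 => y _; rewrite lee_fin.
transitivity (\int[P]_x ((\int[Q]_y (g y)%:E) * (f x)%:E)).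
  apply: eq_integral => x _; rewrite muleC.
  have gg y : 0 <= (EFin \o g) y by rewrite lee_fin.
  have fx : 0 <= (f x)%:E by rewrite lee_fin.
  exact: (ge0_integralTZl Q mgE gg fx).
rewrite muleC; exact: (ge0_integralTZl P mfE).
Qed.

End product_kernels.

(** * The stationary joining read along the random walk *)

Section joining_tests.
Local Open Scope ereal_scope.
Context (R : realType) (k : nat) (Gs : 'I_k -> topGroupType) (hG : forall i, lcsc (Gs i)).
Local Notation G := (prod_group Gs).
Local Notation paths := (prodm (fun _ : nat => borel G)).
Variables (mu : probability (borel G) R) (muN : probability paths R).
Hypothesis hmuN : is_iid_law mu muN.
Variables (B : gspace G) (beta : probability B R) (X : gspace G) (nu : probability X R).
Variables (betaw : paths -> probability B R) (nuw : paths -> probability X R).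
Hypothesis mbetaw : forall E, measurable E -> measurable_fun setT (betaw ^~ E).
Hypothesis mnuw : forall E, measurable E -> measurable_fun setT (nuw ^~ E).
Variable lambda : probability (gspace_prod B X) R.
Hypothesis lambdaE : forall C : set (B * X), measurable C ->
  lambda C = \int[muN]_w (betaw w \x nuw w) C.
Variable z : paths -> B.
Hypotheses (mz : measurable_fun setT z)
  (zlaw : forall E, measurable E -> muN (z @^-1` E) = beta E)
  (zshift : forall n, {ae muN, forall w, z w = act (walk w n) (z (path_shift n w))}).

Lemma path_cyl_catW U n m w w' : (n <= m)%N ->
  path_cyl U n (path_cat m (w, w')) <-> path_cyl (Gs := Gs) U n w.
Proof.
move=> nm; split => H i lin; have := H i lin; rewrite /path_cat.
  by rewrite (leq_trans lin).
by rewrite /= (leq_trans lin).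
Qed.

Section tests.
Variables (f1 : B -> R) (f2 : X -> R).
Hypotheses (mf1 : measurable_fun setT f1) (mf2 : measurable_fun setT f2)
  (f1_01 : forall b, (0 <= f1 b <= 1)%R) (f2_01 : forall x, (0 <= f2 x <= 1)%R).

Let mactB (f : B -> R) : measurable_fun setT f ->
  measurable_fun setT (fun gb : borel G * B => f (act (gb.1 : G) gb.2)).
Proof. by move=> mf; exact: measurableT_comp mf (@measurable_act _ B). Qed.

Let avg1 (g : borel G) : R := (\int[beta]_b f1 (act (g : G) b))%R.
Let avg2 (g : borel G) : R := (\int[nu]_x f2 (act (g : G) x))%R.

Let avg1E g : (avg1 g)%:E = \int[beta]_b (f1 (act (g : G) b))%:E /\ (0 <= avg1 g <= 1)%R.
Proof.
apply: RintegralE01 => //; exact: measurableT_comp mf1 (measurable_act_at _).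
Qed.
Let avg2E g : (avg2 g)%:E = \int[nu]_x (f2 (act (g : G) x))%:E /\ (0 <= avg2 g <= 1)%R.
Proof.
apply: RintegralE01 => //; exact: measurableT_comp mf2 (measurable_act_at _).
Qed.

Let mavg1 : measurable_fun setT avg1.
Proof.
apply/measurable_EFinP; rewrite (_ : _ \o _ = fun g : borel G => \int[beta]_b (f1 (act (g : G) b))%:E).
  apply: (measurable_integral_fst beta (f := fun gb : borel G * B => (f1 (act (gb.1 : G) gb.2))%:E)).
    by apply/measurable_EFinP; exact: mactB.
  by move=> gb; rewrite lee_fin; have /andP[] := f1_01 (act gb.1 gb.2).
by apply/funext => g /=; rewrite (avg1E g).1.
Qed.

Let mavg2 : measurable_fun setT avg2.
Proof.
apply/measurable_EFinP; rewrite (_ : _ \o _ = fun g : borel G => \int[nu]_x (f2 (act (g : G) x))%:E).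
  apply: (measurable_integral_fst nu (f := fun gb : borel G * X => (f2 (act (gb.1 : G) gb.2))%:E)).
    by apply/measurable_EFinP; exact: measurableT_comp mf2 (@measurable_act _ X).
  by move=> gb; rewrite lee_fin; have /andP[] := f2_01 (act gb.1 gb.2).
by apply/funext => g /=; rewrite (avg2E g).1.
Qed.

Variables (U : nat -> set (borel G)) (n : nat).
Hypothesis mU : forall i, measurable (U i).
Let C := path_cyl U n.
Let mC : measurable C. Proof. exact: measurable_path_cyl. Qed.

(** The common approximation: the limit of [L] is computed in two ways, once through the boundary
    point and once through the joining. *)
Let L m := \int[muN]_w ((\1_C w)%:E * (avg1 (walk w m) * avg2 (walk w m))%:E).

Let mw m : measurable_fun setT (fun w : paths => walk w m : borel G).
Proof. exact: measurable_walk. Qed.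

Let one_cat m w w' : (n <= m)%N -> \1_C (path_cat m (w, w')) = \1_C w :> R.
Proof.
by move=> nm; rewrite !indicE; congr (_%:R); congr nat_of_bool; apply/idP/idP;
  rewrite !inE => H; apply/(path_cyl_catW U w w' nm).
Qed.

(** Given the first [m] increments, [z w] is the position [walk w m] applied to an independent point
    of law [beta], so averaging [f1 (z w)] gives [avg1] at that position. *)
Let L_boundary m : (n <= m)%N ->
  \int[muN]_w ((\1_C w)%:E * (f1 (z w) * avg2 (walk w m))%:E) = L m.
Proof.
move=> nm.
pose F (w : paths) := (\1_C w)%:E *
  (f1 (act (walk w m) (z (path_shift m w))) * avg2 (walk w m))%:E.
have mfz : measurable_fun setT (fun w : paths => f1 (act (walk w m) (z (path_shift m w)))).
  exact: (measurableT_comp (mactB mf1) (measurable_fun_pair (mw m)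
    (measurableT_comp mz (@measurable_path_shift _ Gs m)))).
have m2 : measurable_fun setT (fun w : paths => avg2 (walk w m)).
  exact: measurableT_comp mavg2 (mw m).
have mC1 := measurable_EFin_indic (R := R) mC.
have mF : measurable_fun setT F.
  by apply: emeasurable_funM => //; apply/measurable_EFinP; exact: measurable_funM.
have F0 w : 0 <= F w.
  rewrite mule_ge0 ?lee_fin// mulr_ge0//; first by have /andP[] := f1_01 (act (walk w m) (z (path_shift m w))).
  by have [_ /andP[]] := avg2E (walk w m).
transitivity (\int[muN]_w F w).
  apply: ge0_ae_eq_integral => //.
  - apply: emeasurable_funM => //; apply/measurable_EFinP; apply: measurable_funM => //.
    exact: measurableT_comp mf1 mz.
  - move=> w _; rewrite mule_ge0 ?lee_fin// mulr_ge0//; first by have /andP[] := f1_01 (z w).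
    by have [_ /andP[]] := avg2E (walk w m).
  - by apply: filterS (zshift m) => w zw _; rewrite /F -zw.
rewrite (integral_path_cat hmuN m mF F0); apply: eq_integral => w _.
transitivity (\int[muN]_w' (((\1_C w)%:E * (avg2 (walk w m))%:E) * (f1 (act (walk w m) (z w')))%:E)).
  apply: eq_integral => w' _; rewrite /F one_cat// walk_cat_prefix// path_shift_cat.
  by rewrite [(f1 _ * _)%R]mulrC EFinM muleA.
have mfw : measurable_fun setT (fun b => (f1 (act (walk w m) b))%:E).
  by apply/measurable_EFinP; exact: measurableT_comp mf1 (measurable_act_at _).
have fw0 b : 0 <= (f1 (act (walk w m) b))%:E by rewrite lee_fin; have /andP[] := f1_01 (act (walk w m) b).
rewrite ge0_integralTZl; last 3 first.
- exact: measurableT_comp mfw mz.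
- by move=> w'; exact: fw0.
- by rewrite mule_ge0 ?lee_fin//; have [_ /andP[]] := avg2E (walk w m).
rewrite -(integral_plaw muN mz mfw fw0) -muleA; congr (_ * _).
rewrite mulrC EFinM; congr (_ * _).
rewrite (avg1E (walk w m)).1; apply: eq_measure_integral => E mE _.
exact: zlaw.
Qed.

Let avg2w w : R := (\int[nuw w]_x f2 x)%R.
Let avg2wE w : (avg2w w)%:E = \int[nuw w]_x (f2 x)%:E /\ (0 <= avg2w w <= 1)%R.
Proof. exact: RintegralE01. Qed.
Let mavg2w : measurable_fun setT avg2w.
Proof.
apply/measurable_EFinP; rewrite (_ : _ \o _ = fun w => \int[nuw w]_x (f2 x)%:E).
  apply: measurable_integral_kernel => //; first exact/measurable_EFinP.
  by move=> x; rewrite lee_fin; have /andP[] := f2_01 x.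
by apply/funext => w /=; rewrite (avg2wE w).1.
Qed.

Let mul01 (a b : R) : (0 <= a <= 1)%R -> (0 <= b <= 1)%R -> (0 <= a * b <= 1)%R.
Proof. by move=> /andP[a0 a1] /andP[b0 b1]; rewrite mulr_ge0//= mulr_ile1. Qed.

Let one01 w : (0 <= (\1_C w : R) <= 1)%R.
Proof. by rewrite indicE; case: (w \in C); rewrite /= ?lexx ?ler01. Qed.

(** By [L_boundary] only the factor [avg2] varies with [m], and it converges to the integral against
    the conditional measure; bounded convergence applies. *)
Lemma joining_tests_boundary :
  {ae muN, forall w, (fun m => (\int[nu]_x f2 (act (walk w m) x))%R) @ \oo -->
    (\int[nuw w]_x f2 x)%R} ->
  L @ \oo --> \int[muN]_w (\1_C w * (f1 (z w) * avg2w w))%:E.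
Proof.
move=> cv2.
suff : (fun m => \int[muN]_w (\1_C w * (f1 (z w) * avg2 (walk w m)))%:E) @ \oo -->
    \int[muN]_w (\1_C w * (f1 (z w) * avg2w w))%:E.
  apply: cvg_trans; apply: near_eq_cvg; exists n => // m nm; transitivity (L m) => //; rewrite -(L_boundary nm).
apply: bounded_cvg_integral.
- move=> m; apply: measurable_funM; first exact: measurable_indic.
  apply: measurable_funM; first exact: measurableT_comp mf1 mz.
  exact: measurableT_comp mavg2 (mw m).
- apply: measurable_funM; first exact: measurable_indic.
  by apply: measurable_funM => //; exact: measurableT_comp mf1 mz.
- move=> m w; apply: mul01 => //; apply: mul01 => //.
  by have [] := avg2E (walk w m).
- apply: (ae_mp cv2) => w cw.
  have cw' : (fun m => avg2 (walk w m)) @ \oo --> avg2w w by exact: cw.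
  exact: (cvgM (cvg_cst _) (cvgM (cvg_cst _) cw')).
Qed.

Hypothesis cv1 : forall g, {ae muN, forall w, (fun m => (\int[beta]_b f1 (act g (act (walk w m) b)))%R) @ \oo -->
    (\int[betaw w]_b f1 (act g b))%R}.
Hypothesis cv2 : forall g, {ae muN, forall w, (fun m => (\int[nu]_x f2 (act g (act (walk w m) x)))%R) @ \oo -->
    (\int[nuw w]_x f2 (act g x))%R}.

Let joined g := \int[lambda]_y (f1 (act g y.1) * f2 (act g y.2))%:E.

Let joined_cvg g :
  (fun m => \int[muN]_w (avg1 (g * walk w m)%g * avg2 (g * walk w m)%g)%:E) @ \oo --> joined g.
Proof.
have mg1 : measurable_fun setT (fun b => f1 (act g b)).
  exact: measurableT_comp mf1 (measurable_act_at _).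
have mg2 : measurable_fun setT (fun x => f2 (act g x)).
  exact: measurableT_comp mf2 (measurable_act_at _).
have h1 w := RintegralE01 (betaw w) mg1 (fun b => f1_01 (act g b)).
have h2 w := RintegralE01 (nuw w) mg2 (fun x => f2_01 (act g x)).
have mRint (S : gspace G) (f : S -> R) (K : paths -> probability S R) : measurable_fun setT f ->
    (forall x, (0 <= f x <= 1)%R) ->
    (forall E, measurable E -> measurable_fun setT (K ^~ E)) ->
    measurable_fun setT (fun w => (\int[K w]_b f b)%R).
  move=> mf f01 mK; apply/measurable_EFinP.
  rewrite (_ : _ \o _ = fun w => \int[K w]_x (f x)%:E).
    apply: measurable_integral_kernel => //; first exact/measurable_EFinP.
    by move=> x; rewrite lee_fin; have /andP[] := f01 x.
  by apply/funext => w /=; rewrite (RintegralE01 (K w) mf f01).1.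
have -> : joined g = \int[muN]_w ((\int[betaw w]_b f1 (act g b))%R * (\int[nuw w]_x f2 (act g x))%R)%:E.
  pose K w : probability (B * X)%type R := (betaw w \x nuw w).
  rewrite /joined (mixture_integral (P := muN) (K := K)).
  - apply: eq_integral => w _; rewrite /K (integral_prod_mul _ _ mg1 mg2); last 2 first.
    + by move=> b; have /andP[] := f1_01 (act g b).
    + by move=> b; have /andP[] := f2_01 (act g b).
    by rewrite EFinM (h1 w).1 (h2 w).1.
  - by move=> E mE; exact: measurable_prod_kernel.
  - by move=> E mE; exact: lambdaE.
  - apply/measurable_EFinP; apply: measurable_funM.
      exact: measurableT_comp mg1 measurable_fst.
    exact: measurableT_comp mg2 measurable_snd.
  - move=> y; rewrite lee_fin mulr_ge0//; first by have /andP[] := f1_01 (act g y.1).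
    by have /andP[] := f2_01 (act g y.2).
apply: bounded_cvg_integral.
- move=> m; apply: measurable_funM; [apply: measurableT_comp mavg1 _|apply: measurableT_comp mavg2 _];
  exact: (measurableT_comp (measurable_mulg hG) (measurable_fun_pair (measurable_cst (g : borel G)) (mw m))).
- by apply: measurable_funM; exact: mRint.
- by move=> m w; apply: mul01; [have [] := avg1E (g * walk w m)%g|have [] := avg2E (g * walk w m)%g].
- apply: (ae_mp2 (cv1 g) (cv2 g)) => w c1 c2.
  have e1 : (fun m => avg1 (g * walk w m)%g) =
      fun m => (\int[beta]_b f1 (act g (act (walk w m) b)))%R.
    by apply/funext => m; apply: eq_Rintegral => b _; rewrite actM.
  have e2 : (fun m => avg2 (g * walk w m)%g) =
      fun m => (\int[nu]_x f2 (act g (act (walk w m) x)))%R.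
    by apply/funext => m; apply: eq_Rintegral => b _; rewrite actM.
  by rewrite -e1 in c1; rewrite -e2 in c2; exact: (cvgM c1 c2).
Qed.

(** The walk is cut at time [n]. With the first [n] steps fixed, the product of averages along the
    remaining steps converges in mean to the integral of the translated test against the joining,
    the average of products of conditional measures. *)
Lemma joining_tests_joined : L @ \oo --> \int[muN]_w ((\1_C w)%:E * joined (walk w n)).
Proof.
pose J g := (avg1 g * avg2 g)%R.
have mJ : measurable_fun setT J by exact: measurable_funM.
have J01 g : (0 <= J g <= 1)%R by apply: mul01; [have [] := avg1E g|have [] := avg2E g].
have mJm m (g : G) : measurable_fun setT (fun w : paths => J (g * walk w m)%g).
  apply: measurableT_comp mJ _.
  exact: (measurableT_comp (measurable_mulg hG) (measurable_fun_pair (measurable_cst (g : borel G)) (mw m))).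
pose h m (g : borel G) := (\int[muN]_w J (g * walk w m)%g)%R.
have hE m g := RintegralE01 muN (mJm m g) (fun w => J01 _).
have mh m : measurable_fun setT (h m).
  apply/measurable_EFinP.
  rewrite (_ : _ \o _ = fun g : borel G => \int[muN]_w (J (g * walk w m)%g)%:E).
    apply: (measurable_integral_fst muN
      (f := fun gw : borel G * paths => (J (gw.1 * walk gw.2 m)%g)%:E)).
      apply/measurable_EFinP; apply: measurableT_comp mJ _.
      exact: (measurableT_comp (measurable_mulg hG)
        (measurable_fun_pair measurable_fst (measurableT_comp (mw m) measurable_snd))).
    by move=> gw; rewrite lee_fin; have /andP[] := J01 (gw.1 * walk gw.2 m)%g.
  by apply/funext => g /=; rewrite (hE m g).1.
have joined01 g : (fine (joined g))%:E = joined g /\ (0 <= fine (joined g) <= 1)%R.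
  apply: RintegralE01.
    apply: measurable_funM.
      exact: measurableT_comp mf1 (measurableT_comp (measurable_act_at _) measurable_fst).
    exact: measurableT_comp mf2 (measurableT_comp (measurable_act_at _) measurable_snd).
  by move=> y; exact: mul01.
have Lh m : L (n + m)%N = \int[muN]_w (\1_C w * h m (walk w n))%:E.
  rewrite /L (integral_path_cat hmuN n); last 2 first.
  - apply: emeasurable_funM; first exact: measurable_EFin_indic.
    by apply/measurable_EFinP; exact: measurableT_comp mJ (mw (n + m)).
  - by move=> w; rewrite mule_ge0// lee_fin//; have /andP[] := J01 (walk w (n + m)).
  apply: eq_integral => w _; rewrite EFinM (hE m (walk w n)).1 -ge0_integralTZl.
  - apply: eq_integral => w' _; rewrite one_cat// walk_add walk_cat_prefix//.
    by rewrite path_shift_cat.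
  - by apply/measurable_EFinP; exact: mJm.
  - by move=> w'; rewrite lee_fin; have /andP[] := J01 (walk w n * walk w' m)%g.
  - by rewrite lee_fin; have /andP[] := one01 w.
have mjoined : measurable_fun setT (fun w : paths => fine (joined (walk w n))).
  apply: measurableT_comp => //.
  have mj : measurable_fun setT (joined : borel G -> \bar R).
    apply: (measurable_integral_fst lambda (f := fun gy : borel G * (B * X) =>
      (f1 (act (gy.1 : G) gy.2.1) * f2 (act (gy.1 : G) gy.2.2))%:E)).
      apply/measurable_EFinP; apply: measurable_funM.
        exact: (measurableT_comp mf1 (measurableT_comp (@measurable_act _ B)
          (measurable_fun_pair measurable_fst (measurableT_comp measurable_fst measurable_snd)))).
      exact: (measurableT_comp mf2 (measurableT_comp (@measurable_act _ X)
        (measurable_fun_pair measurable_fst (measurableT_comp measurable_snd measurable_snd)))).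
    by move=> y; rewrite lee_fin; have /andP[] := mul01 (f1_01 (act y.1 y.2.1)) (f2_01 (act y.1 y.2.2)).
  exact: measurableT_comp mj (mw n).
have -> : \int[muN]_w ((\1_C w)%:E * joined (walk w n)) =
    \int[muN]_w (\1_C w * fine (joined (walk w n)))%:E.
  by apply: eq_integral => w _; rewrite EFinM (joined01 _).1.
rewrite -(cvg_shiftn n).
have -> : (fun m => L (m + n)%N) = fun m => \int[muN]_w (\1_C w * h m (walk w n))%:E.
  by apply/funext => m; rewrite addnC Lh.
apply: bounded_cvg_integral.
- move=> m; apply: measurable_funM; first exact: measurable_indic.
  exact: measurableT_comp (mh m) (mw n).
- by apply: measurable_funM => //; exact: measurable_indic.
- by move=> m w; apply: mul01 => //; have [] := hE m (walk w n).
- apply: aeW => w; have := @joined_cvg (walk w n); rewrite -(joined01 (walk w n)).1.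
  rewrite (_ : (fun m => _) = fun m => (h m (walk w n))%:E); last first.
    by apply/funext => m; rewrite (hE m (walk w n)).1.
  move=> /fine_cvgP[_ c]; exact: (cvgM (cvg_cst _) c).
Qed.

End tests.
End joining_tests.

Section joining_walk.
Local Open Scope ereal_scope.
Context (R : realType) (k : nat) (Gs : 'I_k -> topGroupType) (hG : forall i, lcsc (Gs i)).
Local Notation G := (prod_group Gs).
Local Notation paths := (prodm (fun _ : nat => borel G)).
Variables (mu : probability (borel G) R) (muN : probability paths R).
Hypothesis hmuN : is_iid_law mu muN.
Variables (B : gspace G) (beta : probability B R) (X : gspace G) (nu : probability X R).
Hypotheses (sB : standard_borel R B) (sX : standard_borel R X).
Variables (betaw : paths -> probability B R) (nuw : paths -> probability X R).
Hypotheses (hbetaw : conditional_measures muN beta betaw)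
  (hnuw : conditional_measures muN nu nuw).
Variable lambda : probability (gspace_prod B X) R.
Hypothesis lambdaE : forall C : set (B * X), measurable C ->
  lambda C = \int[muN]_w (betaw w \x nuw w) C.
Hypothesis lambdaX : forall E : set X, measurable E -> lambda (setT `*` E) = nu E.
Variable z : paths -> B.
Hypotheses (mz : measurable_fun setT z)
  (zlaw : forall E, measurable E -> muN (z @^-1` E) = beta E)
  (zshift : forall n, {ae muN, forall w, z w = act (walk w n) (z (path_shift n w))}).

Let mnuw : forall E, measurable E -> measurable_fun setT (nuw ^~ E) := hnuw.1.

(** Increments together with a point of [X] drawn from the conditional measure of the path. *)
Definition joint_paths : probability (paths * X)%type R := joint_law muN mnuw.

Variables (U : nat -> set (borel G)) (n : nat).
Hypothesis mU : forall i, measurable (U i).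
Let C := path_cyl U n.
Let mC : measurable C. Proof. exact: measurable_path_cyl. Qed.

Let q (v : paths * X) : B * X := (z v.1, v.2).
Let q' (v : paths * (B * X)) : B * X := (act (walk v.1 n) v.2.1, act (walk v.1 n) v.2.2).

Let mq : measurable_fun setT q.
Proof. exact: (measurable_fun_pair (measurableT_comp mz measurable_fst) measurable_snd). Qed.

Let mq' : measurable_fun setT q'.
Proof.
have mw : measurable_fun setT (fun v : paths * (B * X) => walk v.1 n : borel G).
  exact: (measurableT_comp (measurable_walk hG n) measurable_fst).
apply: measurable_fun_pair.
  exact: (measurableT_comp (@measurable_act _ B)
    (measurable_fun_pair mw (measurableT_comp measurable_fst measurable_snd))).
exact: (measurableT_comp (@measurable_act _ X)
  (measurable_fun_pair mw (measurableT_comp measurable_snd measurable_snd))).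
Qed.

Let one (w : paths) : R := \1_C w.
Let mone : measurable_fun setT one. Proof. exact: measurable_indic. Qed.
Let one01 w : (0 <= one w <= 1)%R.
Proof. by rewrite /one indicE; case: (w \in C); rewrite /= ?lexx ?ler01. Qed.
Let one0 w : (0 <= one w)%R. Proof. by have /andP[] := one01 w. Qed.

Let P2 : probability (paths * (B * X))%type R := (muN \x lambda).

Let agree (F : B * X -> R) := \int[joint_paths]_v (one v.1 * F (q v))%:E =
  \int[P2]_v (one v.1 * F (q' v))%:E.

Let mF1 (F : B * X -> R) : measurable_fun setT F ->
  measurable_fun setT (fun v : paths * X => one v.1 * F (q v))%R.
Proof.
move=> mF; apply: measurable_funM; first exact: measurableT_comp mone measurable_fst.
exact: measurableT_comp mF mq.
Qed.

Let mF2 (F : B * X -> R) : measurable_fun setT F ->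
  measurable_fun setT (fun v : paths * (B * X) => one v.1 * F (q' v))%R.
Proof.
move=> mF; apply: measurable_funM; first exact: measurableT_comp mone measurable_fst.
exact: measurableT_comp mF mq'.
Qed.

Let agree_tests (f1 : B -> R) (f2 : X -> R) :
  measurable_fun setT f1 -> measurable_fun setT f2 ->
  (forall b, 0 <= f1 b <= 1)%R -> (forall x, 0 <= f2 x <= 1)%R ->
  {ae muN, forall w, (fun m => (\int[nu]_x f2 (act (walk w m) x))%R) @ \oo -->
    (\int[nuw w]_x f2 x)%R} ->
  (forall g, {ae muN, forall w, (fun m => (\int[beta]_b f1 (act g (act (walk w m) b)))%R) @ \oo -->
    (\int[betaw w]_b f1 (act g b))%R}) ->
  (forall g, {ae muN, forall w, (fun m => (\int[nu]_x f2 (act g (act (walk w m) x)))%R) @ \oo -->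
    (\int[nuw w]_x f2 (act g x))%R}) ->
  agree (fun y => f1 y.1 * f2 y.2)%R.
Proof.
move=> mf1 mf2 f1_01 f2_01 c0 c1 c2.
have mF : measurable_fun setT (fun y : B * X => f1 y.1 * f2 y.2)%R.
  apply: measurable_funM; first exact: measurableT_comp mf1 measurable_fst.
  exact: measurableT_comp mf2 measurable_snd.
have F0 y : (0 <= f1 y.1 * f2 y.2)%R.
  by rewrite mulr_ge0//; [have /andP[] := f1_01 y.1|have /andP[] := f2_01 y.2].
have h1 := joining_tests_boundary hG hmuN mnuw mz zlaw zshift mf1 mf2 f1_01 f2_01 mU (n := n) c0.
have h2 := joining_tests_joined hG hmuN hbetaw.1 mnuw lambdaE mf1 mf2 f1_01 f2_01 mU (n := n) c1 c2.
have E := cvg_unique (@ereal_hausdorff R) h1 h2.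
rewrite /agree (@integral_joint_law _ _ _ _ _ muN nuw mnuw (fun v => (one v.1 * (f1 (q v).1 * f2 (q v).2))%:E)); last 2 first.
- by apply/measurable_EFinP; exact: (mF1 mF).
- by move=> v; rewrite lee_fin mulr_ge0// (F0 (q v)).
rewrite /P2 fubini_tonelli1; last 2 first.
- by apply/measurable_EFinP; exact: (mF2 mF).
- by move=> v; rewrite lee_fin mulr_ge0// (F0 (q' v)).
transitivity (\int[muN]_w (\1_C w * (f1 (z w) * (\int[nuw w]_x f2 x)%R))%:E).
  apply: eq_integral => w _; rewrite mulrA EFinM (RintegralE01 (nuw w) mf2 f2_01).1.
  rewrite -ge0_integralTZl.
  - by apply: eq_integral => x _; rewrite -EFinM /q /= mulrA.
  - exact/measurable_EFinP.
  - by move=> x; rewrite lee_fin; have /andP[] := f2_01 x.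
  - by rewrite lee_fin mulr_ge0//; have /andP[] := f1_01 (z w).
rewrite E; apply: eq_integral => w _; rewrite /fubini_F /=.
rewrite -ge0_integralTZl.
- by apply: eq_integral => y _; rewrite -EFinM.
- apply/measurable_EFinP; apply: measurable_funM.
    exact: measurableT_comp mf1 (measurableT_comp (measurable_act_at _) measurable_fst).
  exact: measurableT_comp mf2 (measurableT_comp (measurable_act_at _) measurable_snd).
- by move=> y; rewrite lee_fin (F0 (act (walk w n) y.1, act (walk w n) y.2)).
- by rewrite lee_fin.
Qed.

Let agree_lim (F_ : nat -> B * X -> R) (F : B * X -> R) :
  (forall m, measurable_fun setT (F_ m)) -> measurable_fun setT F ->
  (forall m y, (0 <= F_ m y <= 1)%R) ->
  (forall y, \forall m \near \oo, F_ m y = F y) ->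
  (forall m, agree (F_ m)) -> agree F.
Proof.
move=> mF_ mF F01 FF aF.
have m01 (a b : R) : (0 <= a <= 1)%R -> (0 <= b <= 1)%R -> (0 <= a * b <= 1)%R.
  by move=> /andP[a0 a1] /andP[b0 b1]; rewrite mulr_ge0//= mulr_ile1.
have c1 : (fun m => \int[joint_paths]_v (one v.1 * F_ m (q v))%:E) @ \oo -->
    \int[joint_paths]_v (one v.1 * F (q v))%:E.
  apply: bounded_cvg_integral.
  - by move=> m; exact: mF1.
  - exact: mF1.
  - by move=> m v; exact: m01.
  - apply: aeW => v; apply: cvg_near_cst; apply: filterS (FF (q v)) => m Fm.
    by rewrite Fm.
have c2 : (fun m => \int[P2]_v (one v.1 * F_ m (q' v))%:E) @ \oo -->
    \int[P2]_v (one v.1 * F (q' v))%:E.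
  apply: bounded_cvg_integral.
  - by move=> m; exact: mF2.
  - exact: mF2.
  - by move=> m v; exact: m01.
  - apply: aeW => v; apply: cvg_near_cst; apply: filterS (FF (q' v)) => m Fm.
    by rewrite Fm.
have e12 : (fun m => \int[joint_paths]_v (one v.1 * F_ m (q v))%:E) =
    (fun m => \int[P2]_v (one v.1 * F_ m (q' v))%:E).
  by apply/funext => m; exact: aF.
by rewrite e12 in c1; exact: (cvg_unique (@ereal_hausdorff R) c1 c2).
Qed.

Let M1 (D : set (B * X)) := \int[joint_paths]_v ((one v.1)%:E * (\1_D (q v))%:E).
Let M2 (D : set (B * X)) := \int[P2]_v ((one v.1)%:E * (\1_D (q' v))%:E).

Let MT : M1 setT = \int[joint_paths]_v (one v.1)%:E /\ M2 setT = \int[P2]_v (one v.1)%:E.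
Proof. by split; apply: eq_integral => v _; rewrite indicT mule1. Qed.

(** The rectangles of test sets form a pi-system, so agreement extends to the sigma-algebra they
    generate, which may be smaller than the full product one. *)
Let agree_rect (OB : set (set B)) (OX : set (set X)) :
  OB setT /\ setI_closed OB -> OX setT /\ setI_closed OX ->
  (forall E, OB E -> measurable E) -> (forall E, OX E -> measurable E) ->
  (forall E1 E2, OB E1 -> OX E2 -> agree (fun y => \1_E1 y.1 * \1_E2 y.2)%R) ->
  forall D, <<s [set E1 `*` E2 | E1 in OB & E2 in OX] >> D -> M1 D = M2 D.
Proof.
move=> [OBT OBI] [OXT OXI] mOB mOX ag.
set G0 := [set E1 `*` E2 | E1 in OB & E2 in OX].
pose W := g_sigma_algebraType G0.
have G0m D : G0 D -> measurable D.
  by move=> [E1 /mOB m1 [E2 /mOX m2 <-]]; exact: measurableX.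
have toW d (T : measurableType d) (f : T -> B * X) : measurable_fun setT f ->
    measurable_fun setT (f : T -> W).
  move=> mf; apply: (@measurability _ _ _ W _ _ G0) => // _ [D GD <-].
  by rewrite setTI; apply: measurable_pre mf _; exact: G0m.
have GE E1 E2 : OB E1 -> OX E2 -> M1 (E1 `*` E2) = M2 (E1 `*` E2).
  move=> O1 O2; have := ag _ _ O1 O2; rewrite /agree /M1 /M2.
  have e (y : B * X) : (\1_(E1 `*` E2) y = \1_E1 y.1 * \1_E2 y.2 :> R)%R.
    by rewrite !indicE -natrM mulnb; congr (_%:R); congr nat_of_bool;
      apply/idP/andP; rewrite !inE.
  by move=> h; under eq_integral do rewrite e -EFinM; under [RHS]eq_integral do rewrite e -EFinM.
move=> D; apply: (@density_unique R _ _ _ _ _ W joint_paths P2 q q'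
    (fun v => (one v.1)%:E) (fun v => (one v.1)%:E) G0).
- exact: toW.
- exact: toW.
- by apply/measurable_EFinP; exact: measurableT_comp mone measurable_fst.
- by apply/measurable_EFinP; exact: measurableT_comp mone measurable_fst.
- by move=> v; rewrite lee_fin.
- by move=> v; rewrite lee_fin.
- apply: le_lt_trans (_ : \int[joint_paths]_v cst 1 v < _).
    apply: ge0_le_integral => //.
    + by move=> v _; rewrite lee_fin.
    + by apply/measurable_EFinP; exact: measurableT_comp mone measurable_fst.
    + by move=> v _; rewrite lee_fin; have /andP[] := one01 v.1.
  by rewrite integral_cst// [X in _ * X]probability_setT mule1 ltry.
- by [].
- move=> _ _ [A OA [A' OA' <-]] [A2 OA2 [A2' OA2' <-]].
  by exists (A `&` A2); [exact: OBI|exists (A' `&` A2'); [exact: OXI|rewrite setXI]].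
- by rewrite -MT.1 -MT.2 -setXTT; exact: GE.
- by move=> _ [E1 O1 [E2 O2 <-]]; exact: GE.
Qed.

Let off_null d (T : measurableType d) (P : probability T R) (u : T -> R) (f : T -> B * X)
    (N D D' : set (B * X)) :
  measurable_fun setT u -> (forall t, 0 <= u t)%R -> measurable_fun setT f ->
  measurable N -> measurable D -> measurable D' ->
  \int[P]_t ((u t)%:E * (\1_N (f t))%:E) = 0 -> (forall y, ~ N y -> D y <-> D' y) ->
  \int[P]_t ((u t)%:E * (\1_D (f t))%:E) = \int[P]_t ((u t)%:E * (\1_D' (f t))%:E).
Proof.
move=> mu_ u0 mf mN mD mD' N0 DD'.
have muE : measurable_fun setT (fun t => (u t)%:E) by exact/measurable_EFinP.
have m1 E : measurable E -> measurable_fun setT (fun t => (u t)%:E * (\1_E (f t))%:E).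
  by move=> mE; exact: ge0_measurable_mul_indic.
have p0 (E : set (B * X)) t : 0 <= (u t)%:E * (\1_E (f t))%:E by rewrite mule_ge0// lee_fin.
have ae0 := ge0_integral_eq0_ae (m1 _ mN) (p0 N) N0.
apply: ge0_ae_eq_integral => //; do ?exact: m1.
apply: (ae_mp ae0) => t ut _; have [Nt|Nt] := pselect (N (f t)).
  by move: ut; rewrite indicE mem_set// mule1 => ->; rewrite !mul0e.
congr (_ * _); congr EFin; rewrite !indicE; congr (_%:R); congr nat_of_bool.
by apply/idP/idP; rewrite !inE => /DD'; exact.
Qed.

(** Under [joint_paths] the boundary point has law [beta] and, by [lambdaX], the point of [X] has
    law [nu]. *)
Let M1_null (Y1 : set B) (Y2 : set X) : measurable Y1 -> measurable Y2 ->
  beta Y1 = 1 -> nu Y2 = 1 -> M1 (~` (Y1 `*` Y2)) = 0.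
Proof.
move=> mY1 mY2 Y11 Y21.
have mc1 := measurableC mY1; have mc2 := measurableC mY2.
pose a (v : paths * X) := (\1_(~` Y1) (z v.1))%:E : \bar R.
pose b (v : paths * X) := (\1_(~` Y2) v.2)%:E : \bar R.
have ma : measurable_fun setT a.
  exact: measurableT_comp (measurable_indic_comp mz mc1) measurable_fst.
have mb : measurable_fun setT b.
  exact: measurableT_comp (measurable_EFin_indic mc2) measurable_snd.
have a0 v : 0 <= a v by rewrite lee_fin.
have b0 v : 0 <= b v by rewrite lee_fin.
have ia : \int[joint_paths]_v a v = 0.
  rewrite (integral_joint_law muN mnuw ma a0).
  transitivity (\int[muN]_w (\1_(~` Y1) (z w))%:E).
    apply: eq_integral => w _; rewrite /a /= integral_cst//.
    by rewrite [X in _ * X]probability_setT mule1.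
  apply: (etrans (integral_indic_pre muN mz mc1)); apply: (etrans (zlaw mc1)).
  exact: prob1_setC.
have ib : \int[joint_paths]_v b v = 0.
  rewrite (integral_joint_law muN mnuw mb b0).
  transitivity (lambda (setT `*` ~` Y2)); last by rewrite lambdaX// prob1_setC.
  rewrite lambdaE; last exact: measurableX.
  apply: eq_integral => w _; rewrite /b /= integral_setT_indic//.
  by rewrite prod_probE// [X in X * _]probability_setT mul1e.
have ab0 : \int[joint_paths]_v (a v + b v) = 0 by rewrite ge0_integralTD// ia ib adde0.
apply/eqP; rewrite eq_le; apply/andP; split; last first.
  by apply: integral_ge0 => v _; rewrite mule_ge0// lee_fin.
rewrite -ab0; apply: ge0_le_integral => //.
- by move=> v _; rewrite mule_ge0// lee_fin.
- apply: ge0_measurable_mul_indic => //.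
    by apply: measurableC; exact: measurableX.
  by apply/measurable_EFinP; exact: measurableT_comp mone measurable_fst.
- exact: emeasurable_funD.
- move=> v _; rewrite /a /b !indicE -EFinM -EFinD lee_fin.
  have /andP[c0 c1] := one01 v.1.
  have [y1|y1] := boolP (z v.1 \in ~` Y1).
    by rewrite (le_trans _ (_ : 1 <= _)%R)//; [case: (_ \in _); rewrite ?mulr1 ?mulr0|rewrite lerDl].
  have [y2|y2] := boolP (v.2 \in ~` Y2).
    by rewrite (le_trans _ (_ : 1 <= _)%R)//; [case: (_ \in _); rewrite ?mulr1 ?mulr0|rewrite add0r].
  rewrite memNset ?mulr0 ?addr0//; apply; split => /=.
    by move: y1; rewrite notin_setE /= => /contrapT.
  by move: y2; rewrite notin_setE /= => /contrapT.
Qed.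

Let agree_measurable D : measurable D -> M1 D = M2 D.
Proof.
have [TB [TBm TBact TBcv [OB [OBI OBE [OsB [OsBO OsBsep]]]]]] := conditional_measures_model hbetaw.
have [TX [TXm TXact TXcv [OX [OXI OXE [OsX [OsXO OsXsep]]]]]] := conditional_measures_model hnuw.
have ag E1 E2 : OB E1 -> OX E2 -> agree (fun y => \1_E1 y.1 * \1_E2 y.2)%R.
  move=> O1 O2; have [mE1 [f1 [f1T _ f1E]]] := OBE _ O1.
  have [mE2 [f2 [f2T _ f2E]]] := OXE _ O2.
  apply: (agree_lim (F_ := fun m y => f1 m y.1 * f2 m y.2)%R).
  - move=> m; apply: measurable_funM.
      exact: measurableT_comp (TBm _ (f1T m)).1 measurable_fst.
    exact: measurableT_comp (TXm _ (f2T m)).1 measurable_snd.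
  - apply: measurable_funM.
      exact: measurableT_comp (measurable_indic mE1) measurable_fst.
    exact: measurableT_comp (measurable_indic mE2) measurable_snd.
  - move=> m y; have [_ /(_ y.1)/andP[a0 a1]] := TBm _ (f1T m).
    by have [_ /(_ y.2)/andP[b0 b1]] := TXm _ (f2T m); rewrite mulr_ge0//= mulr_ile1.
  - move=> y; apply: filterS2 (f1E y.1) (f2E y.2) => m -> ->//.
  move=> m; have [mf1 f1_01] := TBm _ (f1T m); have [mf2 f2_01] := TXm _ (f2T m).
  apply: agree_tests => //.
  - by apply: (ae_mp TXcv) => w /(_ _ (f2T m)).
  - by move=> g; apply: (ae_mp TBcv) => w /(_ _ (TBact _ g (f1T m))).
  - by move=> g; apply: (ae_mp TXcv) => w /(_ _ (TXact _ g (f2T m))).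
have sig := agree_rect OBI OXI (fun E OE => (OBE E OE).1) (fun E OE => (OXE E OE).1) ag.
set G0 := [set E1 `*` E2 | E1 in OB & E2 in OX] in sig.
have sigB E : <<s range OsB >> E -> <<s G0 >> (E `*` setT).
  have h : measurable_fun [set: g_sigma_algebraType G0] (fst : g_sigma_algebraType G0 -> g_sigma_algebraType (range OsB)).
    apply: (@measurability _ _ _ (g_sigma_algebraType (range OsB)) _ _ (range OsB)) => //.
    move=> _ [_ [i _ <-] <-]; rewrite setTI; apply: sub_sigma_algebra.
    exists (OsB i) => //; exists setT; first exact: OXI.1.
    by apply/seteqP; split => y //= -[].
  move=> sE; have := measurable_pre h sE.
  by congr (<<s _ >> _); apply/seteqP; split => y //= -[].
have sigX E : <<s range OsX >> E -> <<s G0 >> (setT `*` E).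
  have h : measurable_fun [set: g_sigma_algebraType G0] (snd : g_sigma_algebraType G0 -> g_sigma_algebraType (range OsX)).
    apply: (@measurability _ _ _ (g_sigma_algebraType (range OsX)) _ _ (range OsX)) => //.
    move=> _ [_ [i _ <-] <-]; rewrite setTI; apply: sub_sigma_algebra.
    exists setT; first exact: OBI.1; exists (OsX i) => //.
    by apply/seteqP; split => y //= -[].
  move=> sE; have := measurable_pre h sE.
  by congr (<<s _ >> _); apply/seteqP; split => y //= -[].
have sigBX E1 E2 : <<s range OsB >> E1 -> <<s range OsX >> E2 -> <<s G0 >> (E1 `*` E2).
  move=> /sigB s1 /sigX s2; rewrite -(setTI E2) -(setIT E1) setXI.
  exact: (@measurableI _ (g_sigma_algebraType G0)).
have mOsB i : measurable (OsB i) by exact: (OBE _ (OsBO i)).1.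
have mOsX i : measurable (OsX i) by exact: (OXE _ (OsXO i)).1.
(* Test sets separate points, so on conull sets they generate the Borel sets; this bridges the gap
   between [<<s G0 >>] and all measurable sets. *)
have [Y1 [sY1 Y11 Y1E]] := separating_generates beta sB mOsB OsBsep.
have [Y2 [sY2 Y21 Y2E]] := separating_generates nu sX mOsX OsXsep.
have mgenB E : <<s range OsB >> E -> measurable E.
  by apply: smallest_sub; [exact: sigma_algebra_measurable|move=> _ [i _ <-]].
have mgenX E : <<s range OsX >> E -> measurable E.
  by apply: smallest_sub; [exact: sigma_algebra_measurable|move=> _ [i _ <-]].
have mN : measurable (~` (Y1 `*` Y2)).
  by apply: measurableC; apply: measurableX; [exact: mgenB|exact: mgenX].
have N1 : M1 (~` (Y1 `*` Y2)) = 0.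
  by apply: M1_null => //; [exact: mgenB|exact: mgenX].
(* The exceptional set itself belongs to [<<s G0 >>], where [M1] and [M2] already agree. *)
have N2 : M2 (~` (Y1 `*` Y2)) = 0.
  rewrite -sig//; apply: (@measurableC _ (g_sigma_algebraType G0)); exact: sigBX.
have mo1 : measurable_fun setT (fun v : paths * X => one v.1).
  exact: measurableT_comp mone measurable_fst.
have mo2 : measurable_fun setT (fun v : paths * (B * X) => one v.1).
  exact: measurableT_comp mone measurable_fst.
apply: (@density_unique R _ _ _ _ _ (B * X)%type joint_paths P2 q q'
    (fun v => (one v.1)%:E) (fun v => (one v.1)%:E) (@rectangles _ B _ X)) => //.
- exact/measurable_EFinP.
- exact/measurable_EFinP.
- by move=> v; rewrite lee_fin.
- by move=> v; rewrite lee_fin.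
- apply: le_lt_trans (_ : \int[joint_paths]_v cst 1 v < _).
    apply: ge0_le_integral => //.
    + by move=> v _; rewrite lee_fin.
    + exact/measurable_EFinP.
    + by move=> v _; rewrite lee_fin; have /andP[] := one01 v.1.
  by rewrite integral_cst// [X in _ * X]probability_setT mule1 ltry.
- exact: measurable_rectangles.
- exact: rectanglesI.
- by rewrite -MT.1 -MT.2; exact: sig (@measurableT _ (g_sigma_algebraType G0)).
move=> _ [E1 mE1 [E2 mE2 <-]].
have [E1' sE1 E1E] := Y1E _ mE1; have [E2' sE2 E2E] := Y2E _ mE2.
have mE1' := mgenB _ sE1; have mE2' := mgenX _ sE2.
have DD' y : ~ (~` (Y1 `*` Y2)) y -> (E1 `*` E2) y <-> (E1' `*` E2') y.
  move=> /contrapT[Yy1 Yy2]; move/seteqP: E1E => [a1 a2]; move/seteqP: E2E => [b1 b2].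
  split=> -[/= e1 e2].
    by split; [have [] := a1 _ (conj e1 Yy1)|have [] := b1 _ (conj e2 Yy2)].
  by split; [have [] := a2 _ (conj e1 Yy1)|have [] := b2 _ (conj e2 Yy2)].
rewrite (off_null mo1 (fun v => one0 v.1) mq mN _ _ N1 DD'); [|exact: measurableX|exact: measurableX].
rewrite [RHS](off_null mo2 (fun v => one0 v.1) mq' mN _ _ N2 DD'); [|exact: measurableX|exact: measurableX].
by apply: sig; exact: sigBX.
Qed.

(** Under [joint_paths], given the first [n] increments, the pair of boundary point and point of [X]
    has the law of the joining translated by the position of the walk. *)
Lemma joining_walk (F : B * X -> \bar R) : measurable_fun setT F -> (forall y, 0 <= F y) ->
  \int[joint_paths]_v ((\1_C v.1)%:E * F (z v.1, v.2)) =
  \int[muN]_w ((\1_C w)%:E * \int[lambda]_y F (act (walk w n) y.1, act (walk w n) y.2)).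
Proof.
move=> mF F0.
have mo1 : measurable_fun setT (fun v : paths * X => (one v.1)%:E).
  by apply/measurable_EFinP; exact: measurableT_comp mone measurable_fst.
have mo2 : measurable_fun setT (fun v : paths * (B * X) => (one v.1)%:E).
  by apply/measurable_EFinP; exact: measurableT_comp mone measurable_fst.
have o1 (v : paths * X) : 0 <= (one v.1)%:E by rewrite lee_fin.
have o2 (v : paths * (B * X)) : 0 <= (one v.1)%:E by rewrite lee_fin.
rewrite (density_integral mq mq' mo1 mo2 o1 o2 agree_measurable mF F0).
rewrite fubini_tonelli1; last 2 first.
- by apply: emeasurable_funM => //; exact: measurableT_comp mF mq'.
- by move=> v; rewrite mule_ge0.
have mFw w : measurable_fun setT (fun y => F (q' (w, y))).
  exact: measurableT_comp mF (measurableT_comp mq' (pair1_measurable w)).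
apply: eq_integral => w _.
have c0 : 0 <= (one w)%:E by rewrite lee_fin.
exact: (ge0_integralTZl lambda (mFw w) (fun y => F0 _) c0).
Qed.

End joining_walk.

(** * Factors of the joining realized on path space *)

Section laws.
Local Open Scope ereal_scope.
Context (R : realType).

Lemma integral_law d (T : measurableType d) d' (S : measurableType d')
    (P : probability T R) (Q : probability S R) (q : T -> S) (f : S -> \bar R) :
  measurable_fun setT q -> (forall E, measurable E -> P (q @^-1` E) = Q E) ->
  measurable_fun setT f -> (forall x, 0 <= f x) -> \int[P]_x f (q x) = \int[Q]_x f x.
Proof.
move=> mq PQ mf f0; rewrite -(integral_plaw P mq mf f0).
by apply: eq_measure_integral => E mE _; exact: PQ.
Qed.

Lemma ae_law d (T : measurableType d) d' (S : measurableType d')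
    (P : probability T R) (Q : probability S R) (q : T -> S) (D : S -> Prop) :
  measurable_fun setT q -> (forall E, measurable E -> P (q @^-1` E) = Q E) ->
  {ae Q, forall y, D y} -> {ae P, forall x, D (q x)}.
Proof.
move=> mq PQ [N [mN N0 sN]]; exists (q @^-1` N); split.
- exact: measurable_pre.
- exact: etrans (PQ _ mN) N0.
- by move=> x nD; exact: sN.
Qed.

Lemma integral_ae_eq_ge0 d (T : measurableType d) (P : probability T R) (f g : T -> \bar R) :
  measurable_fun setT f -> measurable_fun setT g ->
  (forall x, 0 <= f x) -> (forall x, 0 <= g x) -> {ae P, forall x, f x = g x} ->
  \int[P]_x f x = \int[P]_x g x.
Proof.
move=> mf mg f0 g0 fg; apply: ge0_ae_eq_integral => //.
by apply: (ae_mp fg) => x fgx _.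
Qed.

End laws.

Section factor_paths.
Local Open Scope ereal_scope.
Context (R : realType) (k : nat) (Gs : 'I_k -> topGroupType) (hG : forall i, lcsc (Gs i)).
Local Notation G := (prod_group Gs).
Local Notation paths := (prodm (fun _ : nat => borel G)).
Variables (mu : probability (borel G) R) (muN : probability paths R).
Hypothesis hmuN : is_iid_law mu muN.
Variables (X : gspace G) (nu : probability X R) (A : gspace G) (alpha : probability A R).
Variable rho : A -> X.

(* A is realized on paths * X: the fibre of Lam over a path w is the conditional
   measure of nu, and Phi sends (w, x) to the image of (bnd w, x). *)
Definition path_factor (Lam : probability (paths * X)%type R) (Phi : paths * X -> A) :=
  [/\ measurable_fun setT Phi,
    forall (U : nat -> set (borel G)) n (F : A -> \bar R), (forall i, measurable (U i)) ->
      measurable_fun setT F -> (forall a, 0 <= F a) ->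
      \int[Lam]_v ((\1_(path_cyl U n) v.1)%:E * F (Phi v)) =
      \int[muN]_w ((\1_(path_cyl U n) w)%:E * \int[alpha]_a F (act (walk w n) a)) &
    {ae Lam, forall v, rho (Phi v) = v.2}].

(** [Lam] is [joint_paths] and [Phi] sends [(w, x)] to [phi (z w, x)]; [joining_walk] and almost
    equivariance of [phi] give the conditional laws. *)
Lemma path_factor_of_joining (B : gspace G) (beta : probability B R)
    (lambda : probability (gspace_prod B X) R) (phi : gspace_prod B X -> A) :
  standard_borel R X -> poisson_boundary mu muN beta ->
  stationary_joining muN beta nu lambda ->
  gmap lambda alpha phi -> gmap alpha nu rho ->
  {ae lambda, forall z, rho (phi z) = z.2} ->
  exists Lam Phi, path_factor Lam Phi.
Proof.
move=> sX hB [betaw [nuw [hb hn lambdaE]]] [mphi phiact phiE] [mrho _ rhoE] hcomp.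
have [[sB _ _] _] := hB.
have [z [mz zlaw zshift]] := poisson_boundary_map hG hmuN hB.
(* The second marginal of the joining is read off from the composite of [phi] and [rho]. *)
have lambdaX (E : set X) : measurable E -> lambda (setT `*` E) = nu E.
  move=> mE; have mrE : measurable (rho @^-1` E) by exact: measurable_pre.
  rewrite -rhoE// -phiE//; apply: ae_measure_eq.
  - exact: measurableX.
  - exact: measurable_pre.
  - by apply: (ae_mp hcomp) => y /= ->; split => [[]|].
have jw := joining_walk hG hmuN sB sX hb hn lambdaE lambdaX mz zlaw zshift.
exists (joint_paths hn), (fun v => phi (z v.1, v.2)); split.
- exact: (measurableT_comp mphi (measurable_fun_pair (measurableT_comp mz measurable_fst) measurable_snd)).
- move=> U n F mU mF F0.
  have mFphi : measurable_fun setT (fun y => F (phi y)) by exact: measurableT_comp mF mphi.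
  rewrite (jw U n mU (fun y => F (phi y)) mFphi (fun y => F0 _)).
  apply: eq_integral => w _; congr (_ * _).
  have mFa : measurable_fun setT (fun a => F (act (walk w n) a)).
    exact: measurableT_comp mF (measurable_act_at _).
  rewrite -(integral_law mphi phiE mFa (fun a => F0 _)).
  apply: integral_ae_eq_ge0 => //.
  + exact: (measurableT_comp mFphi (@measurable_act_at _ (gspace_prod B X) (walk w n))).
  + exact: measurableT_comp mFa mphi.
  + by apply: (ae_mp (phiact (walk w n))) => y <-.
(* The identity [rho (phi y) = y.2] is carried from [lambda] to path space by [joining_walk] at
   depth 0. *)
pose bad := ~` [set y : B * X | rho (phi y) = y.2].
have mbad : measurable bad.
  apply: measurableC; apply: (measurable_standard_eq sX) => //.
  exact: measurableT_comp mrho mphi.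
have bad0 : lambda bad = 0 by apply: measure_negligible.
have mb1 : measurable_fun setT (fun v : paths * X => (\1_bad (z v.1, v.2))%:E : \bar R).
  exact: (measurableT_comp (measurable_EFin_indic mbad)
    (measurable_fun_pair (measurableT_comp mz measurable_fst) measurable_snd)).
have i0 : \int[joint_paths hn]_v (\1_bad (z v.1, v.2))%:E = 0.
  have := jw (fun=> setT) 0%N (fun=> measurableT) (fun y => (\1_bad y)%:E)
    (measurable_EFin_indic mbad) (fun y => _).
  have CT : path_cyl (fun=> setT) 0 = [set: paths] by apply/seteqP; split.
  rewrite CT => H; transitivity (\int[joint_paths hn]_v ((\1_[set: paths] v.1)%:E * (\1_bad (z v.1, v.2))%:E)).
    by apply: eq_integral => v _; rewrite indicT mul1e.
  rewrite {}H; last by move=> y; rewrite lee_fin.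
  rewrite integral0_eq// => w _; rewrite indicT mul1e -[RHS]bad0 -integral_setT_indic//.
  by apply: eq_integral => y _; rewrite /= !act1; case: y.
have b0 (v : paths * X) : 0 <= (\1_bad (z v.1, v.2))%:E :> \bar R by rewrite lee_fin.
apply: (ae_mp (ge0_integral_eq0_ae mb1 b0 i0)) => v /eqP; rewrite indicE eqe.
have [|nb _] := boolP (_ \in bad); first by rewrite /= oner_eq0.
by move: nb; rewrite notin_setE => /contrapT.
Qed.

Variables (Lam : probability (paths * X)%type R) (Phi : paths * X -> A).
Hypothesis hPhi : path_factor Lam Phi.
Hypothesis mrho : measurable_fun setT rho.

Let mPhi : measurable_fun setT Phi. Proof. by case: hPhi. Qed.

Lemma path_factor_integral U n (F : A -> \bar R) (D : X -> \bar R) :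
  (forall i, measurable (U i)) ->
  measurable_fun setT F -> (forall a, 0 <= F a) ->
  measurable_fun setT D -> (forall x, 0 <= D x) ->
  \int[Lam]_v ((\1_(path_cyl U n) v.1)%:E * (F (Phi v) * D v.2)) =
  \int[muN]_w ((\1_(path_cyl U n) w)%:E *
    \int[alpha]_a (F (act (walk w n) a) * D (rho (act (walk w n) a)))).
Proof.
move=> mU mF F0 mD D0; have [_ S1 S2] := hPhi.
have mDr : measurable_fun setT (fun a => D (rho a)) by exact: measurableT_comp mD mrho.
have m1 : measurable_fun setT (fun v : paths * X => (\1_(path_cyl U n) v.1)%:E : \bar R).
  exact: (measurableT_comp (measurable_EFin_indic (measurable_path_cyl n mU)) measurable_fst).
rewrite -(S1 U n (fun a => F a * D (rho a)) mU); last 2 first.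
- exact: emeasurable_funM.
- by move=> a; rewrite mule_ge0.
apply: integral_ae_eq_ge0.
- apply: emeasurable_funM => //; apply: emeasurable_funM.
    exact: measurableT_comp mF mPhi.
  exact: measurableT_comp mD measurable_snd.
- apply: emeasurable_funM => //; apply: emeasurable_funM.
    exact: measurableT_comp mF mPhi.
  exact: measurableT_comp mDr mPhi.
- by move=> v; rewrite mule_ge0 ?lee_fin// mule_ge0.
- by move=> v; rewrite mule_ge0 ?lee_fin// mule_ge0.
- by apply: (ae_mp S2) => v ->.
Qed.

Lemma path_factor_law E : measurable E -> Lam (Phi @^-1` E) = alpha E.
Proof.
move=> mE; have [_ S1 _] := hPhi.
have CT : path_cyl (fun=> setT) 0 = [set: paths] by apply/seteqP; split.
rewrite -(integral_indic_pre Lam mPhi mE).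
transitivity (\int[Lam]_v ((\1_[set: paths] v.1)%:E * (\1_E (Phi v))%:E)).
  by apply: eq_integral => v _; rewrite indicT mul1e.
rewrite -CT (S1 (fun=> setT) 0%N (fun a => (\1_E a)%:E)) => [|//||a]; last by rewrite lee_fin.
  rewrite (eq_integral (cst (alpha E))).
    by rewrite integral_cst// [X in _ * X]probability_setT mule1.
  move=> w _; rewrite CT indicT mul1e -integral_setT_indic//.
  by apply: eq_integral => a _; rewrite /= act1.
exact: measurable_EFin_indic.
Qed.

Definition path_rects : set (set (paths * X)) :=
  [set C `*` D | C in @path_cyls _ Gs & D in measurable].

Lemma measurable_path_rects : @measurable _ (paths * X)%type = <<s path_rects >>.
Proof.
apply/seteqP; split; last first.
  apply: smallest_sub; first exact: sigma_algebra_measurable.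
  move=> _ [_ [U [n [mU ->]]] [D mD <-]]; apply: measurableX => //.
  exact: measurable_path_cyl.
have cT : @path_cyls _ Gs [set: paths].
  by exists (fun=> setT), 0%N; split => //; apply/seteqP; split.
rewrite measurable_rectangles; apply: smallest_sub; first exact: smallest_sigma_algebra.
move=> _ [E mE [D mD <-]]; rewrite -(setTI D) -(setIT E) setXI.
have mf1 : measurable_fun [set: g_sigma_algebraType path_rects]
    (fst : g_sigma_algebraType path_rects -> paths).
  apply: (measurability _ (@measurable_paths_cyls _ Gs)) => // _ [C cC <-].
  rewrite setTI; apply: sub_sigma_algebra; exists C => //; exists setT => //.
  by apply/seteqP; split => v //= -[].
apply: (@measurableI _ (g_sigma_algebraType path_rects)).
  rewrite (_ : E `*` setT = fst @^-1` E); first exact: measurable_pre mf1 mE.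
  by apply/seteqP; split => v //= -[].
by apply: sub_sigma_algebra; exists setT => //; exists D.
Qed.

Lemma path_rectsI : setI_closed path_rects.
Proof.
move=> _ _ [C cC [D mD <-]] [C' cC' [D' mD' <-]].
exists (C `&` C'); first exact: path_cylsI.
by exists (D `&` D'); [exact: measurableI|rewrite setXI].
Qed.

(** Cylinders times sets of [X] form a generating pi-system, so integrals over them determine an
    integrable function almost everywhere. *)
Lemma path_rects_ae_eq (u v : paths * X -> \bar R) :
  measurable_fun setT u -> measurable_fun setT v ->
  (forall x, 0 <= u x) -> (forall x, 0 <= v x) -> \int[Lam]_x u x < +oo ->
  (forall U n D, (forall i, measurable (U i)) -> measurable D ->
    \int[Lam]_x ((\1_(path_cyl U n) x.1)%:E * (u x * (\1_D x.2)%:E)) =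
    \int[Lam]_x ((\1_(path_cyl U n) x.1)%:E * (v x * (\1_D x.2)%:E))) ->
  {ae Lam, forall x, u x = v x}.
Proof.
move=> mu_ mv u0 v0 uoo H; apply: ae_eq_density => //.
have CT : path_cyl (fun=> setT) 0 = [set: paths] by apply/seteqP; split.
have e U n (D : set X) (w : paths * X -> \bar R) :
    \int[Lam]_x (w x * (\1_(path_cyl U n `*` D) x)%:E) =
    \int[Lam]_x ((\1_(path_cyl U n) x.1)%:E * (w x * (\1_D x.2)%:E)).
  apply: eq_integral => x _; rewrite muleCA; congr (_ * _).
  rewrite -EFinM !indicE -natrM mulnb; congr (_%:R%:E); congr nat_of_bool.
  by apply/idP/andP; rewrite !inE.
apply: (@density_unique R _ _ _ _ _ _ Lam Lam id id u v path_rects) => //.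
- exact: measurable_path_rects.
- exact: path_rectsI.
- have := H (fun=> setT) 0%N setT (fun=> measurableT) measurableT.
  have eT (w : paths * X -> \bar R) : \int[Lam]_x w x =
      \int[Lam]_x ((\1_[set: paths] x.1)%:E * (w x * (\1_[set: X] x.2)%:E)).
    by apply: eq_integral => x _; rewrite !indicT mul1e mule1.
  by rewrite CT -!eT.
- by move=> _ [_ [U [n [mU ->]]] [D mD <-]]; rewrite !e; exact: H.
Qed.

End factor_paths.

(** * [A] is ergodic and is generated by its components together with [X] *)

Section factor_structure.
Local Open Scope ereal_scope.
Context (R : realType) (k : nat) (Gs : 'I_k -> topGroupType) (hG : forall i, lcsc (Gs i)).
Local Notation G := (prod_group Gs).
Local Notation paths := (prodm (fun _ : nat => borel G)).
Variables (mu : probability (borel G) R) (mus : forall i, probability (borel (Gs i)) R).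
Hypothesis hprod : is_product_law
  (fun i (g : borel (prod_group Gs)) => g i : borel (Gs i)) mus mu.
Hypothesis hadm : admissible mu.
Variable (muN : probability paths R).
Variables (X : gspace G) (nu : probability X R).
Hypotheses (qiX : quasi_invariant nu) (stX : stationary mu nu) (ergX : ergodic nu).
Variables (A : gspace G) (alpha : probability A R).
Hypotheses (qiA : quasi_invariant alpha) (stA : stationary mu alpha).
Variables (rho : A -> X) (hrho : gmap alpha nu rho).
Variables (Lam : probability (paths * X)%type R) (Phi : paths * X -> A).
Hypothesis hPhi : path_factor muN alpha rho Lam Phi.

Let mrho : measurable_fun setT rho. Proof. by case: hrho. Qed.
Let mPhi : measurable_fun setT Phi. Proof. by case: hPhi. Qed.
Let mrD (D : set X) : measurable D -> measurable (rho @^-1` D).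
Proof. exact: measurable_pre. Qed.

Let rho_act (g : G) (D : set X) : measurable D ->
  {ae alpha, forall a, (act g @^-1` (rho @^-1` D)) a <-> (rho @^-1` (act g @^-1` D)) a}.
Proof. by move=> mD; have [_ ra _] := hrho; apply: (ae_mp (ra g)) => a /= ->. Qed.

Lemma ae_exists d (T : measurableType d) (P : probability T R) (Q : T -> Prop) :
  {ae P, forall x, Q x} -> exists x, Q x.
Proof.
move=> [N [mN N0 sN]]; apply: contrapT => nQ.
have NT : N = setT by apply/seteqP; split => // x _; apply: sN => Qx; apply: nQ; exists x.
by have := oner_neq0 R; rewrite -eqe -(probability_setT P) -NT N0 eqxx.
Qed.

(** For an invariant [E], the law of [rho] on [E] is stationary, hence a multiple of [nu]: [E] is
    independent of [X]. Being also unaffected by the translations of the walk, its lift to path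
    space has constant conditional probability [alpha E] on all rectangles, so its indicator equals
    [alpha E] almost surely. *)
Lemma factor_ergodic : ergodic alpha.
Proof.
move=> E [mE Einv]; have [_ _ rhoE] := hrho.
have hc D : measurable D -> alpha (E `&` rho @^-1` D) = alpha E * nu D.
  move=> mD; have := @stationary_unique _ _ _ _ _ mu nu _ (@measurable_act _ X) stX
    (ergodic_zero_one hG hadm qiX ergX) (rlaw_finite alpha mE mrho).
  move=> /(_ _ _ D mD); rewrite [X in _ = X * _](_ : _ = alpha E); last first.
    by congr (alpha _); rewrite preimage_setT setIT.
  apply.
  - move=> F mF F0; have : alpha (rho @^-1` F) = 0 by rewrite rhoE.
    apply: null_subset; [|exact: mrD|exact: subIsetr].
    by apply: measurableI => //; exact: mrD.
  - move=> F mF; have mEF : measurable (E `&` rho @^-1` F).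
      by apply: measurableI => //; exact: mrD.
    rewrite -[RHS](stA mEF); apply: eq_integral => g _.
    rewrite -[LHS]/(alpha (E `&` rho @^-1` (act (g : G) @^-1` F))).
    apply: ae_measure_eq.
    + by apply: measurableI => //; apply: mrD; exact: measurable_act_pre.
    + exact: measurable_act_pre.
    have gE := setY_null_ae (measurable_act_pre _ mE) mE (Einv (g : G) Logic.I).
    apply: (ae_mp2 gE (rho_act (g : G) mF)) => a Ea ra.
    by split => -[? ?]; split; [apply/Ea|apply/ra|apply/Ea|apply/ra].
have aeE : {ae Lam, forall v, (\1_E (Phi v))%:E = alpha E}.
  apply: (path_rects_ae_eq (u := fun v => (\1_E (Phi v))%:E) (v := fun=> alpha E)).
  - exact: measurable_indic_comp.
  - exact: measurable_cst.
  - by move=> v; rewrite lee_fin.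
  - by move=> v; exact: measure_ge0.
  - by rewrite (integral_indic_pre Lam mPhi mE) (le_lt_trans (probability_le1 _ _)) ?ltry//; exact: measurable_pre.
  move=> U n D mU mD.
  have mD1 := measurable_EFin_indic (R := R) mD.
  have D0 (x : X) : 0 <= (\1_D x)%:E :> \bar R by rewrite lee_fin.
  rewrite (path_factor_integral hPhi mrho n (F := fun a => (\1_E a)%:E) mU _ _ mD1 D0); last 2 first.
  - exact: measurable_EFin_indic.
  - by move=> a; rewrite lee_fin.
  rewrite (path_factor_integral hPhi mrho n (F := fun=> alpha E) mU _ _ mD1 D0); last 2 first.
  - exact: measurable_cst.
  - by move=> a; exact: measure_ge0.
  apply: eq_integral => w _; congr (_ * _).
  set g := walk w n.
  have mgD : measurable (act g @^-1` D) by exact: measurable_act_pre.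
  have mEr : measurable (E `&` rho @^-1` D) by apply: measurableI => //; exact: mrD.
  transitivity (alpha E * nu (act g @^-1` D)).
    rewrite -hc//; transitivity (alpha (act g @^-1` (E `&` rho @^-1` D))).
      rewrite -(integral_indic_pre alpha (measurable_act_at g) mEr).
      apply: eq_integral => a _; rewrite -EFinM !indicE -natrM mulnb; congr (_%:R%:E).
      by congr nat_of_bool; apply/andP/idP; rewrite !inE.
    apply: ae_measure_eq.
    + exact: measurable_act_pre.
    + by apply: measurableI => //; exact: mrD.
    have gE := setY_null_ae (measurable_act_pre _ mE) mE (Einv g Logic.I).
    apply: (ae_mp2 gE (rho_act g mD)) => a Ea ra.
    by split => -[? ?]; split; [apply/Ea|apply/ra|apply/Ea|apply/ra].
  have m2 : measurable_fun setT (fun a => (\1_D (rho (act g a)))%:E : \bar R).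
    exact: (measurableT_comp mD1 (measurableT_comp mrho (measurable_act_at g))).
  rewrite (ge0_integralTZl alpha m2 (fun a => D0 _) (measure_ge0 _ _)); congr (_ * _).
  rewrite -rhoE//; transitivity (alpha (act g @^-1` (rho @^-1` D))).
    apply: ae_measure_eq; last by apply: (ae_mp (rho_act g mD)) => a; tauto.
      exact: mrD.
    by apply: measurable_act_pre; exact: mrD.
  by rewrite -(integral_indic_pre alpha (measurable_act_at g) (mrD mD)).
have [v] := ae_exists aeE.
by rewrite indicE; case: (_ \in _) => <-; [right|left].
Qed.

Variables (As : forall j, gspace (Gs j)) (alphas : forall j, probability (As j) R)
  (pA : forall j, A -> As j).
Hypothesis hAs : forall j, invariant_component alpha (alphas j) (pA j).

Let q (a : A) : gspace_pi As * X := (components pA a, rho a).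
Let mpA : measurable_fun setT (components pA).
Proof. exact: measurable_components hAs. Qed.
Let mq : measurable_fun setT q.
Proof. exact: (measurable_fun_pair mpA mrho). Qed.

(** With [e] the conditional probability of [E] given [q], both [1_E] and [e] composed with [q] have
    the same integrals over all rectangles of path space; they agree almost surely, so [E] is
    [e = 1] up to a null set. *)
Lemma factor_generated (E : set A) : measurable E ->
  exists2 E' : set (gspace_pi As * X), measurable E' &
    alpha (E `+` (fun a => (components pA a, rho a)) @^-1` E') = 0.
Proof.
move=> mE; have [e [me e0 eE]] := @cond_prob R _ _ _ _ alpha E q mE mq.
have meE : measurable_fun setT (fun a => (e (q a))%:E).
  by apply/measurable_EFinP; exact: measurableT_comp me mq.
have key (K : gspace_pi As * X -> \bar R) : measurable_fun setT K -> (forall y, 0 <= K y) ->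
    \int[alpha]_a ((\1_E a)%:E * K (q a)) = \int[alpha]_a ((e (q a))%:E * K (q a)).
  apply: density_integral => //; [exact: measurable_EFin_indic|by move=> a; rewrite lee_fin|].
  move=> D mD; rewrite -eE//.
  rewrite -integral_setT_indic; last by apply: measurableI => //; exact: measurable_pre.
  by apply: eq_integral => a _; rewrite indicI.
have aeE : {ae Lam, forall v, (\1_E (Phi v))%:E = (e (q (Phi v)))%:E}.
  apply: (path_rects_ae_eq (u := fun v => (\1_E (Phi v))%:E) (v := fun v => (e (q (Phi v)))%:E)).
  - exact: measurable_indic_comp.
  - exact: measurableT_comp meE mPhi.
  - by move=> v; rewrite lee_fin.
  - by move=> v; rewrite lee_fin.
  - by rewrite (integral_indic_pre Lam mPhi mE) (le_lt_trans (probability_le1 _ _)) ?ltry//; exact: measurable_pre.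
  move=> U n D mU mD.
  have mD1 := measurable_EFin_indic (R := R) mD.
  have D0 (x : X) : 0 <= (\1_D x)%:E :> \bar R by rewrite lee_fin.
  rewrite (path_factor_integral hPhi mrho n (F := fun a => (\1_E a)%:E) mU _ _ mD1 D0); last 2 first.
  - exact: measurable_EFin_indic.
  - by move=> a; rewrite lee_fin.
  rewrite (path_factor_integral hPhi mrho n (F := fun a => (e (q a))%:E) mU _ _ mD1 D0); last 2 first.
  - exact: meE.
  - by move=> a; rewrite lee_fin.
  apply: eq_integral => w _; congr (_ * _).
  set g := walk w n.
  (* Translation by [g] costs a density that depends on the components only; multiplied by the test
     on [rho] it is a function of [q], against which [E] may be replaced by [e]. *)
  have [r [mr r0 rE]] := action_density hG hprod hadm qiA stA factor_ergodic hAs g.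
  have mDr : measurable_fun setT (fun a => (\1_D (rho a))%:E : \bar R).
    exact: measurableT_comp mD1 mrho.
  pose K (y : gspace_pi As * X) := (r y.1)%:E * (\1_D y.2)%:E.
  have mK : measurable_fun setT K.
    apply: emeasurable_funM; last exact: measurableT_comp mD1 measurable_snd.
    by apply/measurable_EFinP; exact: measurableT_comp mr measurable_fst.
  have K0 y : 0 <= K y by rewrite mule_ge0// lee_fin.
  rewrite (rE (fun a => (\1_E a)%:E * (\1_D (rho a))%:E)); last 2 first.
  - by apply: emeasurable_funM => //; exact: measurable_EFin_indic.
  - by move=> a; rewrite mule_ge0// lee_fin.
  rewrite (rE (fun a => (e (q a))%:E * (\1_D (rho a))%:E)); last 2 first.
  - exact: emeasurable_funM.
  - by move=> a; rewrite mule_ge0// lee_fin.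
  transitivity (\int[alpha]_a ((\1_E a)%:E * K (q a))).
    by apply: eq_integral => a _; rewrite muleCA.
  rewrite key//; apply: eq_integral => a _; by rewrite muleCA.
pose E' := e @^-1` [set 1%R].
have mE' : measurable E' by apply: measurable_pre => //; exact: measurable_set1.
exists E' => //.
have mY : measurable (E `+` q @^-1` E') by apply: measurable_setY => //; exact: measurable_pre.
rewrite -(path_factor_law hPhi mY).
apply: measure_negligible; first exact: measurable_pre.
have [N [mN N0 sN]] := aeE; exists N; split => // v /= vY; apply: sN => /= ev.
move: vY; rewrite indicE in ev; case=> -[] /=.
  by move=> Ev; apply; rewrite /E' /= /q; case: ev; rewrite mem_set.
by rewrite /E' /= => e1 nE; move: ev; rewrite memNset// e1 => -[] /eqP; rewrite eq_sym oner_eq0.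
Qed.

End factor_structure.

(** * Conditional independence of the components of [A] and of [X] *)

Section conditional_independence.
Local Open Scope ereal_scope.
Context (R : realType) (k : nat) (Gs : 'I_k -> topGroupType) (hG : forall i, lcsc (Gs i)).
Local Notation G := (prod_group Gs).
Local Notation paths := (prodm (fun _ : nat => borel G)).
Variables (mu : probability (borel G) R) (mus : forall i, probability (borel (Gs i)) R).
Hypothesis hprod : is_product_law
  (fun i (g : borel (prod_group Gs)) => g i : borel (Gs i)) mus mu.
Hypothesis hadm : admissible mu.
Variable (muN : probability paths R).
Variables (X : gspace G) (nu : probability X R).
Hypotheses (qiX : quasi_invariant nu) (stX : stationary mu nu) (ergX : ergodic nu).
Variables (A : gspace G) (alpha : probability A R).
Hypotheses (qiA : quasi_invariant alpha) (stA : stationary mu alpha) (ergA : ergodic alpha).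
Variables (rho : A -> X) (hrho : gmap alpha nu rho).
Variables (Lam : probability (paths * X)%type R) (Phi : paths * X -> A).
Hypothesis hPhi : path_factor muN alpha rho Lam Phi.
Variables (As : forall j, gspace (Gs j)) (alphas : forall j, probability (As j) R)
  (pA : forall j, A -> As j).
Hypothesis hAs : forall j, invariant_component alpha (alphas j) (pA j).
Variables (Xs : forall j, gspace (Gs j)) (nus : forall j, probability (Xs j) R)
  (pX : forall j, X -> Xs j).
Hypothesis hXs : forall j, invariant_component nu (nus j) (pX j).

Let mrho : measurable_fun setT rho. Proof. by case: hrho. Qed.
Let mPhi : measurable_fun setT Phi. Proof. by case: hPhi. Qed.
Let mpA j : measurable_fun setT (pA j). Proof. by have [[]] := hAs j. Qed.
Let zX : X -> gspace_pi Xs := components pX.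
Let mzX : measurable_fun setT zX. Proof. exact: measurable_components hXs. Qed.

Let mrz (r : gspace_pi Xs -> R) : measurable_fun setT r ->
  measurable_fun setT (fun x => (r (zX x))%:E).
Proof. by move=> mr; apply/measurable_EFinP; exact: measurableT_comp mr mzX. Qed.

(** [F] times the image of [alpha] under any [g] projects to a measure on [X] whose density with
    respect to [nu] depends only on the components of [X]. *)
Definition fibred (F : A -> \bar R) := forall g : G, exists h : gspace_pi Xs -> R,
  [/\ measurable_fun setT h, (forall y, (0 <= h y)%R) &
    forall D : X -> \bar R, measurable_fun setT D -> (forall x, 0 <= D x) ->
      \int[alpha]_a (F (act g a) * D (rho (act g a))) =
      \int[nu]_x ((h (components pX x))%:E * D x)].

Let fibred1 : fibred (cst 1).
Proof.
move=> g; have [r [mr r0 rE]] := action_density hG hprod hadm qiX stX ergX hXs g.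
exists r; split => // D mD D0; rewrite -rE//.
have [_ ra rhoE] := hrho.
have mDg : measurable_fun setT (fun x => D (act g x)) by exact: measurableT_comp mD (measurable_act_at _).
rewrite -(integral_law mrho rhoE mDg (fun=> D0 _)).
apply: integral_ae_eq_ge0 => //.
- apply: emeasurable_funM => //.
  exact: (measurableT_comp mD (measurableT_comp mrho (measurable_act_at g))).
- exact: measurableT_comp mDg mrho.
- by move=> a; rewrite mul1e.
- by apply: (ae_mp (ra g)) => a ->; rewrite mul1e.
Qed.

(** Two densities multiply: that of [nu] under [g], and the conditional probability given [X] of a
    cofactor-invariant event. The latter is a function on [Xs j], evaluated after translating back
    by $g^{-1}$. *)
Let fibred_component j (E : set (As j)) : measurable E ->
  fibred (fun a => (\1_E (pA j a))%:E).
Proof.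
move=> mE g; have [_ ra rhoE] := hrho.
have [[_ _ _ pAinv _] _ pAact] := hAs j; have [hXj _ pXact] := hXs j.
(* Almost equal to the preimage under [g] of the event [E]; it is invariant under the cofactor since
   [pA j] is. *)
pose S := pA j @^-1` (act (g j) @^-1` E).
have mS : measurable S by apply: measurable_pre => //; exact: measurable_act_pre.
have invS : invariant_set (cofactor_subgroup j) alpha S.
  split => // h hj; apply: ae_setY_null => //; first exact: measurable_act_pre.
  by apply: (ae_mp (pAinv h hj)) => a; rewrite /S /= => ->.
have [r [mr r0 rE]] := invariant_set_density hG hprod hadm qiX stX ergX qiA stA ergA hrho hXj invS.
have [s [ms s0 sE]] := action_density hG hprod hadm qiX stX ergX hXs g.
have mpXj : measurable_fun setT (pX j) by have [] := hXj.
have mS1 := measurable_EFin_indic (R := R) mS.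
have mrp : measurable_fun setT (fun x => (r (pX j x))%:E).
  by apply/measurable_EFinP; exact: measurableT_comp mr mpXj.
have key (K : X -> \bar R) : measurable_fun setT K -> (forall x, 0 <= K x) ->
    \int[alpha]_a ((\1_S a)%:E * K (rho a)) = \int[nu]_x ((r (pX j x))%:E * K x).
  apply: (@density_integral R _ _ _ _ _ _ alpha nu rho id) => //.
    by move=> a; rewrite lee_fin.
  move=> D mD; rewrite -rE//.
  have mrD : measurable (rho @^-1` D) by exact: measurable_pre.
  rewrite -integral_setT_indic; last exact: measurableI.
  by apply: eq_integral => a _; rewrite indicI.
have mtr : measurable_fun setT (fun y : gspace_pi Xs => act ((g^-1)%g j) (y j) : Xs j).
  exact: (measurableT_comp (measurable_act_at _) (@measurable_prodm_coord _ _ Xs j)).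
exists (fun y => s y * r (act ((g^-1)%g j) (y j)))%R; split.
- by apply: measurable_funM => //; exact: measurableT_comp mr mtr.
- by move=> y; rewrite mulr_ge0.
move=> D mD D0.
have mDg : measurable_fun setT (fun x => D (act g x)) by exact: measurableT_comp mD (measurable_act_at _).
transitivity (\int[alpha]_a ((\1_S a)%:E * D (act g (rho a)))).
  apply: integral_ae_eq_ge0 => //.
  - apply: emeasurable_funM.
      exact: (measurableT_comp (measurable_EFin_indic mE) (measurableT_comp (@mpA j) (measurable_act_at g))).
    exact: (measurableT_comp mD (measurableT_comp mrho (measurable_act_at g))).
  - by apply: emeasurable_funM => //; exact: (measurableT_comp mDg mrho).
  - by move=> a; rewrite mule_ge0// lee_fin.
  - by move=> a; rewrite mule_ge0// lee_fin.
  - by apply: (ae_mp2 (pAact g) (ra g)) => a ga ->; rewrite !indicE ga; congr (_ * _).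
rewrite (key (fun x => D (act g x)) mDg (fun=> D0 _)).
pose u x := (r (pX j (act g^-1%g x)))%:E * D x.
have mru : measurable_fun setT (fun x => (r (pX j (act g^-1%g x)))%:E).
  by apply/measurable_EFinP; exact: (measurableT_comp mr (measurableT_comp mpXj (measurable_act_at _))).
transitivity (\int[nu]_x u (act g x)).
  by apply: eq_integral => x _; rewrite /u -actM mulVg act1.
rewrite sE; last 2 first.
- exact: emeasurable_funM.
- by move=> x; rewrite mule_ge0// lee_fin.
apply: integral_ae_eq_ge0.
- by apply: emeasurable_funM; [exact: mrz|exact: emeasurable_funM].
- apply: emeasurable_funM => //.
  apply: (@mrz (fun y => s y * r (act ((g^-1)%g j) (y j)))%R).
  by apply: measurable_funM => //; exact: measurableT_comp mr mtr.
- by move=> x; rewrite mule_ge0 ?lee_fin// mule_ge0// lee_fin.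
- by move=> x; rewrite mule_ge0 ?lee_fin// mulr_ge0.
- by apply: (ae_mp (pXact (g^-1)%g)) => x gx; rewrite /u gx muleA -EFinM.
Qed.

Section given_set.
Variables (D : set X) (dD : gspace_pi Xs -> \bar R).
Hypotheses (mD : measurable D) (mdD : measurable_fun setT dD) (dD0 : forall y, 0 <= dD y).
Hypothesis dDE : forall S, measurable S ->
  nu (D `&` components pX @^-1` S) =
  \int[nu]_x (dD (components pX x) * (\1_S (components pX x))%:E).

Let mdz : measurable_fun setT (fun x => dD (zX x)). Proof. exact: measurableT_comp mdD mzX. Qed.
Let mD1 : measurable_fun setT (fun x : X => (\1_D x)%:E : \bar R).
Proof. exact: measurable_EFin_indic. Qed.
Let D10 (x : X) : 0 <= (\1_D x)%:E :> \bar R. Proof. by rewrite lee_fin. Qed.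

Let dD_integral (K : gspace_pi Xs -> \bar R) : measurable_fun setT K -> (forall y, 0 <= K y) ->
  \int[nu]_x ((\1_D x)%:E * K (zX x)) = \int[nu]_x (dD (zX x) * K (zX x)).
Proof.
apply: density_integral => // S mS; rewrite -dDE//.
rewrite -integral_setT_indic; last by apply: measurableI => //; exact: measurable_pre.
by apply: eq_integral => x _; rewrite indicI.
Qed.

(** After conditioning on the first [n] steps, all factors other than [D] depend on [X] through its
    components, so [D] may be replaced by [dD], its conditional probability given them. *)
Let fibred_swap F U n S : fibred F -> measurable_fun setT F -> (forall a, 0 <= F a) ->
  (forall i, measurable (U i)) -> measurable S ->
  \int[Lam]_v ((\1_(path_cyl U n) v.1)%:E * (F (Phi v) * ((\1_D v.2)%:E * (\1_S (zX v.2))%:E))) =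
  \int[Lam]_v ((\1_(path_cyl U n) v.1)%:E * (F (Phi v) * (dD (zX v.2) * (\1_S (zX v.2))%:E))).
Proof.
move=> fF mF F0 mU mS.
have mSz : measurable_fun setT (fun x => (\1_S (zX x))%:E : \bar R) by exact: measurable_indic_comp.
have p0 (x : X) : 0 <= (\1_D x)%:E * (\1_S (zX x))%:E :> \bar R by rewrite mule_ge0// lee_fin.
have p1 x : 0 <= dD (zX x) * (\1_S (zX x))%:E by rewrite mule_ge0// lee_fin.
have m1 := emeasurable_funM mD1 mSz; have m2 := emeasurable_funM mdz mSz.
rewrite (path_factor_integral hPhi mrho n mU mF F0 m1 p0).
rewrite (path_factor_integral hPhi mrho n mU mF F0 m2 p1).
apply: eq_integral => w _; congr (_ * _).
have [h [mh h0 hE]] := fF (walk w n).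
rewrite (hE _ m1 p0) (hE _ m2 p1).
pose K y := (h y)%:E * (\1_S y)%:E.
have mK : measurable_fun setT K.
  by apply: emeasurable_funM; [exact/measurable_EFinP|exact: measurable_EFin_indic].
have K0 y : 0 <= K y by rewrite mule_ge0// lee_fin.
transitivity (\int[nu]_x ((\1_D x)%:E * K (zX x))).
  by apply: eq_integral => x _; rewrite muleCA.
by rewrite dD_integral//; apply: eq_integral => x _; rewrite muleCA.
Qed.

Let qq (v : paths * X) : paths * gspace_pi Xs := (v.1, zX v.2).
Let mqq : measurable_fun setT qq.
Proof. exact: (measurable_fun_pair measurable_fst (measurableT_comp mzX measurable_snd)). Qed.

Let mD1v : measurable_fun setT (fun v : paths * X => (\1_D v.2)%:E : \bar R).
Proof. exact: measurableT_comp mD1 measurable_snd. Qed.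
Let mdv : measurable_fun setT (fun v : paths * X => dD (zX v.2)).
Proof. exact: measurableT_comp mdz measurable_snd. Qed.

(** Conditional independence, under [Lam], of the path and the point of [X] given the components of
    the point. It is [fibred_swap] for the constant function. *)
Lemma path_swap (K : paths * gspace_pi Xs -> \bar R) :
  measurable_fun setT K -> (forall y, 0 <= K y) ->
  \int[Lam]_v ((\1_D v.2)%:E * K (v.1, components pX v.2)) =
  \int[Lam]_v (dD (components pX v.2) * K (v.1, components pX v.2)).
Proof.
have e (u : paths * X -> \bar R) U n S :
    \int[Lam]_v (u v * (\1_(path_cyl U n `*` S) (qq v))%:E) =
    \int[Lam]_v ((\1_(path_cyl U n) v.1)%:E * (cst 1 (Phi v) * (u v * (\1_S (zX v.2))%:E))).
  apply: eq_integral => v _; rewrite mul1e muleCA; congr (_ * _).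
  rewrite -EFinM !indicE -natrM mulnb; congr (_%:R%:E); congr nat_of_bool.
  by apply/idP/andP; rewrite !inE.
have CT : path_cyl (fun=> setT) 0 = [set: paths] by apply/seteqP; split.
have sw U n S : (forall i, measurable (U i)) -> measurable S ->
    \int[Lam]_v ((\1_D v.2)%:E * (\1_(path_cyl U n `*` S) (qq v))%:E) =
    \int[Lam]_v (dD (zX v.2) * (\1_(path_cyl U n `*` S) (qq v))%:E).
  by move=> mU mS; rewrite !e; apply: fibred_swap.
have eT (u : paths * X -> \bar R) : \int[Lam]_v u v =
    \int[Lam]_v (u v * (\1_(path_cyl (fun=> setT) 0 `*` setT) (qq v))%:E).
  by apply: eq_integral => v _; rewrite CT setXTT indicT mule1.
apply: (@density_integral R _ _ _ _ _ _ Lam Lam qq qq) => //.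
apply: (@density_unique R _ _ _ _ _ _ Lam Lam qq qq _ _ (@path_rects _ Gs (gspace_pi Xs))) => //.
- rewrite (integral_indic_pre Lam measurable_snd mD) (le_lt_trans (probability_le1 _ _)) ?ltry//.
  exact: measurable_pre measurable_snd mD.
- exact: measurable_path_rects.
- exact: path_rectsI.
- by rewrite eT [RHS]eT; apply: sw.
- by move=> _ [_ [U [n [mU ->]]] [S mS <-]]; exact: sw.
Qed.

Lemma component_swap j (E : set (As j)) U n : measurable E -> (forall i, measurable (U i)) ->
  \int[Lam]_v ((\1_(path_cyl U n) v.1)%:E * ((\1_E (pA j (Phi v)))%:E * (\1_D v.2)%:E)) =
  \int[Lam]_v ((\1_(path_cyl U n) v.1)%:E * ((\1_E (pA j (Phi v)))%:E * dD (components pX v.2))).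
Proof.
move=> mE mU; have mF : measurable_fun setT (fun a => (\1_E (pA j a))%:E : \bar R).
  exact: measurable_indic_comp.
have F0 (a : A) : 0 <= (\1_E (pA j a))%:E :> \bar R by rewrite lee_fin.
have := fibred_swap n (fibred_component mE) mF F0 mU (@measurableT _ (gspace_pi Xs)).
have eT (u : paths * X -> \bar R) : \int[Lam]_v ((\1_(path_cyl U n) v.1)%:E *
    ((\1_E (pA j (Phi v)))%:E * (u v * (\1_[set: gspace_pi Xs] (zX v.2))%:E))) =
    \int[Lam]_v ((\1_(path_cyl U n) v.1)%:E * ((\1_E (pA j (Phi v)))%:E * u v)).
  by apply: eq_integral => v _; rewrite indicT mule1.
by rewrite (eT (fun v => (\1_D v.2)%:E)) (eT (fun v => dD (zX v.2))).
Qed.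

End given_set.

(** The indicator of the lifted event is compared on rectangles with its conditional probability [H]
    given the path and the components of the point of [X]; they agree almost surely, so [H] takes
    the values 0 and 1 and the event is a function of these data. *)
Lemma component_path_measurable j (E : set (As j)) : measurable E ->
  exists2 E' : set (paths * gspace_pi Xs), measurable E' &
    {ae Lam, forall v, E (pA j (Phi v)) <-> E' (v.1, components pX v.2)}.
Proof.
move=> mE; pose qq (v : paths * X) : paths * gspace_pi Xs := (v.1, zX v.2).
have mqq : measurable_fun setT qq.
  exact: (measurable_fun_pair measurable_fst (measurableT_comp mzX measurable_snd)).
pose F v := E (pA j (Phi v)).
have mF : measurable F.
  exact: (measurable_pre (measurableT_comp (@mpA j) mPhi) mE).
have [H [mH H0 HE]] := @cond_prob R _ _ _ _ Lam F qq mF mqq.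
have mF1 := measurable_EFin_indic (R := R) mF.
have mHq : measurable_fun setT (fun v => (H (qq v))%:E).
  by apply/measurable_EFinP; exact: measurableT_comp mH mqq.
have key (K : paths * gspace_pi Xs -> \bar R) : measurable_fun setT K -> (forall y, 0 <= K y) ->
    \int[Lam]_v ((\1_F v)%:E * K (qq v)) = \int[Lam]_v ((H (qq v))%:E * K (qq v)).
  apply: density_integral => //.
    by move=> v; rewrite lee_fin.
  move=> S mS; rewrite -HE//.
  rewrite -integral_setT_indic; last by apply: measurableI => //; exact: measurable_pre.
  by apply: eq_integral => v _; rewrite indicI.
have ae1 : {ae Lam, forall v, (\1_F v)%:E = (H (qq v))%:E}.
  apply: path_rects_ae_eq.
  - exact: mF1.
  - exact: mHq.
  - by move=> v; rewrite lee_fin.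
  - by move=> v; rewrite lee_fin.
  - by rewrite (integral_setT_indic Lam mF) (le_lt_trans (probability_le1 _ _)) ?ltry.
  move=> U n D mU mD.
  have [d [md d0 dE]] := @cond_prob R _ _ _ _ nu D zX mD mzX.
  have mdE : measurable_fun setT (fun y => (d y)%:E) by exact/measurable_EFinP.
  have d0E y : 0 <= (d y)%:E by rewrite lee_fin.
  (* [D] is exchanged for its conditional probability [d]; the event is then integrated against a
     function of path and components and may be exchanged for [H]; finally [path_swap] restores
     [D]. *)
  transitivity (\int[Lam]_v ((\1_(path_cyl U n) v.1)%:E * ((\1_F v)%:E * (d (zX v.2))%:E))).
    have eF v : \1_F v = \1_E (pA j (Phi v)) :> R.
      by rewrite !indicE; congr (_%:R); congr nat_of_bool; apply/idP/idP; rewrite !inE.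
    transitivity (\int[Lam]_v ((\1_(path_cyl U n) v.1)%:E *
        ((\1_E (pA j (Phi v)))%:E * (\1_D v.2)%:E))).
      by apply: eq_integral => v _; rewrite eF.
    rewrite (component_swap mD mdE d0E dE n mE mU).
    by apply: eq_integral => v _; rewrite eF.
  have mC1 := measurable_EFin_indic (R := R) (measurable_path_cyl n mU).
  pose K (y : paths * gspace_pi Xs) := (\1_(path_cyl U n) y.1)%:E * (d y.2)%:E.
  have mK : measurable_fun setT K.
    apply: emeasurable_funM; first exact: measurableT_comp mC1 measurable_fst.
    exact: measurableT_comp mdE measurable_snd.
  have K0 y : 0 <= K y by rewrite mule_ge0// lee_fin.
  transitivity (\int[Lam]_v ((\1_F v)%:E * K (qq v))).
    by apply: eq_integral => v _; rewrite muleCA.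
  rewrite key//.
  pose K' (y : paths * gspace_pi Xs) := (H y)%:E * (\1_(path_cyl U n) y.1)%:E.
  have mK' : measurable_fun setT K'.
    apply: emeasurable_funM; first exact/measurable_EFinP.
    exact: measurableT_comp mC1 measurable_fst.
  have K'0 y : 0 <= K' y by rewrite mule_ge0// lee_fin.
  have sw := path_swap mD mdE d0E dE mK' K'0.
  transitivity (\int[Lam]_v ((d (zX v.2))%:E * K' (qq v))).
    by apply: eq_integral => v _; rewrite /K /K' muleA muleC.
  rewrite -[LHS]sw; apply: eq_integral => v _.
  by rewrite /K' muleC muleAC muleC muleA.
exists (H @^-1` [set 1%R]); first by apply: measurable_pre => //; exact: measurable_set1.
apply: (ae_mp ae1) => v; rewrite indicE => -[Hv]; rewrite /= -[components pX v.2]/(zX v.2) -/(qq v) -Hv.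
have [Fv|Fv] := pselect (F v); first by rewrite mem_set.
by rewrite memNset//; split => // /eqP; rewrite eq_sym oner_eq0.
Qed.

(** Each event [E j] is a function of the path and the components of the point of [X], hence so is
    their intersection, and [path_swap] applies to it. *)
Lemma factor_cond_indep (E : forall j, set (As j)) (D : set X) (dD : gspace_pi Xs -> \bar R) :
  (forall j, measurable (E j)) -> measurable D ->
  measurable_fun setT dD -> (forall y, 0 <= dD y) ->
  (forall S, measurable S -> nu (D `&` components pX @^-1` S) =
    \int[nu]_x (dD (components pX x) * (\1_S (components pX x))%:E)) ->
  alpha ([set a | forall j, E j (pA j a)] `&` rho @^-1` D) =
  \int[alpha]_a ((\1_[set a | forall j, E j (pA j a)] a)%:E * dD (components pX (rho a))).
Proof.
move=> mE mD mdD dD0 dDE; set P := [set a | _].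
have mP : measurable P.
  rewrite (_ : P = \bigcap_(j in [set: 'I_k]) (pA j @^-1` E j)).
    by apply: fin_bigcap_measurable => // j _; exact: measurable_pre.
  by apply/seteqP; split => a /= Pa j; [move=> _; exact: Pa|exact: Pa].
have /choice[E' E'P] j : exists E' : set (paths * gspace_pi Xs), measurable E' /\
    {ae Lam, forall v, E j (pA j (Phi v)) <-> E' (v.1, components pX v.2)}.
  by have [E' mE' E'E] := component_path_measurable (mE j); exists E'.
pose P' : set (paths * gspace_pi Xs) := \bigcap_(j in [set: 'I_k]) E' j.
have mP' : measurable P'.
  by apply: fin_bigcap_measurable => // j _; exact: (E'P j).1.
have aeP : {ae Lam, forall v, P (Phi v) <-> P' (v.1, zX v.2)}.
  have : {ae Lam, forall v j, E j (pA j (Phi v)) <-> E' j (v.1, components pX v.2)}.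
    by apply: filter_forall => j; exact: (E'P j).2.
  move/ae_mp; apply => v H; split => [Pv j _|P'v j]; first exact/H/Pv.
  by apply/H; exact: P'v.
have mP1 := measurable_EFin_indic (R := R) mP.
(* Moves integrals over the box from [A] to path space, where it becomes the event [P'] of path and
   components. *)
have lift (f : X -> \bar R) : measurable_fun setT f -> (forall x, 0 <= f x) ->
    \int[alpha]_a ((\1_P a)%:E * f (rho a)) =
    \int[Lam]_v (f v.2 * (\1_P' (v.1, zX v.2))%:E).
  move=> mf f0; have [_ _ S2] := hPhi.
  have mfr : measurable_fun setT (fun a => f (rho a)) by exact: measurableT_comp mf mrho.
  rewrite -(integral_law mPhi (path_factor_law hPhi) (emeasurable_funM mP1 mfr)); last first.
    by move=> a; rewrite mule_ge0// lee_fin.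
  apply: integral_ae_eq_ge0.
  - exact: (measurableT_comp (emeasurable_funM mP1 mfr) mPhi).
  - apply: emeasurable_funM; first exact: measurableT_comp mf measurable_snd.
    exact: (measurableT_comp (measurable_EFin_indic mP') (measurable_fun_pair measurable_fst
      (measurableT_comp mzX measurable_snd))).
  - by move=> v; rewrite mule_ge0// lee_fin.
  - by move=> v; rewrite mule_ge0// lee_fin.
  apply: (ae_mp2 aeP S2) => v Pv ->; rewrite muleC; congr (_ * _).
  rewrite !indicE; congr (_%:R%:E); congr nat_of_bool.
  by apply/idP/idP; rewrite !inE => /Pv.
have mP'1 := measurable_EFin_indic (R := R) mP'.
have sw := path_swap mD mdD dD0 dDE mP'1 (fun y => _).
rewrite (lift (fun x => dD (zX x))); [|exact: measurableT_comp mdD mzX|by []].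
rewrite -[RHS]sw; last by move=> y; rewrite lee_fin.
rewrite -(lift (fun x => (\1_D x)%:E)); [|exact: measurable_EFin_indic|by move=> x; rewrite lee_fin].
rewrite -integral_setT_indic; last by apply: measurableI => //; exact: measurable_pre.
by apply: eq_integral => a _; rewrite indicI.
Qed.

End conditional_independence.

(** * Identification of the joining and the isomorphism *)

Section assembly.
Local Open Scope ereal_scope.
Context (R : realType).

Lemma probability_eq_pi d (T : measurableType d) (P Q : probability T R) (C : set (set T)) :
  @measurable _ T = <<s C >> -> setI_closed C -> (forall E, C E -> P E = Q E) ->
  forall E, measurable E -> P E = Q E.
Proof.
move=> TC CI PQ.
have mC E : C E -> measurable E by rewrite TC => CE; exact: sub_sigma_algebra.
have e (M : probability T R) E : measurable E ->
    \int[M]_x (cst 1 x * (\1_E (id x))%:E) = M E.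
  by move=> mE; rewrite -(integral_setT_indic M mE); apply: eq_integral => x _; rewrite mul1e.
have c1 (M : probability T R) : \int[M]_x cst 1 x = 1.
  by rewrite integral_cst// [X in _ * X]probability_setT mule1.
move=> E mE; rewrite -(e P E mE) -(e Q E mE).
apply: (@density_unique R _ _ _ _ _ _ P Q id id (cst 1) (cst 1) C) => //.
- by rewrite c1 ltry.
- by rewrite !c1.
- by move=> D CD; rewrite !e; [exact: PQ|exact: mC|exact: mC].
Qed.

Lemma ae_plaw d (T : measurableType d) d' (S : measurableType d') (P : probability T R)
    (q : T -> S) (mq : measurable_fun setT q) (D : S -> Prop) :
  measurable [set y | D y] -> {ae P, forall x, D (q x)} -> {ae plaw P mq, forall y, D y}.
Proof.
move=> mD Dq; exists (~` [set y | D y]); split => //; first exact: measurableC.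
apply: (@measure_negligible _ _ _ P (q @^-1` (~` [set y | D y]))) => //.
by apply: measurable_pre => //; exact: measurableC.
Qed.

Section box_rectangles.
Context (I : finType) (e : I -> measure_display) (V : forall i, measurableType (e i))
  d (X : measurableType d).

Definition box_rects : set (set (prodm V * X)) :=
  [set S | exists (E : forall i, set (V i)) (D : set X),
     [/\ forall i, measurable (E i), measurable D & S = [set a | forall i, E i (a i)] `*` D]].

Lemma measurable_prodm_box (E : forall i, set (V i)) : (forall i, measurable (E i)) ->
  measurable [set a : prodm V | forall i, E i (a i)].
Proof.
move=> mE; rewrite (_ : [set a | _] = \bigcap_(i in [set: I]) ((fun a : prodm V => a i) @^-1` E i)).
  apply: fin_bigcap_measurable => // i _.
  exact: measurable_pre (@measurable_prodm_coord _ _ V i) (mE i).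
by apply/seteqP; split => a H i; [move=> _; exact: H|exact: H].
Qed.

Lemma box_rectsI : setI_closed box_rects.
Proof.
move=> _ _ [E [D [mE mD ->]]] [E' [D' [mE' mD' ->]]].
exists (fun i => E i `&` E' i), (D `&` D'); split.
- by move=> i; exact: measurableI.
- exact: measurableI.
apply/seteqP; split => [[a x] [[/= Ea Dx] [/= E'a D'x]]|[a x] [/= Ea [Dx D'x]]].
  by split.
by split; split => //= i; have [] := Ea i.
Qed.

Lemma measurable_box_rects : @measurable _ (prodm V * X)%type = <<s box_rects >>.
Proof.
apply/seteqP; split; last first.
  apply: smallest_sub; first exact: sigma_algebra_measurable.
  move=> _ [E [D [mE mD ->]]]; apply: measurableX => //; exact: measurable_prodm_box.
rewrite measurable_rectangles; apply: smallest_sub; first exact: smallest_sigma_algebra.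
move=> _ [E mE [D mD <-]]; rewrite -(setTI D) -(setIT E) setXI.
have mf1 : measurable_fun [set: g_sigma_algebraType box_rects]
    (fst : g_sigma_algebraType box_rects -> prodm V).
  apply: (@measurability _ _ _ (prodm V) _ _ (cylinders V)) => // _ [_ [i [B [mB ->]]] <-].
  rewrite setTI; apply: sub_sigma_algebra.
  (* A one-coordinate cylinder is the box whose side at [i] is [B] and whose other sides are
     full. *)
  exists (@eqtype.dfwith I (fun l => set (V l)) (fun=> setT) i B), setT; split => //.
    by move=> l; case: eqtype.dfwithP.
  apply/seteqP; split => [[a x] /= Ba|[a x] [/= H _]].
    by split => //= l; case: eqtype.dfwithP.
  by have := H i; rewrite eqtype.dfwith_in.
apply: (@measurableI _ (g_sigma_algebraType box_rects)).
  rewrite (_ : E `*` setT = fst @^-1` E); first exact: measurable_pre mf1 mE.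
  by apply/seteqP; split => v //= -[].
apply: sub_sigma_algebra; exists (fun=> setT), D; split => //.
by congr (_ `*` _); apply/seteqP; split.
Qed.

End box_rectangles.

End assembly.

Theorem theorem2p3 (R : realType) (k : nat) (hk : (1 < k)%N)
    (Gs : 'I_k -> topGroupType) (hG : forall i, lcsc (Gs i))
    (mu : probability (borel (prod_group Gs)) R)
    (mus : forall i, probability (borel (Gs i)) R)
    (hprod : is_product_law
      (fun i (g : borel (prod_group Gs)) => g i : borel (Gs i)) mus mu)
    (hadm : admissible mu)
    (muN : probability (prodm (fun _ : nat => borel (prod_group Gs))) R)
    (hmuN : is_iid_law mu muN)
    (X : gspace (prod_group Gs)) (nu : probability X R)
    (hX : gmu_space mu nu) (hXerg : ergodic nu)
    (B : gspace (prod_group Gs)) (beta : probability B R)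
    (hB : poisson_boundary mu muN beta)
    (lambda : probability (gspace_prod B X) R)
    (hlambda : stationary_joining muN beta nu lambda)
    (A : gspace (prod_group Gs)) (alpha : probability A R)
    (hA : gmu_space mu alpha)
    (phi : gspace_prod B X -> A) (hphi : gmap lambda alpha phi)
    (rho : A -> X) (hrho : gmap alpha nu rho)
    (hcomp : {ae lambda, forall z, rho (phi z) = z.2})
    (As : forall j, gspace (Gs j)) (alphas : forall j, probability (As j) R)
    (pA : forall j, A -> As j)
    (hAs : forall j, invariant_component alpha (alphas j) (pA j))
    (Xs : forall j, gspace (Gs j)) (nus : forall j, probability (Xs j) R)
    (pX : forall j, X -> Xs j)
    (hXs : forall j, invariant_component nu (nus j) (pX j))
    (rhos : forall j, As j -> Xs j)
    (hrhos : forall j, gmap (alphas j) (nus j) (rhos j))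
    (hfun : forall j, {ae alpha, forall a, rhos j (pA j a) = pX j (rho a)}) :
  exists (prodalpha : probability (gspace_pi As) R)
         (prodnu : probability (gspace_pi Xs) R)
         (J : probability (gspace_prod (gspace_pi As) X) R),
    [/\ is_product_law (fun j (a : gspace_pi As) => a j) alphas prodalpha,
        is_product_law (fun j (x : gspace_pi Xs) => x j) nus prodnu,
        relative_independent_joining prodalpha nu prodnu
          (fun a j => rhos j (a j)) (fun x j => pX j x) J &
        gspace_isomorphic alpha J].
Proof.
have [sA qiA stA] := hA; have [sX qiX stX] := hX; have [mrho rhoact rhoE] := hrho.
have [Lam [Phi hPhi]] := path_factor_of_joining hG hmuN sX hB hlambda hphi hrho hcomp.
have ergA := factor_ergodic hG hadm qiX stX hXerg stA hrho hPhi.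
have mpA := measurable_components hAs; have mzX := measurable_components hXs.
have mq : measurable_fun setT (fun a => (components pA a, rho a) : gspace_prod (gspace_pi As) X).
  exact: measurable_fun_pair mpA mrho.
set q := (fun a => _) in mq.
have mpAj j : measurable_fun setT (pA j) by have [[]] := hAs j.
have mrj j : measurable_fun setT (rhos j) by have [] := hrhos j.
pose prodalpha : probability (gspace_pi As) R := plaw alpha mpA.
pose prodnu : probability (gspace_pi Xs) R := plaw nu mzX.
pose J : probability (gspace_prod (gspace_pi As) X) R := plaw alpha mq.
pose p (a : gspace_pi As) : gspace_pi Xs := fun j => rhos j (a j).
have mp : measurable_fun setT p.
  apply: measurable_prodm => j.
  exact: (measurableT_comp (mrj j) (@measurable_prodm_coord _ _ As j)).
have ppA : {ae alpha, forall a, p (components pA a) = components pX (rho a)}.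
  have : {ae alpha, forall a j, rhos j (pA j a) = pX j (rho a)}.
    by apply: filter_forall => j; exact: hfun.
  by move/ae_mp; apply => a H; apply: functional_extensionality_dep => j; exact: H.
have mzr : measurable_fun setT (fun a => components pX (rho a)) by exact: measurableT_comp mzX mrho.
have zrE F : measurable F -> alpha ((fun a => components pX (rho a)) @^-1` F) = prodnu F.
  by move=> mF; rewrite /prodnu plawE -rhoE//; exact: measurable_pre.
have pE F : measurable F -> prodalpha (p @^-1` F) = prodnu F.
  move=> mF; rewrite -zrE// -[LHS]/(alpha (components pA @^-1` (p @^-1` F))).
  apply: ae_measure_eq.
  - exact: (measurable_pre (measurableT_comp mp mpA) mF).
  - exact: measurable_pre.
  - by apply: (ae_mp ppA) => a /= <-.
have [khat [mkhat khatE]] := disintegration_exists (zeta := prodnu) mzr zrE sA.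
have [kappa' [mkappa' kappa'E]] := disintegration_exists (alpha := nu) (zeta := prodnu) mzX (fun _ _ => erefl) sX.
(* Fibre measures of [prodalpha] over the product of the [Xs], as images of those of [alpha]; the
   two projections agree almost everywhere by [ppA]. *)
pose kappa z : probability (gspace_pi As) R := plaw (khat z) mpA.
have mkappa E : measurable E -> measurable_fun setT (kappa ^~ E).
  by move=> mE; apply: mkhat; exact: measurable_pre.
exists prodalpha, prodnu, J; split.
- exact: (components_independent hG hprod hadm qiA stA ergA hAs).
- exact: (components_independent hG hprod hadm qiX stX hXerg hXs).
- split.
  + split => //.
    move=> g; have : {ae prodalpha, forall a j, rhos j (act (g j) (a j)) = act (g j) (rhos j (a j))}.
      apply: filter_forall => j; have [_ rj _] := hrhos j.
      apply: (ae_law (Q := alphas j) (q := fun a : gspace_pi As => a j)) (rj (g j)).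
        exact: (@measurable_prodm_coord _ _ As j).
      by move=> E mE; have [[_ _ + _ _] _ _] := hAs j; exact.
    by move/ae_mp; apply => a H; apply: functional_extensionality_dep => j; exact: H.
  + split => //; first by move=> g; exact: (components_act hXs g).
  exists kappa, kappa'; split => //.
    split => // E F mE mF; rewrite [LHS]khatE//; last exact: measurable_pre.
    rewrite -[RHS]/(alpha (components pA @^-1` (E `&` p @^-1` F))).
    have mpE : measurable (components pA @^-1` E) by exact: measurable_pre.
    apply: ae_measure_eq.
    + by apply: measurableI => //; exact: measurable_pre.
    + by apply: measurableI => //; exact: (measurable_pre (measurableT_comp mp mpA) mF).
    + by apply: (ae_mp ppA) => a; rewrite /= => ->.
  pose K z : probability (gspace_pi As * X)%type R := (kappa z \x kappa' z)%E.
  have mK := measurable_prod_kernel mkappa mkappa'.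
  (* It suffices to compare the two laws on boxes times a set [D], where [factor_cond_indep] applies
     with [dD] the fibre measure of [D]. *)
  apply: (@probability_eq_pi R _ _ J (mixture prodnu (K := K) mK) (@box_rects _ _ As _ X)).
  + exact: measurable_box_rects.
  + exact: box_rectsI.
  move=> _ [E [D [mE mD ->]]].
  set P := [set a : gspace_pi As | forall j, E j (a j)].
  have mP : measurable P by exact: (@measurable_prodm_box _ _ As).
  have mkD := mkappa' _ mD.
  rewrite mixtureE -[LHS]/(alpha ([set a | forall j, E j (pA j a)] `&` rho @^-1` D)).
  rewrite (factor_cond_indep hG hprod hadm qiX stX hXerg qiA stA ergA hrho hPhi hAs hXs
    (dD := fun z => kappa' z D) mE mD mkD) => [|z|S mS]; last 2 first.
  - exact: measure_ge0.
  - rewrite -kappa'E// -(integral_mul_indic prodnu _ mS).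
    rewrite [LHS]integral_plaw//; first by apply: (ge0_measurable_mul_indic (q := id)).
    by move=> z; rewrite mule_ge0// lee_fin.
  have mS : measurable [set a | forall j, E j (pA j a)] by exact: (measurable_pre mpA mP).
  transitivity (\int[prodnu]_z (khat z [set a | forall j, E j (pA j a)] * kappa' z D))%E; last first.
    by apply: eq_integral => z _; rewrite [RHS](prod_probE (kappa z) (kappa' z)).
  set S := [set a | _] in mS *.
  apply: (@density_integral R _ _ _ _ _ _ alpha prodnu (fun a => components pX (rho a)) id
    (fun a => (\1_S a)%:E) (fun z => khat z S) _ _ _ _ _ _ _ (fun z => kappa' z D)) => //.
  + exact: measurable_EFin_indic.
  + exact: mkhat.
  + move=> F mF; rewrite [RHS]integral_mul_indic// khatE//.
    rewrite -integral_setT_indic; last by apply: measurableI => //; exact: measurable_pre.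
    by apply: eq_integral => a _; rewrite indicI.
(* Construction of the inverse: each bit of a point of [A] is, up to a null set, an event of [q],
   and [s] decodes these bits measurably on the whole joining. *)
have [bit [s [mbit bitK ms]]] := standard_borel_bits sA.
have /choice[bit' bit'P] n : exists E' : set (gspace_prod (gspace_pi As) X), measurable E' /\
    alpha (bit n `+` q @^-1` E') = 0%E.
  have [E' mE' E'0] := factor_generated hG hprod hadm qiX stX hXerg qiA stA hrho hPhi hAs (mbit n).
  by exists E'.
pose h y := s (fun n => `[< bit' n y >]).
have mh : measurable_fun setT h by apply: ms => n; exact: (bit'P n).1.
have hq : {ae alpha, forall a, h (q a) = a}.
  have : {ae alpha, forall a n, bit n a <-> bit' n (q a)}.
    apply: ae_all_nat => n; apply: setY_null_ae (mbit n) _ (bit'P n).2.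
    exact: measurable_pre mq (bit'P n).1.
  move/ae_mp; apply => a H; rewrite -[RHS]bitK; congr s; apply/funext => n.
  by apply/asboolP/asboolP => /H.
pose W := gspace_prod (gspace_pi As) X.
have qact g : {ae alpha, forall a, q (act g a) = @act _ W g (q a)}.
  by apply: (ae_mp2 (components_act hAs g) (rhoact g)) => a; rewrite /q => -> ->.
have mact g : measurable_fun setT (@act _ W g).
  exact: measurable_act_at.
exists q, h; split.
- by split.
- split => //.
    move=> g; apply: ae_plaw.
      apply: (measurable_standard_eq sA); first exact: measurableT_comp mh (mact g).
      exact: (measurableT_comp (measurable_act_at g) mh).
    (* Equivariance of [h] at [q a] uses [h (q a) = a] both at [a] and at its translate;
       quasi-invariance transports the null set. *)
    have hqg := ae_act qiA g hq.
    apply: (ae_mp2 (qact g) (filterI hq hqg)) => a qa [ha hga].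
    by rewrite -qa hga ha.
  move=> E mE; rewrite -[LHS]/(alpha (q @^-1` (h @^-1` E))); apply: ae_measure_eq => //.
    exact: (measurable_pre (measurableT_comp mh mq) mE).
  by apply: (ae_mp hq) => a /= ->.
- exact: hq.
- apply: ae_plaw; last by apply: (ae_mp hq) => a ->.
  (* The set where [q (h y) = y] is measurable because equality can be tested coordinate by
     coordinate in standard Borel spaces. *)
  rewrite (_ : [set y | _] = [set y | rho (h y) = y.2] `&`
      \bigcap_(j in [set: 'I_k]) [set y : gspace_pi As * X | pA j (h y) = y.1 j]).
    apply: measurableI.
      by apply: (measurable_standard_eq sX) => //; exact: measurableT_comp mrho mh.
    apply: fin_bigcap_measurable => // j _; have [[sAj _ _ _ _] _ _] := hAs j.
    apply: (measurable_standard_eq sAj); first exact: (measurableT_comp (mpAj j) mh).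
    exact: (measurableT_comp (@measurable_prodm_coord _ _ As j) measurable_fst).
  apply/seteqP; split => y /=.
    move=> qy; split; first exact: (congr1 (fun y' : gspace_pi As * X => y'.2) qy).
    by move=> j _; exact: (congr1 (fun y' : gspace_pi As * X => y'.1 j) qy).
  case: y => a x [/= hx H]; rewrite /q hx; congr pair.
  by apply: functional_extensionality_dep => j; exact: (H j Logic.I).
Qed.
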